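(* Let $\delta\in\mathbb{R}$. The positive zeros $a'_{\nu,\delta,k}$ of $j'_{\nu,\delta}$ satisfy the following bounds. (1) If $\nu\ge|\delta|$ and $k\ge2$, then $$a'_{\nu,\delta,k}>\sqrt{\nu^2+\pi^2\left(k-\frac54\right)^2}.$$ (2) If $\nu\ge|\delta|$ and $k$ is sufficiently large, then $$\pi\left(k+\frac\nu2-\frac12\right)<h_\nu^{-1}(k)<a'_{\nu,\delta,k}<h_\nu^{-1}\left(k+\frac38\right)<\pi\left(k+\frac\nu2+\frac12\right),$$ where $h_\nu(x)=xg(\nu/x)$.
   Context: $J_\nu$ is the Bessel function of the first kind of order $\nu$ and $j_{\nu,\delta}(x)=x^{-\delta}J_\nu(x)$ for $x>0$. For $\nu\ge|\delta|$, the positive zeros of $j_{\nu,\delta}'$ are simple and are listed in increasing order as $a'_{\nu,\delta,k}$, with the index $k$ beginning with $k=0$ if $\nu>|\delta|$ and with $k=1$ if $\nu=|\delta|$. $g(x)=\left(\sqrt{1-x^2}-x\arccos x\right)/\pi$ for $0\le x\le1$, and $h_\nu$ is a strictly increasing function from $[\nu,\infty)$ onto $[0,\infty)$ (with $h_0(x)=x/\pi$); $h_\nu^{-1}$ is its inverse function.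
   Formalization: Part (2) fails with the stated numbering when δ = −ν < 0 (e.g. ν = 1/2, where j is a multiple of sin x and a'_k = π(k−1/2)); that case is excluded from (2) and instead proved with a'_{ν,δ,k+1} in place of a'_{ν,δ,k}. *)

(* Defs.v *)
From Stdlib Require Import Reals Factorial ClassicalEpsilon.
From Coquelicot Require Import Coquelicot.
Open Scope R_scope.

(** Euler's integral; meaningful for [0 < s]. *)
Definition Gamma (s : R) : R :=
  RInt_gen (fun t => Rpower t (s - 1) * exp (- t))
    (at_right 0) (Rbar_locally p_infty).

(** Meaningful for [0 < x] and [-1 < nu]: [Rpower] requires a positive base,
    and [Gamma] a positive argument. *)
Definition BesselJ (nu x : R) : R :=
  Series (fun m : nat =>
    (-1) ^ m / (INR (fact m) * Gamma (INR m + nu + 1))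
    * Rpower (x / 2) (2 * INR m + nu)).

Definition j (nu delta x : R) : R := Rpower x (- delta) * BesselJ nu x.

Definition lists_pos_zeros (f : R -> R) (k0 : nat) (a : nat -> R) : Prop :=
  (forall k : nat, (k0 <= k)%nat -> 0 < a k /\ f (a k) = 0) /\
  (forall k : nat, (k0 <= k)%nat -> a k < a (S k)) /\
  (forall x : R, 0 < x -> f x = 0 -> exists k : nat, (k0 <= k)%nat /\ a k = x).

(** Used only when [Rabs delta <= nu], so that the second branch is the case
    [nu = Rabs delta]. *)
Definition first_index (nu delta : R) : nat :=
  if Rlt_dec (Rabs delta) nu then 0%nat else 1%nat.

(** The values at indices [k >= first_index nu delta] are determined, because an
    increasing listing is unique there.  [epsilon] returns an unspecified
    sequence when no listing exists, so a bound on [a' nu delta k] cannot hold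
    vacuously. *)
Definition a' (nu delta : R) : nat -> R :=
  epsilon (inhabits (fun _ : nat => 0))
    (lists_pos_zeros (Derive (j nu delta)) (first_index nu delta)).

Definition g (x : R) : R := (sqrt (1 - x ^ 2) - x * acos x) / PI.

Definition h (nu x : R) : R := x * g (nu / x).

(** The inverse of [h nu : [nu, +oo) -> [0, +oo)]. *)
Definition h_inv (nu y : R) : R :=
  epsilon (inhabits 0) (fun x : R => nu <= x /\ h nu x = y).

(* Main.v *)
(** Write [J] for the Bessel function, [N x = x J'(x)] and [Phi = PI * h nu], so that
    [Phi' = w / x] with [w = sqrt (x^2 - nu^2)].  The critical points of [x^(-delta) J]
    are the points where [N = delta * J].

    Counting.  The energy [N^2 + (x^2 - nu^2) J^2] has derivative [2 x J^2] and vanishes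
    at [0], hence is positive; so [N / J] is strictly decreasing between zeros of [J] and
    [N = delta * J] exactly once in each gap [(z_k, z_(k+1))] (and before [z_1] iff
    [delta < nu]).  In the variable [Phi], [sqrt w * J] oscillates faster than the sine and
    [N / sqrt w] more slowly; so the [k]-th zero of [J] satisfies [Phi (z_k) <= k PI], and
    the zero of [N] in the [k]-th gap has [Phi >= k PI].  As [Phi <= w], this gives the
    first bound, and it gives the index [k] in the others.

    Phase.  The real part [K] of the integral over [s > 0] of
    [exp (i x - 2 x s) (s (1 + i s))^(nu - 1/2)], turned by [nu PI / 2 + PI / 4], is
    proportional to [x^(-nu) J]: it solves the same equation, because the integrand of the
    equation is an exact derivative in [s], and it is recessive at [0].  By Laplace's
    method [K] behaves like [x^(-nu - 1/2) cos (x - nu PI / 2 - PI / 4)], so at large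
    zeros of [J], resp. of [N - delta J], the cosine, resp. the sine, is [O(1 / x)].  Since
    [Phi x = x - nu PI / 2 + O(1 / x)], these zeros have [Phi] near [(k - 1/4) PI], resp.
    [(k + 1/4) PI]. *)

Require Import Defs.
From Stdlib Require Import Reals Lra Lia Psatz Factorial Ranalysis5 Wf_nat.
From Stdlib Require Import Classical ClassicalEpsilon.
From Coquelicot Require Import Coquelicot.
Open Scope R_scope.
Set Bullet Behavior "Strict Subproofs".

(** [BesselJ] is only a power series, which says nothing directly about large [x], so its
    asymptotics must be transferred from an integral. The integral enters only truncated to
    [[1 / r, r]], and proportionality is used in a weak form: at each fixed [x], the Wronskian of
    the truncated integral with the power series tends to 0 as [r] grows. Where the series vanishes,
    or has a prescribed logarithmic derivative, the integral then satisfies the same relation up to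
    any error; neither the improper integral nor the constant of proportionality has to be
    identified. Asymptotics give [Phi] at a critical point only modulo [PI]; the Sturm bounds supply
    the multiple. Asking for a phase error below [PI / 8] gives a window around [k + 1/4], whose
    upper end is the constant [3/8]. The index of [a'] is the number of the gap, except for
    [delta = - nu < 0]: there a critical point precedes the first zero of [J] while the list begins
    at 1, so index [k + 1] belongs to gap [k]. Hence the chain for [S k] in that case; the first
    bound has room for both numberings. *)

Lemma is_derive_continuity_pt (f : R -> R) (x l : R) :
  is_derive f x l -> continuity_pt f x.
Proof.
  intros H. apply derivable_continuous_pt. exists l. now apply is_derive_Reals.
Qed.

Lemma is_derive_nonneg_le (f df : R -> R) (a b : R) :
  a <= b -> (forall x, a <= x <= b -> is_derive f x (df x)) ->
  (forall x, a <= x <= b -> 0 <= df x) -> f a <= f b.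
Proof.
  intros ab Hd Hp.
  destruct (MVT_gen f a b df) as [c [Hc E]];
    rewrite ?Rmin_left, ?Rmax_right in * by lra.
  - intros x Hx; apply Hd; lra.
  - intros x Hx. eapply is_derive_continuity_pt, Hd; lra.
  - specialize (Hp c Hc). nra.
Qed.

Lemma is_derive_pos_lt (f df : R -> R) (a b : R) :
  a < b -> (forall x, a <= x <= b -> is_derive f x (df x)) ->
  (forall x, a <= x <= b -> 0 < df x) -> f a < f b.
Proof.
  intros ab Hd Hp.
  destruct (MVT_gen f a b df) as [c [Hc E]];
    rewrite ?Rmin_left, ?Rmax_right in * by lra.
  - intros x Hx; apply Hd; lra.
  - intros x Hx. eapply is_derive_continuity_pt, Hd; lra.
  - specialize (Hp c Hc). nra.
Qed.

Lemma Rabs_sub_le_of_is_derive (f df : R -> R) (a b M : R) :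
  a <= b -> (forall x, a <= x <= b -> is_derive f x (df x)) ->
  (forall x, a <= x <= b -> Rabs (df x) <= M) ->
  Rabs (f b - f a) <= M * (b - a).
Proof.
  intros ab Hd Hp.
  destruct (MVT_gen f a b df) as [c [Hc E]];
    rewrite ?Rmin_left, ?Rmax_right in * by lra.
  - intros x Hx; apply Hd; lra.
  - intros x Hx. eapply is_derive_continuity_pt, Hd; lra.
  - rewrite E, Rabs_mult, (Rabs_right (b - a)) by lra.
    specialize (Hp c Hc). nra.
Qed.

(** * Real powers compared with exponentials *)

Lemma exp_le_exp (x y : R) : x <= y -> exp x <= exp y.
Proof. intros [H| ->]; [left; now apply exp_increasing | lra]. Qed.

Lemma Rpower_pos (x y : R) : 0 < Rpower x y.
Proof. apply exp_pos. Qed.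

Lemma is_derive_Rpower (b x : R) :
  0 < x -> is_derive (fun y => Rpower y b) x (b * Rpower x (b - 1)).
Proof.
  intros Hx. unfold Rpower. auto_derive; [lra|].
  replace ((b - 1) * ln x) with (b * ln x + - ln x) by ring.
  rewrite exp_plus, exp_Ropp, exp_ln by lra. field; lra.
Qed.

Lemma continuous_Rpower (b x : R) : 0 < x -> continuous (fun y => Rpower y b) x.
Proof.
  intros Hx. apply (ex_derive_continuous (fun y => Rpower y b)).
  eexists. now apply is_derive_Rpower.
Qed.

Lemma ln_le_self (t : R) : 0 < t -> ln t <= t.
Proof.
  intros Ht. pose proof (exp_ineq1_le (ln t)). rewrite exp_ln in H by lra. lra.
Qed.

(** Putting [t = c * y / b] in [ln t <= t] gives [b * ln y <= c * y + b * ln (b / c)], whence the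
    constant [(b / c) ^ b]. *)
Lemma Rpower_le_exp (b c : R) : 0 <= b -> 0 < c ->
  exists C, 0 < C /\ forall y, 0 < y -> Rpower y b <= C * exp (c * y).
Proof.
  intros Hb Hc. destruct Hb as [Hb|<-].
  - exists (Rpower (b / c) b). split; [apply Rpower_pos|].
    intros y Hy. unfold Rpower. rewrite <- exp_plus. apply exp_le_exp.
    assert (H : ln (c * y / b) <= c * y / b).
    { apply ln_le_self. apply Rdiv_lt_0_compat; nra. }
    assert (E : ln (c * y / b) = ln y - ln (b / c)).
    { replace (c * y / b) with (y / (b / c)) by (field; lra).
      apply ln_div; [lra|]. apply Rdiv_lt_0_compat; lra. }
    rewrite E in H. apply (Rmult_le_compat_l b) in H; [|lra].
    replace (b * (c * y / b)) with (c * y) in H by (field; lra). nra.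
  - exists 1. split; [lra|]. intros y Hy. unfold Rpower.
    rewrite Rmult_0_l, exp_0, Rmult_1_l, <- exp_0. apply exp_le_exp. nra.
Qed.

(* The eta-expanded form is the one that [auto_derive] leaves in its goals. *)
Lemma Derive_eta (f : R -> R) (x l : R) :
  is_derive f x l -> Derive (fun y : R => f y) x = l.
Proof. apply is_derive_unique. Qed.

(** * The Gamma function *)

Lemma ex_RInt_pos_halfline (f : R -> R) (a b : R) :
  (forall x, 0 < x -> continuous f x) -> 0 < a -> 0 < b -> ex_RInt f a b.
Proof.
  intros Hc Ha Hb. apply (ex_RInt_continuous f). intros z Hz. apply Hc.
  revert Hz. unfold Rmin. destruct (Rle_dec a b); lra.
Qed.

Lemma RInt_mono_bounds (f : R -> R) (a b a' b' : R) :
  (forall x, 0 < x -> continuous f x) -> (forall x, 0 < x -> 0 <= f x) ->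
  0 < a' -> a' <= a -> a <= b -> b <= b' -> RInt f a b <= RInt f a' b'.
Proof.
  intros Hc Hp H1 H2 H3 H4.
  assert (Hx : forall u v, 0 < u -> 0 < v -> ex_RInt f u v)
    by (intros; now apply ex_RInt_pos_halfline).
  rewrite <- (RInt_Chasles f a' a b') by (apply Hx; lra).
  rewrite <- (RInt_Chasles f a b b') by (apply Hx; lra).
  unfold plus; simpl.
  assert (0 <= RInt f a' a)
    by (apply RInt_ge_0; [lra | apply Hx; lra | intros; apply Hp; lra]).
  assert (0 <= RInt f b b')
    by (apply RInt_ge_0; [lra | apply Hx; lra | intros; apply Hp; lra]).
  lra.
Qed.

(** Integrals of a nonnegative function grow with the interval, so their supremum is the limit along
    the product filter. The bound by the supremum is kept because it later yields the positivity of
    [Gamma]. *)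
Lemma ex_is_RInt_gen_bounded (f : R -> R) (M : R) :
  (forall x, 0 < x -> continuous f x) -> (forall x, 0 < x -> 0 <= f x) ->
  (forall a b, 0 < a -> a <= b -> RInt f a b <= M) ->
  exists l, is_RInt_gen f (at_right 0) (Rbar_locally p_infty) l /\
            forall a b, 0 < a -> a <= b -> RInt f a b <= l.
Proof.
  intros Hc Hp HM.
  set (S := fun y => exists a b, 0 < a /\ a <= b /\ y = RInt f a b).
  destruct (completeness S) as [l [Hub Hl]].
  - exists M. intros y (a & b & Ha & Hb & ->). now apply HM.
  - exists (RInt f 1 1), 1, 1. lra.
  - exists l.
    assert (Hle : forall a b, 0 < a -> a <= b -> RInt f a b <= l).
    { intros a b Ha Hb. apply Hub. now exists a, b. }
    split; [|exact Hle].
    intros P [eps HP].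
    assert (Hex : exists a b, 0 < a /\ a <= b /\ l - eps < RInt f a b).
    { apply Classical_Prop.NNPP. intros Hn.
      assert (l <= l - eps).
      { apply Hl. intros y (a & b & Ha & Hb & ->).
        apply Rnot_lt_le. intros Hlt. apply Hn. now exists a, b. }
      destruct eps; simpl in *; lra. }
    destruct Hex as (a0 & b0 & Ha & Hb & Hab).
    apply (Filter_prod _ _ _ (fun a => 0 < a <= a0) (fun b => b0 < b)).
    + exists (mkposreal _ Ha). intros y Hy H0. unfold ball in Hy; simpl in Hy.
      unfold AbsRing_ball, abs, minus, plus, opp in Hy; simpl in Hy.
      rewrite Rabs_pos_eq in Hy; lra.
    + exists b0. auto.
    + intros a b [Ha1 Ha2] Hb2. simpl. exists (RInt f a b). split.
      * apply (RInt_correct f). apply ex_RInt_pos_halfline; auto; lra.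
      * apply HP. unfold ball; simpl.
        unfold AbsRing_ball, abs, minus, plus, opp; simpl.
        pose proof (Hle a b Ha1 ltac:(lra)).
        pose proof (RInt_mono_bounds f a0 b0 a b Hc Hp Ha1 Ha2 Hb ltac:(lra)).
        apply Rabs_def1; lra.
Qed.

Definition Gamma_integrand (s t : R) : R := Rpower t (s - 1) * exp (- t).

Lemma continuous_Gamma_integrand (s t : R) :
  0 < t -> continuous (Gamma_integrand s) t.
Proof.
  intros Ht. apply (continuous_mult (fun t => Rpower t (s - 1)) (fun t => exp (- t))).
  - now apply continuous_Rpower.
  - apply (ex_derive_continuous (fun t => exp (- t))). auto_derive. easy.
Qed.

Lemma Gamma_integrand_pos (s t : R) : 0 < Gamma_integrand s t.
Proof. apply Rmult_lt_0_compat; [apply Rpower_pos | apply exp_pos]. Qed.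

Lemma is_RInt_exp_half (a b : R) : a <= b ->
  is_RInt (fun t => exp (- (t / 2))) a b (2 * exp (- (a / 2)) - 2 * exp (- (b / 2))).
Proof.
  intros Hab.
  replace (2 * exp (- (a / 2)) - 2 * exp (- (b / 2))) with
    (minus (- 2 * exp (- (b / 2))) (- 2 * exp (- (a / 2))))
    by (unfold minus, plus, opp; simpl; ring).
  apply (is_RInt_derive (fun t => - 2 * exp (- (t / 2)))).
  - intros x _. auto_derive; [easy|]. unfold Rdiv. field.
  - intros x _. apply (ex_derive_continuous (fun t => exp (- (t / 2)))).
    auto_derive. easy.
Qed.

(** For [1 <= s] the power is bounded near 0, so [C * exp (- t / 2)] dominates on the whole
    half-line. The arguments [m + nu + 1] of the series stay in this range when [0 <= nu]. *)
Lemma Gamma_spec (s : R) : 1 <= s ->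
  is_RInt_gen (Gamma_integrand s) (at_right 0) (Rbar_locally p_infty) (Gamma s)
  /\ 0 < Gamma s.
Proof.
  intros Hs.
  destruct (Rpower_le_exp (s - 1) (1 / 2)) as [C [HC Hb]]; try lra.
  destruct (ex_is_RInt_gen_bounded (Gamma_integrand s) (C * 2)) as [l [Hl Hle]].
  - intros; now apply continuous_Gamma_integrand.
  - intros; left; apply Gamma_integrand_pos.
  - intros a b Ha Hab.
    apply Rle_trans with (RInt (fun t => C * exp (- (t / 2))) a b).
    + apply RInt_le; auto.
      * apply ex_RInt_pos_halfline; try lra.
        intros; now apply continuous_Gamma_integrand.
      * apply (ex_RInt_scal (fun t => exp (- (t / 2)))). eexists.
        now apply is_RInt_exp_half.
      * intros x Hx. unfold Gamma_integrand.
        replace (C * exp (- (x / 2))) with (C * exp (1 / 2 * x) * exp (- x)).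
        -- apply Rmult_le_compat_r; [left; apply exp_pos|]. apply Hb; lra.
        -- rewrite Rmult_assoc, <- exp_plus. do 2 f_equal. field.
    + assert (E : is_RInt (fun t => C * exp (- (t / 2))) a b
               (C * (2 * exp (- (a / 2)) - 2 * exp (- (b / 2))))).
      { apply (is_RInt_scal (fun t => exp (- (t / 2)))). now apply is_RInt_exp_half. }
      rewrite (is_RInt_unique _ _ _ _ E).
      apply Rmult_le_compat_l; [lra|].
      pose proof (exp_pos (- (b / 2))).
      assert (exp (- (a / 2)) <= 1) by (rewrite <- exp_0; apply exp_le_exp; lra).
      lra.
  - assert (E : Gamma s = l).
    { unfold Gamma. now apply is_RInt_gen_unique. }
    rewrite E. split; [exact Hl|].
    apply Rlt_le_trans with (RInt (Gamma_integrand s) 1 2); [|apply Hle; lra].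
    apply RInt_gt_0; [lra| |].
    + intros; apply Gamma_integrand_pos.
    + intros; apply continuous_Gamma_integrand; lra.
Qed.

(** Integration by parts in differential form: the derivative of [F = - t ^ s exp (- t)] is the
    first integrand minus [s] times the second, and [F] vanishes at both ends. *)
Lemma Gamma_succ (s : R) : 1 <= s -> Gamma (s + 1) = s * Gamma s.
Proof.
  intros Hs.
  set (F := fun t => - (Rpower t s * exp (- t))).
  assert (HF : forall t, 0 < t ->
    is_derive F t (Gamma_integrand (s + 1) t - s * Gamma_integrand s t)).
  { intros t Ht. unfold F, Gamma_integrand.
    replace (Rpower t (s + 1 - 1) * exp (- t) - s * (Rpower t (s - 1) * exp (- t)))
      with (opp (plus (mult (s * Rpower t (s - 1)) (exp (- t)))
                 (mult (Rpower t s) (- exp (- t)))))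
      by (replace (s + 1 - 1) with s by ring;
          unfold opp, plus, mult; simpl; ring).
    apply (is_derive_opp (fun t => Rpower t s * exp (- t))).
    apply (is_derive_mult (fun t => Rpower t s) (fun t => exp (- t))).
    - now apply is_derive_Rpower.
    - auto_derive; [easy|]. ring.
    - intros; apply Rmult_comm. }
  assert (Hpos : filter_prod (at_right 0) (Rbar_locally p_infty)
     (fun ab : R * R => 0 < Rmin (fst ab) (snd ab))).
  { apply (Filter_prod _ _ _ (fun a => 0 < a) (fun b => 0 < b)).
    - exists (mkposreal 1 Rlt_0_1). auto.
    - exists 0. auto.
    - intros x y Hx Hy; simpl. now apply Rmin_glb_lt. }
  assert (HD : is_RInt_gen (Derive F) (at_right 0) (Rbar_locally p_infty) (0 - 0)).
  { apply is_RInt_gen_Derive.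
    - refine (filter_imp _ _ _ Hpos). intros [a b] H x Hx. simpl in *.
      eexists. apply HF. lra.
    - refine (filter_imp _ _ _ Hpos). intros [a b] H x Hx. simpl in *.
      assert (Hx0 : 0 < x) by lra.
      apply (continuous_ext_loc (Derive F)
         (fun t => Gamma_integrand (s + 1) t - s * Gamma_integrand s t)).
      + exists (mkposreal x Hx0). intros y Hy. symmetry. apply is_derive_unique, HF.
        unfold ball in Hy; simpl in Hy.
        unfold AbsRing_ball, abs, minus, plus, opp in Hy; simpl in Hy.
        apply Rabs_def2 in Hy. lra.
      + apply (continuous_minus (Gamma_integrand (s + 1))
                 (fun t => s * Gamma_integrand s t)).
        * now apply continuous_Gamma_integrand.
        * apply (continuous_scal_r s (Gamma_integrand s)).
          now apply continuous_Gamma_integrand.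
    - apply filterlim_locally. intros eps.
      exists (mkposreal (Rmin 1 eps) (Rmin_glb_lt 1 eps 0 Rlt_0_1 (cond_pos eps))).
      intros y Hy H0. unfold ball in *; simpl in *.
      unfold AbsRing_ball, abs, minus, plus, opp in *; simpl in *.
      rewrite Rabs_pos_eq in Hy by lra.
      pose proof (Rmin_l 1 eps). pose proof (Rmin_r 1 eps).
      unfold F. replace (- (Rpower y s * exp (- y)) + - 0)
        with (- (Rpower y s * exp (- y))) by ring.
      rewrite Rabs_Ropp, Rabs_pos_eq.
      2: { left. apply Rmult_lt_0_compat; [apply Rpower_pos|apply exp_pos]. }
      apply Rle_lt_trans with (y * 1); [|lra].
      apply Rmult_le_compat; try (left; apply exp_pos).
      + replace s with (1 + (s - 1)) by ring. rewrite Rpower_plus, Rpower_1 by lra.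
        assert (Rpower y (s - 1) <= 1); [|nra].
        apply Rle_trans with (exp 0); [apply exp_le_exp | rewrite exp_0; lra].
        assert (ln y < 0) by (rewrite <- ln_1; apply ln_increasing; lra). nra.
      + rewrite <- exp_0. apply exp_le_exp. lra.
    - destruct (Rpower_le_exp s (1 / 2)) as [C [HC Hb]]; try lra.
      apply filterlim_locally. intros eps.
      (* Beyond this point [C * exp (y / 2) * exp (- y)] is less than [eps]. *)
      exists (Rmax 0 (- 2 * ln (eps / C))). intros y Hy.
      unfold ball in *; simpl in *.
      unfold AbsRing_ball, abs, minus, plus, opp in *; simpl in *.
      pose proof (Rmax_l 0 (- 2 * ln (eps / C))).
      pose proof (Rmax_r 0 (- 2 * ln (eps / C))).
      unfold F. replace (- (Rpower y s * exp (- y)) + - 0)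
        with (- (Rpower y s * exp (- y))) by ring.
      rewrite Rabs_Ropp, Rabs_pos_eq.
      2: { left. apply Rmult_lt_0_compat; [apply Rpower_pos|apply exp_pos]. }
      apply Rle_lt_trans with (C * exp (1 / 2 * y) * exp (- y)).
      { apply Rmult_le_compat_r; [left; apply exp_pos|]. apply Hb; lra. }
      rewrite Rmult_assoc, <- exp_plus.
      replace (pos eps) with (C * exp (ln (eps / C))).
      { apply Rmult_lt_compat_l; [lra|]. apply exp_increasing. lra. }
      rewrite exp_ln; [field; lra|]. apply Rdiv_lt_0_compat; [apply cond_pos|lra]. }
  destruct (Gamma_spec s Hs) as [H1 _].
  destruct (Gamma_spec (s + 1)) as [H2 _]; [lra|].
  assert (H3 := is_RInt_gen_minus _ _ _ _ H2 (is_RInt_gen_scal _ s _ H1)).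
  assert (HD' : RInt_gen (Derive F) (at_right 0) (Rbar_locally p_infty) = 0 - 0)
    by now apply is_RInt_gen_unique.
  assert (H4 : is_RInt_gen (Derive F) (at_right 0) (Rbar_locally p_infty)
      (minus (Gamma (s + 1)) (scal s (Gamma s)))).
  { refine (is_RInt_gen_ext _ _ _ _ H3).
    refine (filter_imp _ _ _ Hpos). intros [a b] H x Hx. simpl in *.
    symmetry. apply is_derive_unique. apply HF. lra. }
  assert (H5 : RInt_gen (Derive F) (at_right 0) (Rbar_locally p_infty) =
      minus (Gamma (s + 1)) (scal s (Gamma s))) by now apply is_RInt_gen_unique.
  rewrite HD' in H5.
  unfold minus, plus, opp, scal in H5; simpl in H5; unfold mult in H5; simpl in H5.
  lra.
Qed.

(** * The Bessel power series *)

(** Coefficients, in the variable [x ^ 2], of [J] divided by [(x / 2) ^ nu]; the powers of [/ 4]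
    come from [(x / 2) ^ 2]. *)
Definition bessel_coef (nu : R) (m : nat) : R :=
  (-1) ^ m / (INR (fact m) * Gamma (INR m + nu + 1)) * (/ 4) ^ m.

Lemma Gamma_shift_pos (nu : R) (m : nat) : 0 <= nu -> 0 < Gamma (INR m + nu + 1).
Proof. intros H. apply Gamma_spec. pose proof (pos_INR m). lra. Qed.

Lemma bessel_coef_neq0 (nu : R) (m : nat) : 0 <= nu -> bessel_coef nu m <> 0.
Proof.
  intros H. unfold bessel_coef. pose proof (Gamma_shift_pos nu m H).
  pose proof (INR_fact_neq_0 m).
  apply Rmult_integral_contrapositive_currified; [|apply pow_nonzero; lra].
  apply Rmult_integral_contrapositive_currified; [apply pow_nonzero; lra|].
  apply Rinv_neq_0_compat. apply Rmult_integral_contrapositive_currified; lra.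
Qed.

Lemma bessel_coef_succ (nu : R) (m : nat) : 0 <= nu ->
  bessel_coef nu (S m) = - bessel_coef nu m / (4 * (INR m + 1) * (INR m + nu + 1)).
Proof.
  intros H. unfold bessel_coef. pose proof (Gamma_shift_pos nu m H).
  pose proof (INR_fact_neq_0 m). pose proof (pos_INR m).
  rewrite S_INR.
  replace (INR m + 1 + nu + 1) with ((INR m + nu + 1) + 1) by ring.
  rewrite Gamma_succ by lra.
  rewrite fact_simpl, mult_INR, S_INR. simpl pow. field. repeat split; lra.
Qed.

Lemma CV_radius_bessel_coef (nu : R) : 0 <= nu -> CV_radius (bessel_coef nu) = p_infty.
Proof.
  intros H. apply CV_radius_infinite_DAlembert.
  - intros n. now apply bessel_coef_neq0.
  - apply is_lim_seq_le_le with (u := fun _ => 0) (w := fun n => / (INR n + 1)).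
    + intros n. pose proof (bessel_coef_neq0 nu n H). pose proof (pos_INR n).
      rewrite bessel_coef_succ by lra.
      replace (- bessel_coef nu n / (4 * (INR n + 1) * (INR n + nu + 1)) / bessel_coef nu n)
        with (- / (4 * (INR n + 1) * (INR n + nu + 1))) by (field; repeat split; lra).
      rewrite Rabs_Ropp.
      assert (0 < (INR n + 1) * (INR n + nu + 1)) by (apply Rmult_lt_0_compat; lra).
      rewrite Rabs_pos_eq by (left; apply Rinv_0_lt_compat; lra).
      split; [left; apply Rinv_0_lt_compat; lra|].
      apply Rinv_le_contravar; nra.
    + apply is_lim_seq_const.
    + apply (is_lim_seq_ext (fun n => / INR (S n))).
      { intros n. now rewrite S_INR. }
      apply is_lim_seq_incr_1 with (u := fun n => / INR n).
      replace (Finite 0) with (Rbar_inv p_infty) by easy.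
      apply is_lim_seq_inv; [apply is_lim_seq_INR | easy].
Qed.

Definition bessel_ps (nu z : R) : R := PSeries (bessel_coef nu) z.
Definition bessel_ps1 (nu z : R) : R := PSeries (PS_derive (bessel_coef nu)) z.

Lemma is_derive_bessel_ps (nu z : R) : 0 <= nu ->
  is_derive (bessel_ps nu) z (bessel_ps1 nu z).
Proof.
  intros H. apply is_derive_PSeries. now rewrite CV_radius_bessel_coef.
Qed.

(** Bessel's equation for [J / (x / 2) ^ nu], written in [z = x ^ 2]: it is the recurrence of the
    coefficients, compared term by term. *)
Lemma bessel_ps_ode (nu z : R) : 0 <= nu ->
  exists d, is_derive (bessel_ps1 nu) z d /\
    4 * z * d + 4 * (nu + 1) * bessel_ps1 nu z + bessel_ps nu z = 0.
Proof.
  intros H. set (a := bessel_coef nu). set (a1 := PS_derive a).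
  set (a2 := PS_derive a1).
  assert (R0 : CV_radius a = p_infty) by now apply CV_radius_bessel_coef.
  assert (R1 : CV_radius a1 = p_infty) by (unfold a1; now rewrite CV_radius_derive).
  assert (R2 : CV_radius a2 = p_infty) by (unfold a2; now rewrite CV_radius_derive).
  assert (E1 : ex_pseries a1 z) by (apply CV_radius_inside; now rewrite R1).
  assert (E2 : ex_pseries a2 z) by (apply CV_radius_inside; now rewrite R2).
  exists (PSeries a2 z). split.
  - apply is_derive_PSeries. fold a a1. now rewrite R1.
  - unfold bessel_ps, bessel_ps1. fold a a1.
    rewrite (PSeries_ext a (PS_opp (PS_plus (PS_scal 4 (PS_incr_1 a2))
                                   (PS_scal (4 * (nu + 1)) a1)))).
    + rewrite PSeries_opp, PSeries_plus, !PSeries_scal, PSeries_incr_1.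
      * ring.
      * apply ex_pseries_scal; [apply Rmult_comm|]. now apply ex_pseries_incr_1.
      * apply ex_pseries_scal; [apply Rmult_comm|easy].
    + intros n. unfold PS_opp, PS_plus, PS_scal, PS_incr_1, a2, a1, PS_derive, a.
      pose proof (pos_INR n).
      unfold opp, plus, scal; cbn -[INR]; unfold mult; cbn -[INR].
      destruct n as [|n].
      * rewrite bessel_coef_succ by lra. simpl. unfold zero; simpl. field. lra.
      * pose proof (pos_INR n).
        rewrite (bessel_coef_succ nu (S n)) by lra. rewrite !S_INR. fold a. field. lra.
Qed.

(** [J] without its factor [(x / 2) ^ nu]. It is smooth across 0 and positive there, so estimates
    near 0 reduce to the continuity of two power series. *)
Definition bessel_L (nu x : R) : R := bessel_ps nu (x ^ 2).
Definition bessel_L' (nu x : R) : R := 2 * x * bessel_ps1 nu (x ^ 2).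

Lemma is_derive_bessel_L (nu x : R) : 0 <= nu ->
  is_derive (bessel_L nu) x (bessel_L' nu x).
Proof.
  intros H. unfold bessel_L, bessel_L'.
  replace (2 * x * bessel_ps1 nu (x ^ 2)) with (scal (2 * x) (bessel_ps1 nu (x ^ 2)))
    by easy.
  apply (is_derive_comp (bessel_ps nu) (fun x => x ^ 2)).
  - now apply is_derive_bessel_ps.
  - auto_derive; [easy|]. ring.
Qed.

Lemma is_derive_bessel_L' (nu x : R) : 0 <= nu -> 0 < x ->
  is_derive (bessel_L' nu) x (- ((2 * nu + 1) / x) * bessel_L' nu x - bessel_L nu x).
Proof.
  intros H Hx. destruct (bessel_ps_ode nu (x ^ 2) H) as [d [Hd E]].
  assert (Hc : is_derive (fun x => bessel_ps1 nu (x ^ 2)) x (scal (2 * x) d)).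
  { apply (is_derive_comp (bessel_ps1 nu) (fun x => x ^ 2)); [easy|].
    auto_derive; [easy|]. ring. }
  assert (Hm := is_derive_mult (fun x => 2 * x) (fun x => bessel_ps1 nu (x ^ 2)) x
    2 (scal (2 * x) d) ltac:(auto_derive; [easy|]; ring) Hc (fun n m => Rmult_comm n m)).
  unfold bessel_L' at 1.
  replace (- ((2 * nu + 1) / x) * bessel_L' nu x - bessel_L nu x) with
    (plus (mult 2 (bessel_ps1 nu (x ^ 2))) (mult (2 * x) (scal (2 * x) d)));
    [exact Hm|].
  unfold bessel_L', bessel_L, plus, mult, scal; simpl; unfold mult; simpl.
  simpl in E. field_simplify; [|lra]. nra.
Qed.

Lemma BesselJ_eq (nu x : R) : 0 < x -> BesselJ nu x = Rpower (x / 2) nu * bessel_L nu x.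
Proof.
  intros Hx. unfold BesselJ, bessel_L, bessel_ps, PSeries.
  rewrite <- Series_scal_l. apply Series_ext. intros m.
  unfold bessel_coef. rewrite Rpower_plus.
  replace (Rpower (x / 2) (2 * INR m)) with ((/ 4) ^ m * (x ^ 2) ^ m); [ring|].
  rewrite <- Rpow_mult_distr.
  replace (2 * INR m) with (INR (2 * m)) by (rewrite mult_INR; simpl; ring).
  rewrite Rpower_pow by lra. rewrite pow_mult. f_equal. field.
Qed.

(** [J] solves Bessel's equation with [N x = x J'(x)], and it is the solution
    that behaves like [x ^ nu] at [0]. *)
Definition bessel_pair (nu : R) (J N : R -> R) : Prop :=
  0 <= nu /\
  (forall x, 0 < x -> is_derive J x (N x / x)) /\
  (forall x, 0 < x -> is_derive N x ((nu ^ 2 - x ^ 2) * J x / x)) /\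
  exists eta B, 0 < eta /\ forall x, 0 < x < eta ->
    0 < J x <= B /\ Rabs (N x - nu * J x) <= x ^ 2 * J x.

Definition bessel_N (nu x : R) : R :=
  Rpower (x / 2) nu * (nu * bessel_L nu x + x * bessel_L' nu x).

Lemma is_derive_Rpower_half (nu x : R) : 0 < x ->
  is_derive (fun x => Rpower (x / 2) nu) x (nu / x * Rpower (x / 2) nu).
Proof. intros Hx. unfold Rpower. auto_derive; [lra|]. unfold Rdiv; field; lra. Qed.

Lemma is_derive_BesselJ (nu x : R) : 0 <= nu -> 0 < x ->
  is_derive (BesselJ nu) x (bessel_N nu x / x).
Proof.
  intros H Hx.
  apply (is_derive_ext_loc (fun x => Rpower (x / 2) nu * bessel_L nu x)).
  - exists (mkposreal x Hx). intros y Hy. symmetry. apply BesselJ_eq.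
    unfold ball in Hy; simpl in Hy.
    unfold AbsRing_ball, abs, minus, plus, opp in Hy; simpl in Hy.
    apply Rabs_def2 in Hy. lra.
  - replace (bessel_N nu x / x) with
     (plus (mult (nu / x * Rpower (x / 2) nu) (bessel_L nu x))
           (mult (Rpower (x / 2) nu) (bessel_L' nu x)))
     by (unfold bessel_N, plus, mult; simpl; field; lra).
    apply (is_derive_mult (fun x => Rpower (x / 2) nu) (bessel_L nu)).
    + now apply is_derive_Rpower_half.
    + now apply is_derive_bessel_L.
    + intros; apply Rmult_comm.
Qed.

Lemma is_derive_bessel_N (nu x : R) : 0 <= nu -> 0 < x ->
  is_derive (bessel_N nu) x ((nu ^ 2 - x ^ 2) * BesselJ nu x / x).
Proof.
  intros H Hx. rewrite BesselJ_eq by easy.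
  assert (H1 := is_derive_bessel_L nu x H).
  assert (H2 := is_derive_bessel_L' nu x H Hx).
  assert (H3 := is_derive_Rpower_half nu x Hx).
  set (p := fun x => Rpower (x / 2) nu) in *. change (Rpower (x / 2) nu) with (p x) in *.
  unfold bessel_N.
  apply (is_derive_ext (fun x => p x * (nu * bessel_L nu x + x * bessel_L' nu x)));
    [easy|].
  set (L := bessel_L nu) in *. set (L1 := bessel_L' nu) in *.
  auto_derive.
  - repeat split; eexists; eassumption.
  - rewrite (Derive_eta _ _ _ H1), (Derive_eta _ _ _ H2), (Derive_eta p _ _ H3).
    field. lra.
Qed.

Lemma continuous_Rabs_lt (f : R -> R) (x eps : R) : continuous f x -> 0 < eps ->
  exists d, 0 < d /\ forall y, Rabs (y - x) < d -> Rabs (f y - f x) < eps.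
Proof.
  intros Hc He. destruct (proj1 (filterlim_locally _ _) Hc (mkposreal eps He)) as [d Hd].
  exists d. split; [apply cond_pos|]. intros y Hy. apply (Hd y Hy).
Qed.

Lemma bessel_L_near0 (nu : R) : 0 <= nu -> exists eta B, 0 < eta /\
  forall x, 0 < x < eta -> 0 < bessel_L nu x <= B /\
    Rabs (bessel_L' nu x) <= x * bessel_L nu x.
Proof.
  intros H. set (a := bessel_coef nu 0).
  assert (Ha : 0 < a).
  { unfold a, bessel_coef. simpl. pose proof (Gamma_shift_pos nu 0 H). simpl in *.
    rewrite Rmult_1_r, Rmult_1_l. apply Rdiv_lt_0_compat; lra. }
  assert (E0 : bessel_ps nu 0 = a) by apply PSeries_0.
  assert (E1 : bessel_ps1 nu 0 = - a / (4 * (nu + 1))).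
  { unfold bessel_ps1. rewrite PSeries_0. unfold PS_derive.
    rewrite bessel_coef_succ by lra. fold a. simpl. field. lra. }
  assert (E1b : Rabs (bessel_ps1 nu 0) <= a / 4).
  { rewrite E1. unfold Rdiv. rewrite Rabs_mult, Rabs_Ropp, (Rabs_pos_eq a) by lra.
    assert (0 < / (4 * (nu + 1))) by (apply Rinv_0_lt_compat; lra).
    rewrite Rabs_pos_eq by lra. apply Rmult_le_compat_l; [lra|].
    apply Rinv_le_contravar; lra. }
  (* With the tolerances [a / 4] and [a / 8], [L] exceeds [3 a / 4] while the modulus of [L'] is at
     most [2 x (a / 4 + a / 8) = 3 a x / 4], hence at most [x L]. *)
  destruct (continuous_Rabs_lt (bessel_ps nu) 0 (a / 4)) as [d1 [Hd1 H1]].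
  { apply (ex_derive_continuous (bessel_ps nu)). eexists. now apply is_derive_bessel_ps. }
  { lra. }
  destruct (continuous_Rabs_lt (bessel_ps1 nu) 0 (a / 8)) as [d2 [Hd2 H2]].
  { apply (ex_derive_continuous (bessel_ps1 nu)).
    destruct (bessel_ps_ode nu 0 H) as [d [Hd _]]. now exists d. }
  { lra. }
  exists (Rmin 1 (Rmin d1 d2)), (2 * a). split.
  { repeat apply Rmin_glb_lt; lra. }
  intros x [Hx Hx2].
  assert (x < 1 /\ x < d1 /\ x < d2).
  { pose proof (Rmin_l 1 (Rmin d1 d2)). pose proof (Rmin_r 1 (Rmin d1 d2)).
    pose proof (Rmin_l d1 d2). pose proof (Rmin_r d1 d2). lra. }
  assert (Hxx : 0 < x ^ 2 < x) by (simpl; nra).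
  specialize (H1 (x ^ 2)). specialize (H2 (x ^ 2)).
  rewrite Rminus_0_r, Rabs_pos_eq in H1, H2 by lra.
  specialize (H1 ltac:(lra)). specialize (H2 ltac:(lra)).
  rewrite E0 in H1. apply Rabs_def2 in H1. unfold bessel_L, bessel_L'.
  split; [lra|].
  pose proof (Rabs_triang (bessel_ps1 nu (x ^ 2) - bessel_ps1 nu 0) (bessel_ps1 nu 0)).
  replace (bessel_ps1 nu (x ^ 2) - bessel_ps1 nu 0 + bessel_ps1 nu 0)
    with (bessel_ps1 nu (x ^ 2)) in H3 by ring.
  rewrite !Rabs_mult, (Rabs_pos_eq 2), (Rabs_pos_eq x) by lra. nra.
Qed.

Lemma bessel_pair_BesselJ (nu : R) : 0 <= nu ->
  bessel_pair nu (BesselJ nu) (bessel_N nu).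
Proof.
  intros H. split; [easy|]. split; [|split].
  - intros; now apply is_derive_BesselJ.
  - intros; now apply is_derive_bessel_N.
  - destruct (bessel_L_near0 nu H) as (eta & B & He & Hb).
    exists (Rmin 1 eta), B. split; [apply Rmin_glb_lt; lra|].
    intros x [Hx Hx2]. pose proof (Rmin_l 1 eta). pose proof (Rmin_r 1 eta).
    destruct (Hb x ltac:(lra)) as [HL1 HL2].
    rewrite BesselJ_eq by easy. unfold bessel_N.
    pose proof (Rpower_pos (x / 2) nu).
    assert (Rpower (x / 2) nu <= 1).
    { unfold Rpower. rewrite <- exp_0. apply exp_le_exp.
      assert (ln (x / 2) < ln 1) by (apply ln_increasing; lra). rewrite ln_1 in *. nra. }
    split; [split|].
    + nra.
    + apply Rle_trans with (1 * bessel_L nu x); [|lra]. apply Rmult_le_compat_r; lra.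
    + replace (Rpower (x / 2) nu * (nu * bessel_L nu x + x * bessel_L' nu x) -
        nu * (Rpower (x / 2) nu * bessel_L nu x))
        with (Rpower (x / 2) nu * x * bessel_L' nu x) by ring.
      rewrite Rabs_mult, Rabs_pos_eq by nra.
      apply Rle_trans with (Rpower (x / 2) nu * x * (x * bessel_L nu x)); [|right; ring].
      apply Rmult_le_compat_l; nra.
Qed.

(** * The phase variable *)

Definition w (nu x : R) : R := sqrt (x ^ 2 - nu ^ 2).
Definition Phi (nu x : R) : R := PI * h nu x.

Lemma is_derive_acos (y : R) : -1 < y < 1 -> is_derive acos y (- / sqrt (1 - y ^ 2)).
Proof.
  intros Hy. apply is_derive_Reals.
  replace (- / sqrt (1 - y ^ 2)) with (-1 / sqrt (1 - y²)).
  - apply derive_pt_eq_1 with (derivable_pt_acos y Hy). apply derive_pt_acos.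
  - unfold Rsqr. replace (y * y) with (y ^ 2) by ring. field.
    apply Rgt_not_eq, sqrt_lt_R0. nra.
Qed.

Lemma w_pos (nu x : R) : 0 <= nu < x -> 0 < w nu x.
Proof. intros H. apply sqrt_lt_R0. nra. Qed.

Lemma w_sqr (nu x : R) : 0 <= nu <= x -> w nu x ^ 2 = x ^ 2 - nu ^ 2.
Proof. intros H. unfold w. rewrite pow2_sqrt; nra. Qed.

Lemma w_le (nu x : R) : 0 <= nu < x -> w nu x <= x.
Proof.
  intros H. pose proof (w_pos nu x H). pose proof (w_sqr nu x ltac:(lra)). nra.
Qed.

Lemma is_derive_w (nu x : R) : 0 <= nu < x -> is_derive (w nu) x (x / w nu x).
Proof.
  intros H. pose proof (w_pos nu x H) as Hw. unfold w in *.
  auto_derive; [nra|]. change (x * (x * 1)) with (x ^ 2). change (nu * (nu * 1)) with (nu ^ 2).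
  change (x ^ 2 + - nu ^ 2) with (x ^ 2 - nu ^ 2). field. lra.
Qed.

Lemma Phi_eq (nu x : R) : 0 <= nu <= x -> 0 < x -> Phi nu x = w nu x - nu * acos (nu / x).
Proof.
  intros H Hx. pose proof PI_RGT_0. unfold Phi, h, g.
  replace (PI * (x * ((sqrt (1 - (nu / x) ^ 2) - nu / x * acos (nu / x)) / PI)))
    with (x * sqrt (1 - (nu / x) ^ 2) - nu * acos (nu / x)) by (field; lra).
  f_equal. unfold w. rewrite <- (sqrt_pow2 x) at 1 by lra.
  rewrite <- sqrt_mult_alt by nra. f_equal. field. lra.
Qed.

Lemma ratio_lt_1 (nu x : R) : 0 <= nu < x -> 0 <= nu / x < 1.
Proof.
  intros H. split.
  - apply Rdiv_le_0_compat; lra.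
  - apply Rmult_lt_reg_r with x; [lra|]. unfold Rdiv.
    rewrite Rmult_assoc, Rinv_l; lra.
Qed.

Lemma locally_gt (x a : R) : a < x -> locally x (fun y => a < y).
Proof.
  intros H. assert (H0 : 0 < x - a) by lra. exists (mkposreal _ H0). intros y Hy.
  unfold ball in Hy; simpl in Hy.
  unfold AbsRing_ball, abs, minus, plus, opp in Hy; simpl in Hy.
  apply Rabs_def2 in Hy. lra.
Qed.

Lemma is_derive_Phi (nu x : R) : 0 <= nu < x -> is_derive (Phi nu) x (w nu x / x).
Proof.
  intros H. pose proof (w_pos nu x H) as Hw. pose proof (w_sqr nu x ltac:(lra)) as Hs.
  apply (is_derive_ext_loc (fun x => w nu x - nu * acos (nu / x))).
  { apply (filter_imp (fun y => nu < y)); [|apply locally_gt; lra].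
    intros y Hy. symmetry. apply Phi_eq; lra. }
  pose proof (ratio_lt_1 nu x H) as Hr.
  assert (H1 := is_derive_w nu x H).
  assert (H2 := is_derive_acos (nu / x) ltac:(lra)).
  assert (E : sqrt (1 - (nu / x) ^ 2) = w nu x / x).
  { unfold w. replace (1 - (nu / x) ^ 2) with ((x ^ 2 - nu ^ 2) / x ^ 2) by (field; lra).
    rewrite sqrt_div_alt by nra. now rewrite sqrt_pow2 by lra. }
  rewrite E in H2.
  auto_derive.
  - repeat split; try (eexists; eassumption); lra.
  - change (nu * / x) with (nu / x). rewrite (Derive_eta _ _ _ H1), (Derive_eta acos _ _ H2).
    transitivity ((x ^ 2 - nu ^ 2) / (w nu x * x)); [field; lra|].
    rewrite <- Hs. field. lra.
Qed.

Lemma Phi_incr (nu a b : R) : 0 <= nu < a -> a < b -> Phi nu a < Phi nu b.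
Proof.
  intros H Hab. apply (is_derive_pos_lt (Phi nu) (fun x => w nu x / x)); [lra| |].
  - intros x Hx. apply is_derive_Phi. lra.
  - intros x Hx. apply Rdiv_lt_0_compat; [apply w_pos|]; lra.
Qed.

(** With [t = acos (nu / x)] this is the nonnegativity of [g], because
    [PI * g (cos t) = sin t - t * cos t]. *)
Lemma mul_cos_le_sin (t : R) : 0 <= t <= PI -> t * cos t <= sin t.
Proof.
  intros H.
  assert (Hf : sin 0 - 0 * cos 0 <= sin t - t * cos t).
  { apply (is_derive_nonneg_le (fun t => sin t - t * cos t) (fun t => t * sin t)); [lra| |].
    - intros x Hx. auto_derive; [easy|]. ring.
    - intros x Hx. apply Rmult_le_pos; [lra|]. apply sin_ge_0; lra. }
  rewrite sin_0 in Hf. lra.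
Qed.

Lemma Phi_nonneg (nu x : R) : 0 <= nu < x -> 0 <= Phi nu x.
Proof.
  intros H. pose proof (ratio_lt_1 nu x H) as Hr. pose proof PI_RGT_0.
  unfold Phi, h, g. apply Rmult_le_pos; [lra|]. apply Rmult_le_pos; [lra|].
  apply Rdiv_le_0_compat; [|lra].
  pose proof (acos_bound (nu / x)) as Hb.
  pose proof (mul_cos_le_sin _ Hb) as Hm.
  rewrite cos_acos in Hm by lra. rewrite sin_acos in Hm by lra.
  unfold Rsqr in Hm. replace (nu / x * (nu / x)) with ((nu / x) ^ 2) in Hm by ring. lra.
Qed.

Lemma Phi_pos (nu x : R) : 0 <= nu < x -> 0 < Phi nu x.
Proof.
  intros H. apply Rle_lt_trans with (Phi nu ((nu + x) / 2)).
  - apply Phi_nonneg. lra.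
  - apply Phi_incr; lra.
Qed.

Lemma Phi_le_w (nu x : R) : 0 <= nu < x -> Phi nu x <= w nu x.
Proof.
  intros H. rewrite Phi_eq by lra. pose proof (acos_bound (nu / x)). nra.
Qed.

(** One [nu ^ 2 / x] comes from [x - w = nu ^ 2 / (x + w)]; the other two come from the slope of
    [acos], at most 2 on [[0, 1/2]], which is where [2 * nu <= x] puts [nu / x]. *)
Lemma Phi_asymp (nu x : R) : 0 <= nu < x -> 2 * nu <= x ->
  Rabs (Phi nu x - (x - nu * (PI / 2))) <= 3 * nu ^ 2 / x.
Proof.
  intros H Hx. rewrite Phi_eq by lra.
  pose proof (w_pos nu x H) as Hw. pose proof (w_sqr nu x ltac:(lra)) as Hs.
  pose proof (w_le nu x H) as Hl.
  assert (Hy : 0 <= nu / x <= 1 / 2).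
  { split; [apply ratio_lt_1; lra|]. apply Rmult_le_reg_r with x; [lra|].
    unfold Rdiv at 1. rewrite Rmult_assoc, Rinv_l; lra. }
  assert (Ha : Rabs (acos (nu / x) - acos 0) <= 2 * (nu / x - 0)).
  { apply (Rabs_sub_le_of_is_derive _ (fun y => - / sqrt (1 - y ^ 2))); [lra| |].
    - intros y Hy2. apply is_derive_acos. lra.
    - intros y Hy2. rewrite Rabs_Ropp.
      assert (1 / 2 <= sqrt (1 - y ^ 2)).
      { apply Rsqr_incr_0_var; [|apply sqrt_pos]. rewrite Rsqr_sqrt by nra.
        unfold Rsqr. nra. }
      rewrite Rabs_pos_eq by (left; apply Rinv_0_lt_compat; lra).
      replace 2 with (/ (1 / 2)) by field. apply Rinv_le_contravar; lra. }
  rewrite acos_0 in Ha.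
  assert (Hd : 0 <= x - w nu x <= nu ^ 2 / x).
  { split; [lra|]. apply Rmult_le_reg_r with x; [lra|].
    unfold Rdiv. rewrite Rmult_assoc, Rinv_l by lra. nra. }
  replace (3 * nu ^ 2 / x) with (nu ^ 2 / x + nu * (2 * (nu / x - 0))) by (field; lra).
  replace (w nu x - nu * acos (nu / x) - (x - nu * (PI / 2)))
    with (- (x - w nu x) + - (nu * (acos (nu / x) - PI / 2))) by ring.
  eapply Rle_trans; [apply Rabs_triang|]. rewrite !Rabs_Ropp, Rabs_mult.
  rewrite (Rabs_pos_eq nu) by lra. rewrite (Rabs_pos_eq (x - _)) by lra.
  apply Rplus_le_compat; [lra|]. apply Rmult_le_compat_l; lra.
Qed.

Lemma Phi_unbounded (nu M : R) : 0 <= nu ->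
  exists X, nu < X /\ forall x, X <= x -> M < Phi nu x.
Proof.
  intros H. exists (2 * nu + 1 + nu * (PI / 2) + 3 * nu ^ 2 + Rabs M). 
  pose proof PI_RGT_0. pose proof (Rabs_pos M). pose proof (Rle_abs M).
  split; [nra|]. intros x Hx. 
  assert (0 <= nu * (PI / 2)) by nra. assert (0 <= nu ^ 2) by nra.
  pose proof (Phi_asymp nu x ltac:(lra) ltac:(lra)) as Ha.
  assert (3 * nu ^ 2 / x <= 3 * nu ^ 2).
  { unfold Rdiv. rewrite <- (Rmult_1_r (3 * nu ^ 2)) at 2.
    apply Rmult_le_compat_l; [lra|]. rewrite <- Rinv_1. apply Rinv_le_contravar; lra. }
  pose proof (Rle_abs (- (Phi nu x - (x - nu * (PI / 2))))). rewrite Rabs_Ropp in *. lra.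
Qed.

(** * Oscillation *)

(** The differential system alone, stable under a change of sign: the Sturm comparison is applied to
    [- J] and [- N] as well. *)
Definition bessel_system (nu : R) (J N : R -> R) : Prop :=
  0 <= nu /\
  (forall x, 0 < x -> is_derive J x (N x / x)) /\
  (forall x, 0 < x -> is_derive N x ((nu ^ 2 - x ^ 2) * J x / x)).

Lemma bessel_pair_system nu J N : bessel_pair nu J N -> bessel_system nu J N.
Proof. intros (H1 & H2 & H3 & _). split; [|split]; auto. Qed.

Lemma bessel_system_opp nu J N :
  bessel_system nu J N -> bessel_system nu (fun x => - J x) (fun x => - N x).
Proof.
  intros (H1 & H2 & H3). split; [easy|]. split; intros x Hx.
  - replace (- N x / x) with (opp (N x / x)) by (unfold opp; simpl; field; lra).
    now apply (is_derive_opp J), H2.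
  - replace ((nu ^ 2 - x ^ 2) * - J x / x) with (opp ((nu ^ 2 - x ^ 2) * J x / x))
      by (unfold opp; simpl; field; lra).
    now apply (is_derive_opp N), H3.
Qed.

Definition energy (nu : R) (J N : R -> R) (x : R) : R :=
  N x ^ 2 + (x ^ 2 - nu ^ 2) * J x ^ 2.

Lemma is_derive_energy nu J N x : bessel_system nu J N -> 0 < x ->
  is_derive (energy nu J N) x (2 * x * J x ^ 2).
Proof.
  intros (H0 & H1 & H2) Hx. specialize (H1 x Hx). specialize (H2 x Hx).
  unfold energy. auto_derive.
  - repeat split; eexists; eassumption.
  - rewrite (Derive_eta _ _ _ H1), (Derive_eta _ _ _ H2). field. lra.
Qed.

Lemma energy_pos nu J N x : bessel_pair nu J N -> 0 < x -> 0 < energy nu J N x.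
Proof.
  intros HP Hx. assert (HS := bessel_pair_system _ _ _ HP).
  destruct HP as (H0 & _ & _ & eta & B & He & Hn).
  assert (Hmono : forall a b, 0 < a -> a <= b -> energy nu J N a <= energy nu J N b).
  { intros a b Ha Hab.
    apply (is_derive_nonneg_le _ (fun x => 2 * x * J x ^ 2)); [lra| |].
    - intros y Hy. apply is_derive_energy; [easy|lra].
    - intros y Hy. apply Rmult_le_pos; [lra|]. apply pow2_ge_0. }
  assert (Hstr : forall a b, 0 < a -> a < b -> b < eta ->
    energy nu J N a < energy nu J N b).
  { intros a b Ha Hab Hb.
    apply (is_derive_pos_lt _ (fun x => 2 * x * J x ^ 2)); [lra| |].
    - intros y Hy. apply is_derive_energy; [easy|lra].
    - intros y Hy. destruct (Hn y ltac:(lra)) as [Hj _].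
      apply Rmult_lt_0_compat; [lra|]. apply pow_lt. lra. }
  assert (HB : 0 < B) by (destruct (Hn (eta / 2) ltac:(lra)); lra).
  assert (Hge : forall y, 0 < y -> 0 <= energy nu J N y).
  { intros y Hy. apply Rnot_lt_le. intros Hneg.
    (* With [d = N - nu * J] the energy is [d ^ 2 + 2 nu d J + t ^ 2 J ^ 2]. Since the modulus of
       [d] is at most [t ^ 2 J], it is at least [- 2 nu B ^ 2 t] for [t <= 1]; the extra [B ^ 2]
       keeps [M] positive when [nu = 0]. *)
    set (M := B ^ 2 * (1 + 2 * nu)).
    assert (HM : 0 < M) by (unfold M; apply Rmult_lt_0_compat; [apply pow_lt|]; lra).
    set (e := - energy nu J N y) in *.
    assert (He2 : 0 < e) by (unfold e; lra).
    set (t := Rmin (Rmin (eta / 2) y) (Rmin 1 (e / (2 * M)))).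
    assert (He3 : 0 < e / (2 * M)) by (apply Rdiv_lt_0_compat; lra).
    assert (Ht : 0 < t <= eta / 2 /\ t <= y /\ t <= 1 /\ t <= e / (2 * M)).
    { unfold t.
      pose proof (Rmin_l (Rmin (eta / 2) y) (Rmin 1 (e / (2 * M)))).
      pose proof (Rmin_r (Rmin (eta / 2) y) (Rmin 1 (e / (2 * M)))).
      pose proof (Rmin_l (eta / 2) y). pose proof (Rmin_r (eta / 2) y).
      pose proof (Rmin_l 1 (e / (2 * M))). pose proof (Rmin_r 1 (e / (2 * M))).
      split; [split|]; try lra. repeat apply Rmin_glb_lt; lra. }
    destruct (Hn t ltac:(lra)) as [[Hj1 Hj2] Hj3].
    pose proof (Hmono t y ltac:(lra) ltac:(lra)) as Hle.
    assert (Hlow : - (M * t) <= energy nu J N t).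
    { unfold energy. set (d := N t - nu * J t) in *.
      replace (N t) with (d + nu * J t) by (unfold d; ring).
      pose proof (Rabs_le_between d (t ^ 2 * J t)) as Hb. apply Hb in Hj3.
      assert (J t * J t <= B * B) by nra.
      assert (Ht2 : 0 <= t ^ 2 <= t) by (simpl; nra).
      assert (- (2 * nu * (J t * J t) * t ^ 2) <= 2 * nu * d * J t).
      { assert (0 <= nu * J t) by nra.
        assert (0 <= nu * J t * (d + t ^ 2 * J t)) by (apply Rmult_le_pos; lra). nra. }
      assert (2 * nu * (J t * J t) * t ^ 2 <= 2 * nu * (B * B) * t).
      { apply Rmult_le_compat; try nra. }
      assert (0 <= (t * J t) ^ 2) by apply pow2_ge_0.
      assert (0 <= d ^ 2) by apply pow2_ge_0.
      assert (0 <= B * B * t) by nra.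
      unfold M. nra. }
    assert (M * t <= e / 2).
    { replace (e / 2) with (M * (e / (2 * M))) by (field; lra).
      apply Rmult_le_compat_l; lra. }
    unfold e in *. lra. }
  (* Positivity follows from nonnegativity further left together with strict growth on [(0, eta)],
     where [J] is positive. *)
  destruct (Rlt_le_dec x eta) as [Hxe|Hxe].
  - apply Rle_lt_trans with (energy nu J N (x / 2)).
    + apply Hge; lra.
    + apply Hstr; lra.
  - apply Rlt_le_trans with (energy nu J N (eta / 2)).
    + apply Rle_lt_trans with (energy nu J N (eta / 4)).
      * apply Hge; lra.
      * apply Hstr; lra.
    + apply Hmono; lra.
Qed.

Lemma ratio_decr nu J N a b : bessel_pair nu J N -> 0 < a -> a < b ->
  (forall x, a <= x <= b -> J x <> 0) -> N b / J b < N a / J a.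
Proof.
  intros HP Ha Hab HJ. assert (HS := bessel_pair_system _ _ _ HP).
  destruct HS as (H0 & H1 & H2).
  assert (- (N a / J a) < - (N b / J b)); [|lra].
  apply (is_derive_pos_lt (fun x => - (N x / J x))
    (fun x => energy nu J N x / (x * J x ^ 2))); [lra| |].
  - intros x Hx. assert (Hx0 : 0 < x) by lra.
    specialize (H1 x Hx0). specialize (H2 x Hx0). specialize (HJ x Hx).
    auto_derive.
    + repeat split; try (eexists; eassumption); easy.
    + rewrite (Derive_eta _ _ _ H1), (Derive_eta _ _ _ H2). unfold energy.
      field. split; [easy|lra].
  - intros x Hx. pose proof (energy_pos nu J N x HP ltac:(lra)).
    specialize (HJ x Hx). apply Rdiv_lt_0_compat; [easy|].
    apply Rmult_lt_0_compat; [lra|]. apply pow2_gt_0. easy.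
Qed.

(** The reciprocal form passes through the zeros of [J], where [N / J] has poles. Subtracting
    [d * J] from [N] leaves the numerator of the derivative unchanged: it is the energy again. *)
Lemma inv_ratio_incr nu J N d a b : bessel_pair nu J N -> 0 < a -> a < b ->
  (forall x, a <= x <= b -> N x - d * J x <> 0) ->
  J a / (N a - d * J a) < J b / (N b - d * J b).
Proof.
  intros HP Ha Hab HJ. assert (HS := bessel_pair_system _ _ _ HP).
  destruct HS as (H0 & H1 & H2).
  apply (is_derive_pos_lt (fun x => J x / (N x - d * J x))
    (fun x => energy nu J N x / (x * (N x - d * J x) ^ 2))); [lra| |].
  - intros x Hx. assert (Hx0 : 0 < x) by lra.
    specialize (H1 x Hx0). specialize (H2 x Hx0). specialize (HJ x Hx).
    auto_derive.
    + repeat split; try (eexists; eassumption); easy.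
    + rewrite (Derive_eta _ _ _ H1), (Derive_eta _ _ _ H2). unfold energy.
      field. split; [easy|lra].
  - intros x Hx. pose proof (energy_pos nu J N x HP ltac:(lra)).
    specialize (HJ x Hx). apply Rdiv_lt_0_compat; [easy|].
    apply Rmult_lt_0_compat; [lra|]. apply pow2_gt_0. easy.
Qed.

(** The logarithmic derivative of [sqrt w * J] with respect to [Phi]. *)
Definition chi (nu : R) (J N : R -> R) (x : R) : R :=
  N x / J x / w nu x + x ^ 2 / (2 * w nu x ^ 3).

Lemma bessel_system_N_w nu J N x : bessel_system nu J N -> nu < x ->
  is_derive N x (- (w nu x ^ 2 * J x / x)).
Proof.
  intros (H0 & H1 & H2) Hx. rewrite w_sqr by lra.
  replace (- ((x ^ 2 - nu ^ 2) * J x / x)) with ((nu ^ 2 - x ^ 2) * J x / x)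
    by (field; lra). apply H2; lra.
Qed.

(** Riccati form of [u'' + (1 + q) u = 0] for [u = sqrt w * J] in the variable [Phi], with
    [q = x ^ 2 (5/4 x ^ 2 - w ^ 2) / w ^ 6]; [q] is positive because [w <= x]. *)
Lemma is_derive_chi nu J N x : bessel_system nu J N -> nu < x -> J x <> 0 ->
  is_derive (chi nu J N) x
    (- ((1 + chi nu J N x ^ 2) * (w nu x / x))
     - x * (5 / 4 * x ^ 2 - w nu x ^ 2) / w nu x ^ 5).
Proof.
  intros HS Hx HJ. assert (H2 := bessel_system_N_w _ _ _ _ HS Hx).
  destruct HS as (H0 & H1 & _). specialize (H1 x ltac:(lra)).
  assert (H3 := is_derive_w nu x ltac:(lra)).
  pose proof (w_pos nu x ltac:(lra)) as Hw.
  unfold chi.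
  auto_derive.
  - repeat split; try (eexists; eassumption); try easy; try lra.
    apply Rmult_integral_contrapositive_currified; [lra|].
    apply (pow_nonzero (w nu x) 3). lra.
  - rewrite (Derive_eta _ _ _ H1), (Derive_eta _ _ _ H2), (Derive_eta _ _ _ H3).
    field. repeat split; try lra; easy.
Qed.

(** By the Riccati equation [atan chi + Phi] does not increase, while [atan] varies by less than
    [PI]. *)
Lemma J_gap nu J N a b : bessel_system nu J N -> nu < a -> a < b ->
  (forall x, a <= x <= b -> J x <> 0) -> Phi nu b - Phi nu a < PI.
Proof.
  intros HS Ha Hab HJ. assert (H0 : 0 <= nu) by apply HS.
  assert (Hm : - (atan (chi nu J N a) + Phi nu a) <= - (atan (chi nu J N b) + Phi nu b)).
  { apply (is_derive_nonneg_le (fun x => - (atan (chi nu J N x) + Phi nu x))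
     (fun x => x * (5 / 4 * x ^ 2 - w nu x ^ 2) / w nu x ^ 5 / (1 + chi nu J N x ^ 2)));
     [lra| |].
    - intros x Hx. assert (Hc := is_derive_chi nu J N x HS ltac:(lra) (HJ x Hx)).
      assert (Hp := is_derive_Phi nu x ltac:(lra)).
      assert (H1 := is_derive_atan (chi nu J N x)).
      pose proof (w_pos nu x ltac:(lra)) as Hw.
      assert (0 < 1 + chi nu J N x ^ 2) by (pose proof (pow2_ge_0 (chi nu J N x)); lra).
      set (c := chi nu J N) in *.
      auto_derive.
      + repeat split; eexists; eassumption.
      + rewrite (Derive_eta _ _ _ Hc), (Derive_eta _ _ _ Hp).
        unfold Rsqr. field. repeat split; lra.
    - intros x Hx. pose proof (w_pos nu x ltac:(lra)). pose proof (w_le nu x ltac:(lra)).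
      pose proof (pow2_ge_0 (chi nu J N x)).
      apply Rdiv_le_0_compat; [|lra].
      apply Rdiv_le_0_compat; [|apply pow_lt; lra].
      apply Rmult_le_pos; [lra|]. nra. }
  pose proof (atan_bound (chi nu J N a)). pose proof (atan_bound (chi nu J N b)). lra.
Qed.

(** The Wronskian, with respect to [Phi], of [N / sqrt w] and [sin (Phi - p)]. *)
Definition sturm_wronskian (nu : R) (J N : R -> R) (p x : R) : R :=
  ((- (w nu x * J x) - x ^ 2 * N x / (2 * w nu x ^ 3)) * sin (Phi nu x - p)
   - N x * cos (Phi nu x - p)) / sqrt (w nu x).

(** In the variable [Phi], [v = N / sqrt w] solves [v'' + (1 - q) v = 0] with [q = x ^ 2 (7/4 x ^ 2
    - w ^ 2) / w ^ 6 > 0]. The Wronskian with the sine therefore has derivative [q v sin (Phi - p)],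
    of known sign while [v] and the sine keep theirs. *)
Lemma is_derive_sturm_wronskian nu J N p x : bessel_system nu J N -> nu < x ->
  is_derive (sturm_wronskian nu J N p) x
    (x * (7 / 4 * x ^ 2 - w nu x ^ 2) / w nu x ^ 5 *
     (N x / sqrt (w nu x)) * sin (Phi nu x - p)).
Proof.
  intros HS Hx. assert (H2 := bessel_system_N_w _ _ _ _ HS Hx).
  destruct HS as (H0 & H1 & _). specialize (H1 x ltac:(lra)).
  assert (H3 := is_derive_w nu x ltac:(lra)).
  assert (H4 := is_derive_Phi nu x ltac:(lra)).
  pose proof (w_pos nu x ltac:(lra)) as Hw.
  assert (Hq : 0 < sqrt (w nu x)) by now apply sqrt_lt_R0.
  assert (H5 : is_derive (fun x => sqrt (w nu x)) x
             (x * sqrt (w nu x) / (2 * w nu x ^ 2))).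
  { auto_derive.
    - split; [eexists; eassumption|lra].
    - rewrite (Derive_eta _ _ _ H3).
      transitivity (x * sqrt (w nu x) / (2 * w nu x * (sqrt (w nu x) * sqrt (w nu x))));
        [field; lra|].
      rewrite sqrt_sqrt by lra. field. lra. }
  set (q := fun x => sqrt (w nu x)) in *.
  change (sqrt (w nu x)) with (q x) in *.
  apply (is_derive_ext (fun x =>
  ((- (w nu x * J x) - x ^ 2 * N x / (2 * w nu x ^ 3)) * sin (Phi nu x - p)
   - N x * cos (Phi nu x - p)) / q x)); [easy|].
  auto_derive.
  - repeat split; try (eexists; eassumption); try easy; try lra.
    apply Rmult_integral_contrapositive_currified; [lra|].
    apply (pow_nonzero (w nu x) 3). lra.
  - rewrite (Derive_eta _ _ _ H1), (Derive_eta _ _ _ H2), (Derive_eta _ _ _ H3),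
      (Derive_eta _ _ _ H4), (Derive_eta q _ _ H5).
    change (Phi nu x + - p) with (Phi nu x - p).
    field. repeat split; lra.
Qed.

Lemma is_derive_Rabs_lt (f : R -> R) (x l eps : R) : is_derive f x l -> 0 < eps ->
  exists d, 0 < d /\ forall y, Rabs (y - x) < d -> Rabs (f y - f x) < eps.
Proof.
  intros H He. apply continuous_Rabs_lt; [|easy].
  apply (ex_derive_continuous f). now exists l.
Qed.

Lemma nonzero_const_sign (f : R -> R) (a b : R) :
  (forall x, a < x < b -> continuity_pt f x) ->
  (forall x, a < x < b -> f x <> 0) ->
  (forall x, a < x < b -> 0 < f x) \/ (forall x, a < x < b -> f x < 0).
Proof.
  intros Hc Hn.
  destruct (classic (exists x, a < x < b /\ 0 < f x)) as [[x [Hx Px]]|Hno].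
  - left. intros y Hy. destruct (Rtotal_order (f y) 0) as [H|[H|H]]; [|now apply Hn in H|easy].
    exfalso. destruct (Rtotal_order x y) as [L|[E|L]].
    + destruct (IVT_interv (fun t => - f t) x y) as [z [Hz E]]; try lra.
      * intros t Ht. apply continuity_pt_opp, Hc. lra.
      * apply (Hn z); lra.
    + subst. lra.
    + destruct (IVT_interv f y x) as [z [Hz E]]; try lra.
      * intros t Ht. apply Hc. lra.
      * apply (Hn z); lra.
  - right. intros y Hy. destruct (Rtotal_order (f y) 0) as [H|[H|H]]; [easy|now apply Hn in H|].
    exfalso. apply Hno. now exists y.
Qed.

(** Sturm comparison: the Wronskian starts near 0 and does not decrease, yet at [c2] it equals
    [- sqrt w * J * sin (Phi - p) < 0]. Its smallness is asked only at points close to [c1], since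
    for [c1 = nu = 0] the Wronskian is singular at [c1] itself. *)
Lemma sturm_no_N_zero nu J N p c1 c2 : bessel_system nu J N -> nu <= c1 -> c1 < c2 ->
  (forall x, c1 < x < c2 -> 0 < N x) -> N c2 = 0 -> J c2 <> 0 ->
  (forall x, c1 < x <= c2 -> 0 < Phi nu x - p < PI) ->
  (forall eps, 0 < eps -> exists a, c1 < a < c2 /\
      Rabs (sturm_wronskian nu J N p a) < eps) ->
  False.
Proof.
  intros HS H1 H2 HN N2 J2 HP HW. assert (H0 : 0 <= nu) by apply HS.
  pose proof (w_pos nu c2 ltac:(lra)) as Hw.
  (* [N] descends to 0 at [c2] and [N' = - w ^ 2 J / x], so a negative [J c2] would make [N]
     negative just before. *)
  assert (Jp : 0 < J c2).
  { apply Rnot_le_lt. intros [Jn|Jn]; [|easy].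
    destruct (is_derive_Rabs_lt J c2 _ (- J c2) (proj1 (proj2 HS) c2 ltac:(lra)))
      as [d [Hd Hc]]; [lra|].
    set (e := Rmin (d / 2) ((c2 - c1) / 2)).
    assert (He : 0 < e) by (apply Rmin_glb_lt; lra).
    pose proof (Rmin_l (d / 2) ((c2 - c1) / 2)). pose proof (Rmin_r (d / 2) ((c2 - c1) / 2)).
    fold e in H, H3.
    assert (N (c2 - e) < N c2).
    { apply (is_derive_pos_lt N (fun x => - (w nu x ^ 2 * J x / x))); [lra| |].
      - intros x Hx. apply (bessel_system_N_w _ _ _ _ HS). lra.
      - intros x Hx. specialize (Hc x).
        assert (Rabs (x - c2) < d) by (apply Rabs_def1; lra).
        apply Hc, Rabs_def2 in H4. pose proof (w_pos nu x ltac:(lra)).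
        replace (- (w nu x ^ 2 * J x / x)) with (w nu x ^ 2 * - J x / x) by (field; lra).
        apply Rdiv_lt_0_compat; [|lra]. apply Rmult_lt_0_compat; [|lra].
        now apply pow_lt. }
    specialize (HN (c2 - e) ltac:(lra)). lra. }
  assert (W2 : sturm_wronskian nu J N p c2 < 0).
  { unfold sturm_wronskian. rewrite N2.
    assert (0 < sqrt (w nu c2)) by now apply sqrt_lt_R0.
    assert (0 < sin (Phi nu c2 - p)) by (apply sin_gt_0; apply HP; lra).
    replace (((- (w nu c2 * J c2) - c2 ^ 2 * 0 / (2 * w nu c2 ^ 3)) * sin (Phi nu c2 - p)
       - 0 * cos (Phi nu c2 - p)) / sqrt (w nu c2))
      with (- (w nu c2 * J c2 * sin (Phi nu c2 - p) / sqrt (w nu c2)))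
      by (field; split; lra).
    assert (0 < w nu c2 * J c2 * sin (Phi nu c2 - p) / sqrt (w nu c2)); [|lra].
    apply Rdiv_lt_0_compat; [|easy]. apply Rmult_lt_0_compat; [nra|easy]. }
  destruct (HW (- sturm_wronskian nu J N p c2)) as [a [Ha Hwa]]; [lra|].
  assert (sturm_wronskian nu J N p a <= sturm_wronskian nu J N p c2).
  { apply (is_derive_nonneg_le _ (fun x => x * (7 / 4 * x ^ 2 - w nu x ^ 2) / w nu x ^ 5 *
     (N x / sqrt (w nu x)) * sin (Phi nu x - p))); [lra| |].
    - intros x Hx. apply is_derive_sturm_wronskian; [easy|lra].
    - intros x Hx. pose proof (w_pos nu x ltac:(lra)). pose proof (w_le nu x ltac:(lra)).
      assert (0 < sqrt (w nu x)) by now apply sqrt_lt_R0.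
      assert (0 < sin (Phi nu x - p)) by (apply sin_gt_0; apply HP; lra).
      assert (0 <= N x).
      { destruct (Rle_lt_or_eq_dec x c2 (proj2 Hx)) as [L| ->]; [|lra].
        left. apply HN. lra. }
      apply Rmult_le_pos; [|lra]. apply Rmult_le_pos.
      + apply Rdiv_le_0_compat; [|apply pow_lt; lra]. apply Rmult_le_pos; [lra|nra].
      + apply Rdiv_le_0_compat; lra. }
  apply Rabs_def2 in Hwa. lra.
Qed.

(** Otherwise [Phi - p] stays inside [(0, PI)] up to [c2], and the comparison applies to [N] or to
    [- N], whichever is positive. *)
Lemma N_zero_ge_of_wronskian nu J N p c1 c2 : bessel_system nu J N -> nu <= c1 -> c1 < c2 ->
  (forall x, c1 < x < c2 -> N x <> 0) -> N c2 = 0 -> J c2 <> 0 ->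
  (forall x, c1 < x <= c2 -> 0 < Phi nu x - p) ->
  (forall eps, 0 < eps -> exists a, c1 < a < c2 /\
      Rabs (sturm_wronskian nu J N p a) < eps) ->
  p + PI <= Phi nu c2.
Proof.
  intros HS H1 H2 HN N2 J2 HP HW. assert (H0 : 0 <= nu) by apply HS.
  apply Rnot_lt_le. intros Hlt.
  assert (HP' : forall x, c1 < x <= c2 -> 0 < Phi nu x - p < PI).
  { intros x Hx. split; [now apply HP|].
    destruct (Rle_lt_or_eq_dec x c2 (proj2 Hx)) as [L| ->]; [|lra].
    pose proof (Phi_incr nu x c2 ltac:(lra) L). lra. }
  destruct (nonzero_const_sign N c1 c2) as [Hp|Hn].
  - intros x Hx. eapply is_derive_continuity_pt. apply HS. lra.
  - easy.
  - now apply (sturm_no_N_zero nu J N p c1 c2).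
  - apply (sturm_no_N_zero nu (fun x => - J x) (fun x => - N x) p c1 c2); try easy.
    + now apply bessel_system_opp.
    + intros x Hx. specialize (Hn x Hx). lra.
    + lra.
    + lra.
    + intros eps He. destruct (HW eps He) as [a [Ha Hb]]. exists a. split; [easy|].
      replace (sturm_wronskian nu (fun x => - J x) (fun x => - N x) p a)
        with (- sturm_wronskian nu J N p a).
      * now rewrite Rabs_Ropp.
      * pose proof (w_pos nu a ltac:(lra)) as Hw.
        assert (0 < sqrt (w nu a)) by now apply sqrt_lt_R0.
        unfold sturm_wronskian. field. split; lra.
Qed.

Lemma energy_N_zero nu J N x : bessel_pair nu J N -> 0 < x -> N x = 0 ->
  nu < x /\ J x <> 0.
Proof.
  intros HP Hx HN. pose proof (energy_pos nu J N x HP Hx) as He. unfold energy in He.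
  rewrite HN in He. assert (H0 : 0 <= nu) by apply HP.
  pose proof (pow2_ge_0 (J x)).
  split.
  - apply Rnot_le_lt. intros Hle. assert (x ^ 2 <= nu ^ 2) by nra. nra.
  - intros HJ. rewrite HJ in He. lra.
Qed.

Lemma energy_J_zero nu J N x : bessel_pair nu J N -> 0 < x -> J x = 0 -> N x <> 0.
Proof.
  intros HP Hx HJ HN. pose proof (energy_pos nu J N x HP Hx) as He. unfold energy in He.
  rewrite HN, HJ in He. lra.
Qed.

(** For [p = Phi nu c1] both terms of the Wronskian vanish at [c1], and continuity makes it small
    nearby. *)
Lemma N_zero_spacing nu J N c1 c2 : bessel_pair nu J N -> 0 < c1 -> c1 < c2 ->
  N c1 = 0 -> N c2 = 0 -> (forall x, c1 < x < c2 -> N x <> 0) ->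
  Phi nu c1 + PI <= Phi nu c2.
Proof.
  intros HP Hc1 Hc N1 N2 HN.
  assert (HS := bessel_pair_system _ _ _ HP). assert (H0 : 0 <= nu) by apply HP.
  destruct (energy_N_zero nu J N c1 HP Hc1 N1) as [Hn1 J1].
  destruct (energy_N_zero nu J N c2 HP ltac:(lra) N2) as [Hn2 J2].
  apply (N_zero_ge_of_wronskian nu J N (Phi nu c1) c1 c2); try easy; try lra.
  - intros x Hx. pose proof (Phi_incr nu c1 x ltac:(lra) ltac:(lra)). lra.
  - intros eps He.
    destruct (is_derive_Rabs_lt _ _ _ eps
      (is_derive_sturm_wronskian nu J N (Phi nu c1) c1 HS Hn1) He) as [d [Hd Hw]].
    set (e := Rmin (d / 2) ((c2 - c1) / 2)).
    assert (Hep : 0 < e) by (apply Rmin_glb_lt; lra).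
    pose proof (Rmin_l (d / 2) ((c2 - c1) / 2)). pose proof (Rmin_r (d / 2) ((c2 - c1) / 2)).
    fold e in H, H1.
    exists (c1 + e). split; [lra|].
    assert (E : sturm_wronskian nu J N (Phi nu c1) c1 = 0).
    { pose proof (w_pos nu c1 ltac:(lra)) as Hw1.
      assert (0 < sqrt (w nu c1)) by now apply sqrt_lt_R0.
      unfold sturm_wronskian. rewrite N1, Rminus_diag, sin_0, cos_0. field. split; lra. }
    specialize (Hw (c1 + e)). rewrite E, Rminus_0_r in Hw. apply Hw.
    replace (c1 + e - c1) with e by ring. rewrite Rabs_pos_eq; lra.
Qed.

(** For order 0 there is no zero of [N] before [c] to compare with; the origin takes its place, as
    [N = O(t ^ 2)]. There [w = t] degenerates, but the numerator of the Wronskian is at most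
    [5/2 * B * t] and the denominator is [sqrt t]. *)
Lemma N_first_zero_order0 J N c : bessel_pair 0 J N -> 0 < c -> N c = 0 ->
  (forall x, 0 < x < c -> N x <> 0) -> PI <= Phi 0 c.
Proof.
  intros HP Hc Nc HN.
  assert (HS := bessel_pair_system _ _ _ HP).
  destruct (energy_N_zero 0 J N c HP Hc Nc) as [_ Jc].
  rewrite <- (Rplus_0_l PI).
  apply (N_zero_ge_of_wronskian 0 J N 0 0 c); try easy; try lra.
  - intros x Hx. rewrite Rminus_0_r. apply Phi_pos. lra.
  - intros eps He. destruct HP as (_ & _ & _ & eta & B & Het & Hn).
    assert (HB : 0 < B) by (destruct (Hn (eta / 2) ltac:(lra)); lra).
    (* The last bound makes [5/2 * B * sqrt t] at most [5/8 * eps]. *)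
    set (t := Rmin (Rmin (eta / 2) (c / 2)) (Rmin 1 ((eps / (4 * B)) ^ 2))).
    assert (He3 : 0 < eps / (4 * B)) by (apply Rdiv_lt_0_compat; lra).
    assert (Ht : 0 < t <= eta / 2 /\ t <= c / 2 /\ t <= 1 /\ t <= (eps / (4 * B)) ^ 2).
    { unfold t.
      pose proof (Rmin_l (Rmin (eta / 2) (c / 2)) (Rmin 1 ((eps / (4 * B)) ^ 2))).
      pose proof (Rmin_r (Rmin (eta / 2) (c / 2)) (Rmin 1 ((eps / (4 * B)) ^ 2))).
      pose proof (Rmin_l (eta / 2) (c / 2)). pose proof (Rmin_r (eta / 2) (c / 2)).
      pose proof (Rmin_l 1 ((eps / (4 * B)) ^ 2)). pose proof (Rmin_r 1 ((eps / (4 * B)) ^ 2)).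
      split; [split|]; try lra. assert (0 < (eps / (4 * B)) ^ 2) by now apply pow_lt.
      repeat apply Rmin_glb_lt; lra. }
    exists t. split; [lra|].
    destruct (Hn t ltac:(lra)) as [[Hj1 Hj2] Hj3].
    rewrite Rmult_0_l, Rminus_0_r in Hj3.
    assert (Ew : w 0 t = t).
    { unfold w. replace (t ^ 2 - 0 ^ 2) with (t ^ 2) by ring. apply sqrt_pow2. lra. }
    unfold sturm_wronskian. rewrite Ew.
    assert (Hs : 0 < sqrt t) by (apply sqrt_lt_R0; lra).
    assert (Hss : t <= sqrt t).
    { rewrite <- (sqrt_sqrt t) at 1 by lra. assert (sqrt t <= 1); [|nra].
      rewrite <- sqrt_1. apply sqrt_le_1_alt. lra. }
    set (S := sin (Phi 0 t - 0)). set (C := cos (Phi 0 t - 0)).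
    assert (HSb : Rabs S <= 1) by (apply Rabs_le; apply SIN_bound).
    assert (HCb : Rabs C <= 1) by (apply Rabs_le; apply COS_bound).
    assert (HN2 : Rabs (N t) <= t ^ 2 * B).
    { eapply Rle_trans; [exact Hj3|]. apply Rmult_le_compat_l; [apply pow2_ge_0|lra]. }
    assert (Hm : Rabs ((- (t * J t) - t ^ 2 * N t / (2 * t ^ 3)) * S - N t * C)
                 <= 5 / 2 * B * t).
    { replace ((- (t * J t) - t ^ 2 * N t / (2 * t ^ 3)) * S - N t * C)
        with (- (t * J t) * S + (- (N t / (2 * t)) * S + - (N t * C))) by (field; lra).
      eapply Rle_trans; [apply Rabs_triang|].
      eapply Rle_trans; [apply Rplus_le_compat_l, Rabs_triang|].
      rewrite Rabs_Ropp, !Rabs_mult, !Rabs_Ropp.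
      unfold Rdiv. rewrite !Rabs_mult.
      rewrite (Rabs_pos_eq t), (Rabs_pos_eq (J t)) by lra.
      assert (0 < / (2 * t)) by (apply Rinv_0_lt_compat; lra).
      rewrite (Rabs_pos_eq (/ (2 * t))) by lra.
      assert (H1 : Rabs (N t) * / (2 * t) <= t * B / 2).
      { apply Rle_trans with (t ^ 2 * B * / (2 * t)).
        - apply Rmult_le_compat_r; lra.
        - right. field. lra. }
      pose proof (Rabs_pos S). pose proof (Rabs_pos C). pose proof (Rabs_pos (N t)).
      assert (t * J t * Rabs S <= t * B * 1).
      { apply Rmult_le_compat; try nra. }
      assert (Rabs (N t) * / (2 * t) * Rabs S <= t * B / 2 * 1).
      { apply Rmult_le_compat; try nra. }
      assert (Rabs (N t) * Rabs C <= t ^ 2 * B * 1).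
      { apply Rmult_le_compat; try nra. }
      assert (t ^ 2 * B <= t * B) by (simpl; nra).
      lra. }
    unfold Rdiv at 1. rewrite Rabs_mult, Rabs_inv, (Rabs_pos_eq (sqrt t)) by lra.
    apply Rle_lt_trans with (5 / 2 * B * t * / sqrt t).
    + apply Rmult_le_compat_r; [left; now apply Rinv_0_lt_compat|easy].
    + rewrite <- (sqrt_sqrt t) at 1 by lra.
      replace (5 / 2 * B * (sqrt t * sqrt t) * / sqrt t) with (5 / 2 * B * sqrt t)
        by (field; lra).
      assert (sqrt t <= eps / (4 * B)).
      { rewrite <- (sqrt_pow2 (eps / (4 * B))) by lra. apply sqrt_le_1_alt. lra. }
      apply Rle_lt_trans with (5 / 2 * B * (eps / (4 * B))).
      * apply Rmult_le_compat_l; lra.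
      * replace (5 / 2 * B * (eps / (4 * B))) with (5 / 8 * eps) by (field; lra). lra.
Qed.

(** * Zeros of J and of N - d J *)

Definition is_next_zero (f : R -> R) (a b : R) : Prop :=
  a < b /\ f b = 0 /\ forall x, a < x < b -> f x <> 0.

Lemma continuity_pt_Rabs_lt (f : R -> R) (x eps : R) : continuity_pt f x -> 0 < eps ->
  exists d, 0 < d /\ forall y, Rabs (y - x) < d -> Rabs (f y - f x) < eps.
Proof.
  intros H He. apply continuous_Rabs_lt; [|easy]. now apply continuity_pt_filterlim.
Qed.

(** The zero is the supremum of the ends of zero-free intervals starting at [a]. The margin [e]
    keeps it away from [a], and a nonzero value there would extend the intervals by continuity. *)
Lemma next_zero_exists (f : R -> R) (a e z : R) :
  (forall x, a < x -> continuity_pt f x) -> 0 < e ->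
  (forall x, a < x < a + e -> f x <> 0) -> a < z -> f z = 0 ->
  exists b, is_next_zero f a b.
Proof.
  intros Hc He Hn Hz Fz.
  set (S := fun x => a < x /\ forall y, a < y <= x -> f y <> 0).
  destruct (completeness S) as [b [Hub Hl]].
  - exists z. intros x [Hx Hy]. apply Rnot_lt_le. intros Hlt. apply (Hy z); lra.
  - exists (a + e / 2). split; [lra|]. intros y Hy. apply Hn. lra.
  - assert (Hb : a < b).
    { apply Rlt_le_trans with (a + e / 2); [lra|]. apply Hub. split; [lra|].
      intros y Hy. apply Hn. lra. }
    assert (Hbelow : forall x, a < x < b -> f x <> 0).
    { intros x Hx. destruct (classic (exists s, S s /\ x <= s)) as [[s [[Hs1 Hs2] Hs]]|Hno].
      - apply Hs2. lra.
      - exfalso. assert (b <= x); [|lra]. apply Hl. intros s Hs.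
        apply Rnot_lt_le. intros Hlt. apply Hno. exists s. split; [easy|lra]. }
    exists b. split; [easy|]. split; [|easy].
    apply NNPP. intros Fb.
    destruct (continuity_pt_Rabs_lt f b (Rabs (f b)) (Hc b Hb)) as [d [Hd Hcd]].
    { now apply Rabs_pos_lt. }
    assert (b + d / 2 <= b); [|lra].
    apply Hub. split; [lra|]. intros y Hy.
    destruct (Rlt_le_dec y b) as [L|L]; [apply Hbelow; lra|].
    intros Fy. specialize (Hcd y). rewrite Fy in Hcd.
    replace (0 - f b) with (- f b) in Hcd by ring. rewrite Rabs_Ropp in Hcd.
    specialize (Hcd ltac:(apply Rabs_def1; lra)). lra.
Qed.

(** Index 0 holds the left end 0, which is not meant as a zero; the positive zeros start at index
    1. *)
Fixpoint zero_seq (f : R -> R) (k : nat) : R :=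
  match k with
  | O => 0
  | S k => epsilon (inhabits 0) (is_next_zero f (zero_seq f k))
  end.

(** By the energy [N z] is nonzero, so [J / N] is strictly increasing just after [z] and cannot
    return to 0. *)
Lemma J_zero_isolated nu J N z : bessel_pair nu J N -> 0 < z -> J z = 0 ->
  exists e, 0 < e /\ forall x, z < x < z + e -> J x <> 0.
Proof.
  intros HP Hz Jz. pose proof (energy_J_zero nu J N z HP Hz Jz) as HN.
  destruct (bessel_pair_system _ _ _ HP) as (H0 & H1 & H2).
  destruct (is_derive_Rabs_lt N z _ (Rabs (N z)) (H2 z Hz)) as [d [Hd Hc]].
  { now apply Rabs_pos_lt. }
  exists d. split; [easy|]. intros x Hx Jx.
  assert (Hlt : J z / (N z - 0 * J z) < J x / (N x - 0 * J x)).
  { apply (inv_ratio_incr nu); try easy; try lra.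
    intros y Hy Ny. specialize (Hc y). replace (N y) with 0 in Hc by lra.
    replace (0 - N z) with (- N z) in Hc by ring. rewrite Rabs_Ropp in Hc.
    specialize (Hc ltac:(apply Rabs_def1; lra)). lra. }
  rewrite Jz, Jx in Hlt. unfold Rdiv in Hlt. rewrite !Rmult_0_l in Hlt. lra.
Qed.

Lemma J_oscillates nu J N a : bessel_system nu J N -> exists z, a < z /\ J z = 0.
Proof.
  intros HS. assert (H0 : 0 <= nu) by apply HS. apply NNPP. intros Hno.
  set (b := Rmax nu a + 1).
  pose proof (Rmax_l nu a). pose proof (Rmax_r nu a).
  destruct (Phi_unbounded nu (Phi nu b + PI) H0) as [X [HX Hb]].
  specialize (Hb (Rmax X (b + 1)) (Rmax_l _ _)). pose proof (Rmax_r X (b + 1)).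
  assert (Phi nu (Rmax X (b + 1)) - Phi nu b < PI); [|lra].
  apply (J_gap nu J N); try easy; unfold b in *; try lra.
  intros x Hx Jx. apply Hno. exists x. split; [lra|easy].
Qed.

Lemma zero_seq_spec nu J N k : bessel_pair nu J N ->
  0 <= zero_seq J k /\ is_next_zero J (zero_seq J k) (zero_seq J (S k)).
Proof.
  intros HP. assert (HS := bessel_pair_system _ _ _ HP).
  assert (Hstep : forall a, 0 <= a ->
    (exists e, 0 < e /\ forall x, a < x < a + e -> J x <> 0) ->
    exists b, is_next_zero J a b).
  { intros a Ha [e [He Hn]]. destruct (J_oscillates nu J N a HS) as [z [Hz Jz]].
    apply (next_zero_exists J a e z); try easy.
    intros x Hx. eapply is_derive_continuity_pt. apply HS. lra. }
  assert (Hn : forall a, (exists b, is_next_zero J a b) ->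
    is_next_zero J a (epsilon (inhabits 0) (is_next_zero J a))).
  { intros a H. now apply epsilon_spec. }
  induction k as [|k [IH1 IH2]].
  - split; [simpl; lra|]. apply Hn. apply Hstep; [simpl; lra|]. simpl.
    destruct HP as (_ & _ & _ & eta & B & He & Hp). exists eta. split; [easy|].
    intros x Hx. destruct (Hp x ltac:(lra)). lra.
  - assert (Hz : 0 < zero_seq J (S k)) by (destruct IH2; lra).
    split; [lra|]. apply Hn. apply Hstep; [lra|].
    apply (J_zero_isolated nu J N); try easy. apply IH2.
Qed.

Section ZeroSequence.
Context (nu : R) (J N : R -> R) (HP : bessel_pair nu J N).
Notation z := (zero_seq J).

Lemma zero_seq_lt k : z k < z (S k).
Proof. apply (zero_seq_spec nu J N k HP). Qed.

Lemma zero_seq_pos k : 0 < z (S k).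
Proof. destruct (zero_seq_spec nu J N k HP) as [H1 [H2 _]]. lra. Qed.

Lemma zero_seq_nonneg k : 0 <= z k.
Proof. apply (zero_seq_spec nu J N k HP). Qed.

Lemma zero_seq_zero k : J (z (S k)) = 0.
Proof. apply (zero_seq_spec nu J N k HP). Qed.

Lemma zero_seq_between k x : z k < x < z (S k) -> J x <> 0.
Proof. apply (zero_seq_spec nu J N k HP). Qed.

Lemma zero_seq_le k m : (k <= m)%nat -> z k <= z m.
Proof. induction 1; [lra|]. pose proof (zero_seq_lt m). lra. Qed.

(** Points of the [k]-th gap where [N / J] takes the value [d]: [d = delta] gives the critical
    points of [x ^ (- delta) J], [d = 0] the extrema of [J]. *)
Definition is_level_zero (d : R) (k : nat) (x : R) : Prop :=
  z k < x < z (S k) /\ N x = d * J x.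

Definition level_zero (d : R) (k : nat) : R :=
  epsilon (inhabits 0) (is_level_zero d k).

(** If there were none, [J / (N - d * J)] would be strictly increasing over the closed gap; but it
    vanishes at both ends when [1 <= k], and for [k = 0] it is positive near 0 and vanishes at the
    first zero. *)
Lemma level_zero_exists d k : (1 <= k)%nat \/ d < nu -> exists x, is_level_zero d k x.
Proof.
  intros Hk. apply NNPP. intros Hno.
  pose proof (zero_seq_lt k) as Hlt. pose proof (zero_seq_pos k) as Hp.
  assert (Hend : forall m, N (z (S m)) - d * J (z (S m)) <> 0).
  { intros m. rewrite zero_seq_zero, Rmult_0_r, Rminus_0_r.
    apply (energy_J_zero nu J N); [easy|apply zero_seq_pos|apply zero_seq_zero]. }
  assert (Hne : forall x, z k < x <= z (S k) -> N x - d * J x <> 0).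
  { intros x Hx E. destruct (Rle_lt_or_eq_dec x _ (proj2 Hx)) as [L|L].
    - apply Hno. exists x. split; lra.
    - rewrite L in E. now apply (Hend k). }
  destruct k as [|k].
  - destruct Hk as [Hk|Hk]; [lia|]. simpl z in Hne at 1.
    pose proof HP as (_ & _ & _ & eta & B & He & Hn).
    (* At such a [t], [N - d * J >= (nu - d - t ^ 2) * J > 0]. *)
    set (t := Rmin (Rmin (eta / 2) (z 1 / 2)) (Rmin 1 ((nu - d) / 2))).
    assert (Ht : 0 < t <= eta / 2 /\ t <= z 1%nat / 2 /\ t <= 1 /\ t <= (nu - d) / 2).
    { unfold t.
      pose proof (Rmin_l (Rmin (eta / 2) (z 1 / 2)) (Rmin 1 ((nu - d) / 2))).
      pose proof (Rmin_r (Rmin (eta / 2) (z 1 / 2)) (Rmin 1 ((nu - d) / 2))).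
      pose proof (Rmin_l (eta / 2) (z 1%nat / 2)). pose proof (Rmin_r (eta / 2) (z 1%nat / 2)).
      pose proof (Rmin_l 1 ((nu - d) / 2)). pose proof (Rmin_r 1 ((nu - d) / 2)).
      split; [split|]; try lra. repeat apply Rmin_glb_lt; lra. }
    destruct (Hn t ltac:(lra)) as [[Hj1 _] Hj3].
    apply Rabs_le_between in Hj3.
    assert (t ^ 2 <= (nu - d) / 2) by (simpl; nra).
    assert (HD : 0 < N t - d * J t) by nra.
    assert (Hc : J t / (N t - d * J t) < J (z 1%nat) / (N (z 1%nat) - d * J (z 1%nat))).
    { apply (inv_ratio_incr nu); try easy; try lra. intros x Hx. apply Hne. lra. }
    rewrite (zero_seq_zero 0) in Hc.
    assert (0 < J t / (N t - d * J t)) by now apply Rdiv_lt_0_compat.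
    unfold Rdiv in Hc at 2. rewrite Rmult_0_l in Hc. lra.
  - pose proof (zero_seq_pos k) as Hp'.
    assert (Hc : J (z (S k)) / (N (z (S k)) - d * J (z (S k))) <
       J (z (S (S k))) / (N (z (S (S k))) - d * J (z (S (S k))))).
    { apply (inv_ratio_incr nu); try easy; try lra. intros x Hx.
      destruct (Rle_lt_or_eq_dec _ x (proj1 Hx)) as [L|L]; [apply Hne; lra|].
      rewrite <- L. apply Hend. }
    rewrite !zero_seq_zero in Hc. unfold Rdiv in Hc. rewrite !Rmult_0_l in Hc. lra.
Qed.

Lemma level_zero_spec d k : (1 <= k)%nat \/ d < nu ->
  is_level_zero d k (level_zero d k).
Proof. intros H. unfold level_zero. apply epsilon_spec. now apply level_zero_exists. Qed.

Lemma is_level_zero_order d1 d2 k x1 x2 :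
  is_level_zero d1 k x1 -> is_level_zero d2 k x2 -> x1 < x2 -> d2 < d1.
Proof.
  intros [H1 E1] [H2 E2] Hlt. pose proof (zero_seq_nonneg k) as Hk.
  assert (Hr : N x2 / J x2 < N x1 / J x1).
  { apply (ratio_decr nu); try easy; try lra.
    intros x Hx. apply (zero_seq_between k). lra. }
  rewrite E1, E2 in Hr. unfold Rdiv in Hr. rewrite !Rmult_assoc, !Rinv_r in Hr.
  - lra.
  - now apply (zero_seq_between k).
  - now apply (zero_seq_between k).
Qed.

Lemma is_level_zero_unique d k x1 x2 :
  is_level_zero d k x1 -> is_level_zero d k x2 -> x1 = x2.
Proof.
  intros H1 H2. destruct (Rtotal_order x1 x2) as [L|[L|L]]; [|easy|].
  - pose proof (is_level_zero_order _ _ _ _ _ H1 H2 L). lra.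
  - pose proof (is_level_zero_order _ _ _ _ _ H2 H1 L). lra.
Qed.

(** On the first gap [N / J] decreases strictly from its limit [nu] at 0. The value [r] at [x / 2]
    exceeds [d], hence [nu], by a definite margin, whereas [N / J <= nu + t ^ 2] at small [t]. *)
Lemma no_level_zero_ge_nu d x : nu <= d -> ~ is_level_zero d 0 x.
Proof.
  intros Hd Hx. assert (Hx1 : 0 < x < z 1%nat) by apply Hx.
  pose proof (zero_seq_between 0) as Hb. change (z 0) with 0 in Hb.
  assert (Hx2 : is_level_zero (N (x / 2) / J (x / 2)) 0 (x / 2)).
  { split; [simpl (z 0); lra|]. field. apply Hb. lra. }
  pose proof (is_level_zero_order _ _ _ _ _ Hx2 Hx ltac:(lra)) as Ho.
  set (r := N (x / 2) / J (x / 2)) in *.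
  pose proof HP as (_ & _ & _ & eta & B & He & Hn).
  set (t := Rmin (Rmin (eta / 2) (x / 4)) (Rmin 1 ((r - nu) / 2))).
  assert (Ht : 0 < t <= eta / 2 /\ t <= x / 4 /\ t <= 1 /\ t <= (r - nu) / 2).
  { unfold t.
    pose proof (Rmin_l (Rmin (eta / 2) (x / 4)) (Rmin 1 ((r - nu) / 2))).
    pose proof (Rmin_r (Rmin (eta / 2) (x / 4)) (Rmin 1 ((r - nu) / 2))).
    pose proof (Rmin_l (eta / 2) (x / 4)). pose proof (Rmin_r (eta / 2) (x / 4)).
    pose proof (Rmin_l 1 ((r - nu) / 2)). pose proof (Rmin_r 1 ((r - nu) / 2)).
    split; [split|]; try lra. repeat apply Rmin_glb_lt; lra. }
  destruct (Hn t ltac:(lra)) as [[Hj1 _] Hj3]. apply Rabs_le_between in Hj3.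
  assert (Ht2 : is_level_zero (N t / J t) 0 t).
  { split; [simpl (z 0); lra|]. field. lra. }
  pose proof (is_level_zero_order _ _ _ _ _ Ht2 Hx2 ltac:(lra)) as Ho2.
  assert (t ^ 2 <= (r - nu) / 2) by (simpl; nra).
  assert (N t / J t <= nu + t ^ 2); [|lra].
  apply Rmult_le_reg_r with (J t); [easy|]. unfold Rdiv.
  rewrite Rmult_assoc, Rinv_l by lra. lra.
Qed.

Lemma extremum_spec k : (1 <= k)%nat \/ 0 < nu ->
  z k < level_zero 0 k < z (S k) /\ N (level_zero 0 k) = 0 /\ nu < level_zero 0 k.
Proof.
  intros H. destruct (level_zero_spec 0 k H) as [H1 H2]. rewrite Rmult_0_l in H2.
  split; [easy|]. split; [easy|]. pose proof (zero_seq_nonneg k).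
  apply (energy_N_zero nu J N); [easy|lra|easy].
Qed.

(** For [nu > 0] an extremum of [J] precedes the first zero, and the energy places every extremum
    beyond [nu]. *)
Lemma zero_seq_gt_nu k : nu < z (S k).
Proof.
  assert (H0 : 0 <= nu) by apply HP. pose proof (zero_seq_le 1 (S k) ltac:(lia)).
  destruct H0 as [H0|H0].
  - destruct (extremum_spec 0) as (H1 & _ & H3); [now right|]. lra.
  - pose proof (zero_seq_pos 0). lra.
Qed.

Lemma extremum_spacing k : (1 <= k)%nat \/ 0 < nu ->
  Phi nu (level_zero 0 k) + PI <= Phi nu (level_zero 0 (S k)).
Proof.
  intros Hk. destruct (extremum_spec k Hk) as (H1 & H2 & H3).
  destruct (extremum_spec (S k)) as (H4 & H5 & H6); [left; lia|].
  assert (H0 : 0 <= nu) by apply HP.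
  apply (N_zero_spacing nu J N); try easy; try lra.
  intros x Hx Nx. destruct (Rtotal_order x (z (S k))) as [L|[E|L]].
  - assert (x = level_zero 0 k); [|lra].
    apply (is_level_zero_unique 0 k); [split; lra|now apply level_zero_spec].
  - subst x. revert Nx. apply (energy_J_zero nu J N); [easy|apply zero_seq_pos|].
    apply zero_seq_zero.
  - assert (x = level_zero 0 (S k)); [|lra].
    apply (is_level_zero_unique 0 (S k)); [split; lra|].
    apply level_zero_spec. left; lia.
Qed.

(** Each extremum adds at least [PI]. The count starts from the extremum before the first zero of
    [J] if [nu > 0], and from the origin if [nu = 0], where that extremum is missing. *)
Lemma Phi_extremum_ge k : (1 <= k)%nat -> INR k * PI <= Phi nu (level_zero 0 k).
Proof.
  intros Hk. assert (H0 : 0 <= nu) by apply HP.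
  induction k as [|[|k] IH]; [lia| |].
  - rewrite INR_1, Rmult_1_l. destruct H0 as [H0|H0].
    + pose proof (extremum_spacing 0 (or_intror H0)) as Hs.
      destruct (extremum_spec 0) as (_ & _ & H3); [now right|].
      pose proof (Phi_nonneg nu (level_zero 0 0) ltac:(lra)). lra.
    + destruct (extremum_spec 1) as (H1 & H2 & H3); [left; lia|].
      pose proof (zero_seq_pos 0) as Hz.
      assert (HP0 : bessel_pair 0 J N) by (rewrite H0; exact HP).
      rewrite <- H0. apply (N_first_zero_order0 J N); try easy; try lra.
      intros x Hx Nx. destruct (Rtotal_order x (z 1%nat)) as [L|[E|L]].
      * apply (no_level_zero_ge_nu 0 x); [lra|]. split; [simpl (z 0)|]; lra.
      * subst x. revert Nx. apply (energy_J_zero nu J N); [easy|easy|].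
        apply zero_seq_zero.
      * assert (x = level_zero 0 1); [|lra].
        apply (is_level_zero_unique 0 1); [split; lra|].
        apply level_zero_spec. left; lia.
  - assert (Hk1 : (1 <= S k)%nat) by lia. specialize (IH Hk1).
    pose proof (extremum_spacing (S k) (or_introl Hk1)). rewrite S_INR. lra.
Qed.

Lemma Phi_zero_seq_gt k : INR k * PI < Phi nu (z (S k)).
Proof.
  assert (H0 : 0 <= nu) by apply HP. destruct k as [|k].
  - simpl INR. rewrite Rmult_0_l. apply Phi_pos. pose proof (zero_seq_gt_nu 0). lra.
  - apply Rle_lt_trans with (Phi nu (level_zero 0 (S k))).
    + apply Phi_extremum_ge. lia.
    + destruct (extremum_spec (S k)) as (H1 & _ & H3); [left; lia|].
      apply Phi_incr; lra.
Qed.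

Lemma zero_seq_ge k : INR k * PI < z (S k).
Proof.
  assert (H0 : 0 <= nu) by apply HP. pose proof (zero_seq_gt_nu k).
  pose proof (Phi_zero_seq_gt k). pose proof (Phi_le_w nu (z (S k)) ltac:(lra)).
  pose proof (w_le nu (z (S k)) ltac:(lra)). lra.
Qed.

(** [J_gap] asks for [J] nonzero on a closed interval, so the ends of a gap are approached from
    inside. *)
Lemma Phi_near k e lo : 0 < e -> nu <= lo -> lo < z (S k) ->
  exists b, lo < b < z (S k) /\ Phi nu (z (S k)) - e < Phi nu b.
Proof.
  intros He Hlo Hlt. assert (H0 : 0 <= nu) by apply HP.
  destruct (is_derive_Rabs_lt _ _ _ e (is_derive_Phi nu (z (S k)) ltac:(lra)) He)
    as [d [Hd Hc]].
  set (t := Rmin (d / 2) ((z (S k) - lo) / 2)).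
  assert (Ht : 0 < t) by (apply Rmin_glb_lt; lra).
  pose proof (Rmin_l (d / 2) ((z (S k) - lo) / 2)).
  pose proof (Rmin_r (d / 2) ((z (S k) - lo) / 2)). fold t in H, H1.
  exists (z (S k) - t). split; [lra|].
  specialize (Hc (z (S k) - t)).
  specialize (Hc ltac:(apply Rabs_def1; lra)). apply Rabs_def2 in Hc. lra.
Qed.

Lemma Phi_zero_seq_step k : Phi nu (z (S (S k))) <= Phi nu (z (S k)) + PI.
Proof.
  assert (H0 : 0 <= nu) by apply HP. assert (HS := bessel_pair_system _ _ _ HP).
  pose proof (zero_seq_gt_nu k) as Hz. pose proof (zero_seq_lt (S k)) as Hzz.
  apply Rnot_lt_le. intros Hlt.
  set (e := (Phi nu (z (S (S k))) - (Phi nu (z (S k)) + PI)) / 2).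
  assert (He : 0 < e) by (unfold e; lra).
  destruct (Phi_near (S k) e (z (S k))) as [b [Hb Hbe]]; [easy|lra|easy|].
  destruct (is_derive_Rabs_lt _ _ _ e (is_derive_Phi nu (z (S k)) ltac:(lra)) He)
    as [d [Hd Hc]].
  set (t := Rmin (d / 2) ((b - z (S k)) / 2)).
  assert (Ht : 0 < t) by (apply Rmin_glb_lt; lra).
  pose proof (Rmin_l (d / 2) ((b - z (S k)) / 2)) as M1.
  pose proof (Rmin_r (d / 2) ((b - z (S k)) / 2)) as M2. fold t in M1, M2.
  specialize (Hc (z (S k) + t)).
  specialize (Hc ltac:(apply Rabs_def1; lra)). apply Rabs_def2 in Hc.
  assert (Phi nu b - Phi nu (z (S k) + t) < PI).
  { apply (J_gap nu J N); try easy; try lra.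
    intros x Hx. apply (zero_seq_between (S k)). lra. }
  unfold e in *. lra.
Qed.

Lemma Phi_zero_seq_first : Phi nu (z 1) <= PI.
Proof.
  assert (H0 : 0 <= nu) by apply HP. assert (HS := bessel_pair_system _ _ _ HP).
  pose proof (zero_seq_gt_nu 0) as Hz.
  apply Rnot_lt_le. intros Hlt.
  set (e := (Phi nu (z 1%nat) - PI) / 2).
  assert (He : 0 < e) by (unfold e; lra).
  destruct (Phi_near 0 e nu) as [b [Hb Hbe]]; [easy|lra|easy|].
  pose proof (w_pos nu b ltac:(lra)) as Hw. pose proof (w_sqr nu b ltac:(lra)) as Hw2.
  set (t := Rmin e (w nu b / 2)).
  assert (Ht : 0 < t) by (apply Rmin_glb_lt; lra).
  pose proof (Rmin_l e (w nu b / 2)) as M1. pose proof (Rmin_r e (w nu b / 2)) as M2.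
  fold t in M1, M2.
  (* [chi] is singular at [nu], where [w] vanishes. This [a] has [w nu a = t], so that
     [Phi nu a <= t <= e]. *)
  set (a := sqrt (nu ^ 2 + t ^ 2)).
  assert (Ha2 : a ^ 2 = nu ^ 2 + t ^ 2) by (unfold a; rewrite pow2_sqrt; nra).
  assert (Ha0 : 0 <= a) by apply sqrt_pos.
  assert (Ha : nu < a) by nra.
  assert (Hab : a < b) by nra.
  assert (Hwa : w nu a = t).
  { unfold w. rewrite Ha2. replace (nu ^ 2 + t ^ 2 - nu ^ 2) with (t ^ 2) by ring.
    apply sqrt_pow2. lra. }
  pose proof (Phi_le_w nu a ltac:(lra)) as Hpa.
  assert (Phi nu b - Phi nu a < PI).
  { apply (J_gap nu J N); try easy; try lra.
    intros x Hx. apply (zero_seq_between 0). simpl (z 0). lra. }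
  unfold e in *. lra.
Qed.

Lemma Phi_zero_seq_le k : Phi nu (z (S k)) <= (INR k + 1) * PI.
Proof.
  induction k as [|k IH].
  - simpl INR. pose proof Phi_zero_seq_first. lra.
  - pose proof (Phi_zero_seq_step k). rewrite S_INR. lra.
Qed.

Lemma zero_seq_covers x : 0 < x -> J x <> 0 -> exists k, z k < x < z (S k).
Proof.
  intros Hx Jx. pose proof PI_RGT_0.
  assert (Hex : exists m, x < z m).
  { destruct (INR_unbounded (x / PI)) as [m Hm].
    exists (S m). apply Rlt_trans with (INR m * PI); [|apply zero_seq_ge].
    apply Rmult_lt_reg_r with (/ PI); [now apply Rinv_0_lt_compat|].
    rewrite Rmult_assoc, Rinv_r by lra. unfold Rdiv in Hm. lra. }
  destruct Hex as [m Hm]. induction m as [|m IH].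
  - simpl in Hm. lra.
  - destruct (Rtotal_order x (z m)) as [L|[E|L]].
    + now apply IH.
    + destruct m as [|m]; [simpl in E; lra|]. exfalso. apply Jx. rewrite E.
      apply zero_seq_zero.
    + exists m. lra.
Qed.
End ZeroSequence.

(** * The listing of the critical points *)

Lemma Derive_j (nu delta x : R) : 0 <= nu -> 0 < x ->
  Derive (j nu delta) x =
  Rpower x (- delta) / x * (bessel_N nu x - delta * BesselJ nu x).
Proof.
  intros H Hx. apply is_derive_unique.
  assert (HJ := is_derive_BesselJ nu x H Hx). assert (HR := is_derive_Rpower (- delta) x Hx).
  replace (Rpower x (- delta) / x * (bessel_N nu x - delta * BesselJ nu x)) with
    (plus (mult (- delta * Rpower x (- delta - 1)) (BesselJ nu x))
          (mult (Rpower x (- delta)) (bessel_N nu x / x))).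
  - apply (is_derive_mult (fun x => Rpower x (- delta)) (BesselJ nu)); try easy.
    intros; apply Rmult_comm.
  - unfold plus, mult; simpl.
    replace (- delta - 1) with (- delta + - (1)) by ring.
    rewrite Rpower_plus, (Rpower_Ropp x 1), Rpower_1 by easy. field. lra.
Qed.

Lemma Derive_j_zero (nu delta x : R) : 0 <= nu -> 0 < x ->
  Derive (j nu delta) x = 0 <-> bessel_N nu x = delta * BesselJ nu x.
Proof.
  intros H Hx. rewrite Derive_j by easy. pose proof (Rpower_pos x (- delta)) as Hp.
  assert (0 < Rpower x (- delta) / x) by now apply Rdiv_lt_0_compat.
  split; intros E; [|rewrite E; ring].
  apply Rmult_integral in E. lra.
Qed.

Lemma lists_pos_zeros_le f k0 a k m : lists_pos_zeros f k0 a ->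
  (k0 <= k <= m)%nat -> a k <= a m.
Proof.
  intros (_ & Ha & _) [Hk Hm]. induction Hm as [|m Hm IH]; [lra|].
  specialize (Ha m ltac:(lia)). lra.
Qed.

(** If two lists [c] and [d] agree below [k], then [d k] occurs in [c] at an index that cannot be
    below [k], as [d] is increasing; hence [c k <= d k], and symmetrically. *)
Lemma lists_pos_zeros_unique f k0 a b : lists_pos_zeros f k0 a ->
  lists_pos_zeros f k0 b -> forall k, (k0 <= k)%nat -> a k = b k.
Proof.
  intros La Lb k. induction k as [k IH] using lt_wf_ind. intros Hk.
  assert (Hle : forall c d, lists_pos_zeros f k0 c -> lists_pos_zeros f k0 d ->
    (forall m, (k0 <= m < k)%nat -> c m = d m) -> c k <= d k).
  { intros c d Lc Ld Hcd. destruct (proj1 Ld k Hk) as [Hp Hz].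
    destruct (proj2 (proj2 Lc) _ Hp Hz) as [m [Hm E]].
    destruct (Nat.lt_ge_cases m k) as [L|L].
    - rewrite Hcd in E by lia.
      pose proof (lists_pos_zeros_le f k0 d (S m) k Ld ltac:(lia)).
      pose proof (proj1 (proj2 Ld) m Hm). lra.
    - rewrite <- E. apply (lists_pos_zeros_le f k0 c); [easy|lia]. }
  apply Rle_antisym.
  - apply Hle; try easy. intros m Hm. apply IH; lia.
  - apply Hle; try easy. intros m Hm. symmetry. apply IH; lia.
Qed.

(** The shift [s] is [1] when [delta = - nu < 0]: there the listing starts at index
    [1] although a zero precedes the first positive zero of [J]. *)
Lemma level_zeros_listing (nu delta : R) (s k0 : nat) : 0 <= nu -> (s <= k0)%nat ->
  (k0 = s /\ delta < nu) \/ (k0 = S s /\ nu <= delta) ->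
  lists_pos_zeros (Derive (j nu delta)) k0
    (fun k => level_zero (BesselJ nu) (bessel_N nu) delta (k - s)).
Proof.
  intros H0 Hs Hk0. assert (HP := bessel_pair_BesselJ nu H0).
  set (J := BesselJ nu) in *. set (N := bessel_N nu) in *.
  assert (Hc : forall k, (k0 <= k)%nat -> (1 <= k - s)%nat \/ delta < nu).
  { intros k Hk. destruct Hk0 as [[-> H]|[-> H]]; [now right|left; lia]. }
  assert (Hl : forall k, (k0 <= k)%nat ->
     is_level_zero J N delta (k - s) (level_zero J N delta (k - s))).
  { intros k Hk. apply (level_zero_spec nu J N HP). now apply Hc. }
  assert (Hpos : forall k, (k0 <= k)%nat -> 0 < level_zero J N delta (k - s)).
  { intros k Hk. pose proof (zero_seq_nonneg nu J N HP (k - s)).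
    destruct (Hl k Hk) as [H1 _]. lra. }
  split; [|split].
  - intros k Hk. split; [now apply Hpos|]. apply Derive_j_zero; [easy|now apply Hpos|].
    apply Hl. easy.
  - intros k Hk. destruct (Hl k Hk) as [H1 _]. destruct (Hl (S k) ltac:(lia)) as [H2 _].
    replace (S k - s)%nat with (S (k - s)) in * by lia. lra.
  - intros x Hx Hz. apply Derive_j_zero in Hz; [|easy|easy].
    change (N x = delta * J x) in Hz.
    assert (Jx : J x <> 0).
    { intros Jx. apply (energy_J_zero nu J N x HP Hx Jx). rewrite Hz, Jx. ring. }
    destruct (zero_seq_covers nu J N HP x Hx Jx) as [m Hm].
    assert (Hlz : is_level_zero J N delta m x) by (split; easy).
    assert (Hk : (k0 <= m + s)%nat).
    { destruct Hk0 as [[-> H]|[-> H]]; [lia|]. destruct m as [|m]; [|lia].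
      exfalso. now apply (no_level_zero_ge_nu nu J N HP delta x H). }
    exists (m + s)%nat. split; [easy|].
    apply (is_level_zero_unique nu J N HP delta m); [|easy].
    specialize (Hl (m + s)%nat Hk). now replace (m + s - s)%nat with m in * by lia.
Qed.

Lemma a'_eq (nu delta : R) (s : nat) : 0 <= nu -> (s <= first_index nu delta)%nat ->
  (first_index nu delta = s /\ delta < nu) \/ (first_index nu delta = S s /\ nu <= delta) ->
  forall k, (first_index nu delta <= k)%nat ->
  a' nu delta k = level_zero (BesselJ nu) (bessel_N nu) delta (k - s).
Proof.
  intros H0 Hs Hk0 k Hk. pose proof (level_zeros_listing nu delta s _ H0 Hs Hk0) as HL.
  apply (lists_pos_zeros_unique (Derive (j nu delta)) (first_index nu delta)
    (a' nu delta) (fun k => level_zero (BesselJ nu) (bessel_N nu) delta (k - s)));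
    [|easy|easy].
  unfold a'. apply epsilon_spec. eexists. exact HL.
Qed.

(** If the modulus of [delta] is below [nu], the list and the gaps both start at 0. The remaining
    case is [delta = nu]: gap 0 then holds no critical point, in agreement with a list starting at
    1. *)
Lemma a'_regular (nu delta : R) (k : nat) : Rabs delta <= nu ->
  ~ (0 < nu /\ delta = - nu) -> (1 <= k)%nat ->
  a' nu delta k = level_zero (BesselJ nu) (bessel_N nu) delta k.
Proof.
  intros H Hn Hk. pose proof (Rabs_pos delta). pose proof (Rle_abs delta).
  rewrite (a'_eq nu delta 0).
  - now rewrite Nat.sub_0_r.
  - lra.
  - lia.
  - unfold first_index. destruct (Rlt_dec (Rabs delta) nu) as [L|L]; [left|right].
    + split; [easy|lra].
    + split; [easy|]. assert (E : Rabs delta = nu) by lra.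
      apply Rnot_lt_le. intros Hlt. unfold Rabs in E. destruct (Rcase_abs delta).
      * apply Hn. lra.
      * lra.
  - unfold first_index. destruct (Rlt_dec (Rabs delta) nu); lia.
Qed.

Lemma a'_opposite (nu : R) (k : nat) : 0 < nu ->
  a' nu (- nu) (S k) = level_zero (BesselJ nu) (bessel_N nu) (- nu) k.
Proof.
  intros H. assert (E : first_index nu (- nu) = 1%nat).
  { unfold first_index. rewrite Rabs_Ropp, Rabs_pos_eq by lra.
    destruct (Rlt_dec nu nu); [lra|easy]. }
  rewrite (a'_eq nu (- nu) 1); rewrite ?E; try lra; try lia.
  - now replace (S k - 1)%nat with k by lia.
  - left. split; [easy|lra].
Qed.

(** * The bound valid from the second index on *)

Lemma sqrt_lt_of_Phi (nu x t : R) : 0 <= nu < x -> 0 <= t -> t < Phi nu x ->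
  sqrt (nu ^ 2 + t ^ 2) < x.
Proof.
  intros H Ht Hl. pose proof (Phi_le_w nu x H). pose proof (w_sqr nu x ltac:(lra)).
  rewrite <- (sqrt_pow2 x) by lra. apply sqrt_lt_1_alt. split; nra.
Qed.

(** In both numberings [Phi] at the [k]-th point is at least [(k - 1) * PI], more than
    [(k - 5/4) * PI]. Ordinarily the point lies beyond the [k]-th zero of [J]. For
    [delta = - nu < 0] it lies one gap earlier, but not before the extremum there, since [N / J]
    decreases and the level is negative. *)
Lemma a'_lower_bound (nu delta : R) (k : nat) : Rabs delta <= nu -> (2 <= k)%nat ->
  sqrt (nu ^ 2 + PI ^ 2 * (INR k - 5 / 4) ^ 2) < a' nu delta k.
Proof.
  intros H Hk. pose proof (Rabs_pos delta) as Hd. pose proof PI_RGT_0 as Hpi.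
  assert (H0 : 0 <= nu) by lra. assert (HP := bessel_pair_BesselJ nu H0).
  destruct k as [|k]; [lia|].
  assert (Hk1 : (1 <= k)%nat) by lia. apply le_INR in Hk1 as Hk2. simpl in Hk2.
  assert (HPhi : nu < a' nu delta (S k) /\ INR k * PI <= Phi nu (a' nu delta (S k))).
  { destruct (classic (0 < nu /\ delta = - nu)) as [[Hn ->]|Hn].
    - rewrite a'_opposite by easy.
      pose proof (Phi_extremum_ge nu _ _ HP k Hk1) as Hc.
      pose proof (level_zero_spec nu _ _ HP 0 k (or_introl Hk1)) as L0.
      pose proof (level_zero_spec nu _ _ HP (- nu) k (or_introl Hk1)) as L1.
      destruct (extremum_spec nu _ _ HP k (or_introl Hk1)) as (_ & _ & Hg).
      set (c := level_zero (BesselJ nu) (bessel_N nu) 0 k) in *.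
      set (d := level_zero (BesselJ nu) (bessel_N nu) (- nu) k) in *.
      destruct (Rtotal_order c d) as [L|[E|L]].
      + split; [lra|]. pose proof (Phi_incr nu c d ltac:(lra) L). lra.
      + rewrite <- E. lra.
      + pose proof (is_level_zero_order nu _ _ HP _ _ _ _ _ L1 L0 L). lra.
    - rewrite a'_regular by (easy || lia).
      destruct (level_zero_spec nu _ _ HP delta (S k)) as [L1 _]; [left; lia|].
      pose proof (zero_seq_gt_nu nu _ _ HP k). pose proof (Phi_zero_seq_gt nu _ _ HP k).
      set (d := level_zero (BesselJ nu) (bessel_N nu) delta (S k)) in *.
      split; [lra|]. pose proof (Phi_incr nu (zero_seq (BesselJ nu) (S k)) d). lra. }
  replace (PI ^ 2 * (INR (S k) - 5 / 4) ^ 2) with ((PI * (INR (S k) - 5 / 4)) ^ 2) by ring.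
  rewrite S_INR. apply sqrt_lt_of_Phi; [lra| |]; nra.
Qed.

(** * The Hankel integral *)

(** The real part of [(A - i B) exp (i x - 2 x s)]. Differentiation in [x] multiplies the amplitude
    by [i - 2 s], so derivatives are again kernels. *)
Definition kernel (A B : R -> R) (x s : R) : R :=
  exp (- (2 * x * s)) * (A s * cos x + B s * sin x).

Definition kernel_int (A B : R -> R) (lo hi x : R) : R := RInt (kernel A B x) lo hi.

Lemma is_derive_kernel (A B : R -> R) (x s : R) :
  is_derive (fun x => kernel A B x s) x
    (kernel (fun s => B s - 2 * s * A s) (fun s => - A s - 2 * s * B s) x s).
Proof. unfold kernel. auto_derive; [easy|]. ring. Qed.

Lemma continuous_kernel (A B : R -> R) (x s : R) :
  continuous A s -> continuous B s -> continuous (kernel A B x) s.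
Proof.
  intros HA HB. apply (continuous_mult (fun s => exp (- (2 * x * s)))
    (fun s => A s * cos x + B s * sin x)).
  - apply (ex_derive_continuous (fun s => exp (- (2 * x * s)))). auto_derive. easy.
  - apply (continuous_plus (fun s => A s * cos x) (fun s => B s * sin x)).
    + apply (continuous_mult A (fun _ => cos x)); [easy|apply continuous_const].
    + apply (continuous_mult B (fun _ => sin x)); [easy|apply continuous_const].
Qed.

Lemma ex_RInt_kernel (A B : R -> R) (lo hi x : R) :
  (forall s, 0 < s -> continuous A s) -> (forall s, 0 < s -> continuous B s) ->
  0 < lo -> 0 < hi -> ex_RInt (kernel A B x) lo hi.
Proof.
  intros HA HB Hl Hh. apply ex_RInt_pos_halfline; try easy.
  intros s Hs. apply continuous_kernel; auto.
Qed.

Lemma is_derive_kernel_int (A B : R -> R) (lo hi x : R) :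
  (forall s, 0 < s -> continuous A s) -> (forall s, 0 < s -> continuous B s) ->
  0 < lo -> lo <= hi ->
  is_derive (kernel_int A B lo hi) x
    (kernel_int (fun s => B s - 2 * s * A s) (fun s => - A s - 2 * s * B s) lo hi x).
Proof.
  intros HA HB Hl Hh. unfold kernel_int.
  set (A1 := fun s => B s - 2 * s * A s). set (B1 := fun s => - A s - 2 * s * B s).
  rewrite (RInt_ext (kernel A1 B1 x) (fun t => Derive (fun u => kernel A B u t) x)).
  2: { intros s _. symmetry. apply is_derive_unique, is_derive_kernel. }
  apply (is_derive_RInt_param (kernel A B) lo hi x).
  - apply filter_forall. intros y t _. eexists. apply is_derive_kernel.
  - intros t Ht. rewrite Rmin_left in Ht by lra.
    apply (continuity_2d_pt_ext (kernel A1 B1)).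
    { intros u v. symmetry. apply is_derive_unique, is_derive_kernel. }
    assert (CA : forall f, continuous f t -> continuity_2d_pt (fun _ v : R => f v) x t).
    { intros f Hf. apply (continuity_1d_2d_pt_comp f (fun _ v => v)).
      - now apply continuity_pt_filterlim.
      - apply continuity_2d_pt_id2. }
    assert (CX : forall f, continuity_pt f x -> continuity_2d_pt (fun u _ : R => f u) x t).
    { intros f Hf. apply (continuity_1d_2d_pt_comp f (fun u _ => u)); [easy|].
      apply continuity_2d_pt_id1. }
    assert (HA1 : continuous A1 t).
    { apply (continuous_minus B (fun s => 2 * s * A s)); [apply HB; lra|].
      apply (continuous_mult (fun s => 2 * s) A); [|apply HA; lra].
      apply (ex_derive_continuous (fun s => 2 * s)). auto_derive. easy. }
    assert (HB1 : continuous B1 t).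
    { apply (continuous_minus (fun s => - A s) (fun s => 2 * s * B s)).
      - apply (continuous_opp A), HA; lra.
      - apply (continuous_mult (fun s => 2 * s) B); [|apply HB; lra].
        apply (ex_derive_continuous (fun s => 2 * s)). auto_derive. easy. }
    unfold kernel. apply continuity_2d_pt_mult.
    + apply (continuity_1d_2d_pt_comp exp (fun u v => - (2 * u * v))).
      * apply derivable_continuous_pt, derivable_pt_exp.
      * apply continuity_2d_pt_opp. apply continuity_2d_pt_mult.
        -- apply continuity_2d_pt_mult;
             [apply continuity_2d_pt_const|apply continuity_2d_pt_id1].
        -- apply continuity_2d_pt_id2.
    + apply continuity_2d_pt_plus; apply continuity_2d_pt_mult.
      * now apply CA.
      * apply CX. apply continuity_cos.
      * now apply CA.
      * apply CX. apply continuity_sin.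
  - apply filter_forall. intros y. apply ex_RInt_kernel; auto; lra.
Qed.

(** Modulus and argument of [(s (1 + i s)) ^ (nu - 1/2) * exp (- i phase nu)]. *)
Definition rho (a s : R) : R := Rpower s a * Rpower (1 + s ^ 2) (a / 2).
Definition phase (nu : R) : R := nu * PI / 2 + PI / 4.
Definition theta (nu s : R) : R := (nu - 1 / 2) * atan s - phase nu.

Definition amp_c (nu s : R) : R := rho (nu - 1 / 2) s * cos (theta nu s).
Definition amp_s (nu s : R) : R := - (rho (nu - 1 / 2) s * sin (theta nu s)).

Lemma amp_c_cos (nu x s : R) :
  amp_c nu s * cos x + amp_s nu s * sin x = rho (nu - 1 / 2) s * cos (x + theta nu s).
Proof. unfold amp_c, amp_s. rewrite cos_plus. ring. Qed.

Lemma amp_c_sin (nu x s : R) :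
  amp_c nu s * sin x - amp_s nu s * cos x = rho (nu - 1 / 2) s * sin (x + theta nu s).
Proof. unfold amp_c, amp_s. rewrite sin_plus. ring. Qed.

Lemma is_derive_rho (a s : R) : 0 < s ->
  is_derive (rho a) s (a * (/ s + s / (1 + s ^ 2)) * rho a s).
Proof.
  intros Hs. unfold rho, Rpower. assert (0 < 1 + s ^ 2) by (pose proof (pow2_ge_0 s); lra).
  auto_derive.
  - simpl in *. repeat split; lra.
  - change (s * (s * 1)) with (s ^ 2). field. lra.
Qed.

Lemma is_derive_theta (nu s : R) :
  is_derive (theta nu) s ((nu - 1 / 2) / (1 + s ^ 2)).
Proof.
  assert (0 < 1 + s ^ 2) by (pose proof (pow2_ge_0 s); lra).
  assert (H1 := is_derive_atan s).
  unfold theta. auto_derive; [easy|]. unfold Rsqr. simpl in *. field. lra.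
Qed.

Lemma is_derive_amp_c (nu s : R) : 0 < s ->
  is_derive (amp_c nu) s ((nu - 1 / 2) *
    ((/ s + s / (1 + s ^ 2)) * amp_c nu s + / (1 + s ^ 2) * amp_s nu s)).
Proof.
  intros Hs. assert (H1 := is_derive_rho (nu - 1 / 2) s Hs).
  assert (H2 := is_derive_theta nu s).
  assert (0 < 1 + s ^ 2) by (pose proof (pow2_ge_0 s); lra).
  unfold amp_c, amp_s. set (r := rho (nu - 1 / 2)) in *. set (t := theta nu) in *.
  auto_derive.
  - repeat split; eexists; eassumption.
  - rewrite (Derive_eta _ _ _ H1), (Derive_eta _ _ _ H2). field. simpl in *. lra.
Qed.

Lemma is_derive_amp_s (nu s : R) : 0 < s ->
  is_derive (amp_s nu) s ((nu - 1 / 2) *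
    ((/ s + s / (1 + s ^ 2)) * amp_s nu s - / (1 + s ^ 2) * amp_c nu s)).
Proof.
  intros Hs. assert (H1 := is_derive_rho (nu - 1 / 2) s Hs).
  assert (H2 := is_derive_theta nu s).
  assert (0 < 1 + s ^ 2) by (pose proof (pow2_ge_0 s); lra).
  unfold amp_c, amp_s. set (r := rho (nu - 1 / 2)) in *. set (t := theta nu) in *.
  auto_derive.
  - repeat split; eexists; eassumption.
  - rewrite (Derive_eta _ _ _ H1), (Derive_eta _ _ _ H2). field. simpl in *. lra.
Qed.

Lemma continuous_amp_c (nu s : R) : 0 < s -> continuous (amp_c nu) s.
Proof.
  intros Hs. apply (ex_derive_continuous (amp_c nu)). eexists. now apply is_derive_amp_c.
Qed.

Lemma continuous_amp_s (nu s : R) : 0 < s -> continuous (amp_s nu) s.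
Proof.
  intros Hs. apply (ex_derive_continuous (amp_s nu)). eexists. now apply is_derive_amp_s.
Qed.

Definition amp_c1 (nu s : R) : R := amp_s nu s - 2 * s * amp_c nu s.
Definition amp_s1 (nu s : R) : R := - amp_c nu s - 2 * s * amp_s nu s.
Definition amp_c2 (nu s : R) : R := amp_s1 nu s - 2 * s * amp_c1 nu s.
Definition amp_s2 (nu s : R) : R := - amp_c1 nu s - 2 * s * amp_s1 nu s.

Definition K0 (nu lo hi x : R) : R := kernel_int (amp_c nu) (amp_s nu) lo hi x.
Definition K1 (nu lo hi x : R) : R := kernel_int (amp_c1 nu) (amp_s1 nu) lo hi x.
Definition K2 (nu lo hi x : R) : R := kernel_int (amp_c2 nu) (amp_s2 nu) lo hi x.

Lemma continuous_lin2 (s : R) : continuous (fun s => 2 * s) s.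
Proof. apply (ex_derive_continuous (fun s => 2 * s)). auto_derive. easy. Qed.

Lemma continuous_amp_c1 (nu s : R) : 0 < s -> continuous (amp_c1 nu) s.
Proof.
  intros Hs. apply (continuous_minus (amp_s nu) (fun s => 2 * s * amp_c nu s)).
  - now apply continuous_amp_s.
  - apply (continuous_mult (fun s => 2 * s) (amp_c nu)).
    + apply continuous_lin2.
    + now apply continuous_amp_c.
Qed.

Lemma continuous_amp_s1 (nu s : R) : 0 < s -> continuous (amp_s1 nu) s.
Proof.
  intros Hs. apply (continuous_minus (fun s => - amp_c nu s) (fun s => 2 * s * amp_s nu s)).
  - now apply (continuous_opp (amp_c nu)), continuous_amp_c.
  - apply (continuous_mult (fun s => 2 * s) (amp_s nu)).
    + apply continuous_lin2.
    + now apply continuous_amp_s.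
Qed.

Lemma continuous_amp_c2 (nu s : R) : 0 < s -> continuous (amp_c2 nu) s.
Proof.
  intros Hs. apply (continuous_minus (amp_s1 nu) (fun s => 2 * s * amp_c1 nu s)).
  - now apply continuous_amp_s1.
  - apply (continuous_mult (fun s => 2 * s) (amp_c1 nu)).
    + apply continuous_lin2.
    + now apply continuous_amp_c1.
Qed.

Lemma continuous_amp_s2 (nu s : R) : 0 < s -> continuous (amp_s2 nu) s.
Proof.
  intros Hs. apply (continuous_minus (fun s => - amp_c1 nu s) (fun s => 2 * s * amp_s1 nu s)).
  - now apply (continuous_opp (amp_c1 nu)), continuous_amp_c1.
  - apply (continuous_mult (fun s => 2 * s) (amp_s1 nu)).
    + apply continuous_lin2.
    + now apply continuous_amp_s1.
Qed.

Lemma is_derive_K0 (nu lo hi x : R) : 0 < lo -> lo <= hi ->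
  is_derive (K0 nu lo hi) x (K1 nu lo hi x).
Proof.
  intros Hl Hh.
  change (is_derive (kernel_int (amp_c nu) (amp_s nu) lo hi) x
    (kernel_int (fun s => amp_s nu s - 2 * s * amp_c nu s)
       (fun s => - amp_c nu s - 2 * s * amp_s nu s) lo hi x)).
  apply (is_derive_kernel_int (amp_c nu) (amp_s nu)); try easy; intros.
  - now apply continuous_amp_c.
  - now apply continuous_amp_s.
Qed.

Lemma is_derive_K1 (nu lo hi x : R) : 0 < lo -> lo <= hi ->
  is_derive (K1 nu lo hi) x (K2 nu lo hi x).
Proof.
  intros Hl Hh.
  change (is_derive (kernel_int (amp_c1 nu) (amp_s1 nu) lo hi) x
    (kernel_int (fun s => amp_s1 nu s - 2 * s * amp_c1 nu s)
       (fun s => - amp_c1 nu s - 2 * s * amp_s1 nu s) lo hi x)).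
  apply (is_derive_kernel_int (amp_c1 nu) (amp_s1 nu)); try easy; intros.
  - now apply continuous_amp_c1.
  - now apply continuous_amp_s1.
Qed.

(** The real part of [2 i (s (1 + i s)) ^ (nu + 1/2) exp (i x - 2 x s)], turned by the phase: one
    more factor [s (1 + i s)] than the integrand. *)
Definition boundary (nu x s : R) : R :=
  - 2 * s * exp (- (2 * x * s)) *
  (s * (amp_c nu s * cos x + amp_s nu s * sin x) + (amp_c nu s * sin x - amp_s nu s * cos x)).

(* The integrand of the left-hand side is an exact derivative in [s]. *)
Lemma K_ode (nu lo hi x : R) : 0 < lo -> lo <= hi ->
  x * K2 nu lo hi x + (2 * nu + 1) * K1 nu lo hi x + x * K0 nu lo hi x =
  boundary nu x hi - boundary nu x lo.
Proof.
  intros Hl Hh.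
  assert (E0 : ex_RInt (kernel (amp_c nu) (amp_s nu) x) lo hi).
  { apply ex_RInt_kernel; intros; try lra;
      [now apply continuous_amp_c|now apply continuous_amp_s]. }
  assert (E1 : ex_RInt (kernel (amp_c1 nu) (amp_s1 nu) x) lo hi).
  { apply ex_RInt_kernel; intros; try lra;
      [now apply continuous_amp_c1|now apply continuous_amp_s1]. }
  assert (E2 : ex_RInt (kernel (amp_c2 nu) (amp_s2 nu) x) lo hi).
  { apply ex_RInt_kernel; intros; try lra;
      [now apply continuous_amp_c2|now apply continuous_amp_s2]. }
  apply (RInt_correct (V := R_CompleteNormedModule)) in E0, E1, E2.
  assert (HI : is_RInt (fun s => plus (plus (scal x (kernel (amp_c2 nu) (amp_s2 nu) x s))
     (scal (2 * nu + 1) (kernel (amp_c1 nu) (amp_s1 nu) x s)))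
     (scal x (kernel (amp_c nu) (amp_s nu) x s))) lo hi
     (plus (plus (scal x (K2 nu lo hi x)) (scal (2 * nu + 1) (K1 nu lo hi x)))
        (scal x (K0 nu lo hi x)))).
  { apply (is_RInt_plus (V := R_NormedModule)); [apply (is_RInt_plus (V := R_NormedModule))|];
      apply (is_RInt_scal (V := R_NormedModule)); assumption. }
  assert (HB : is_RInt (fun s => plus (plus (scal x (kernel (amp_c2 nu) (amp_s2 nu) x s))
     (scal (2 * nu + 1) (kernel (amp_c1 nu) (amp_s1 nu) x s)))
     (scal x (kernel (amp_c nu) (amp_s nu) x s))) lo hi
     (minus (boundary nu x hi) (boundary nu x lo))).
  { apply (is_RInt_derive (V := R_CompleteNormedModule) (boundary nu x)).
    - intros s Hs. rewrite Rmin_left in Hs by lra. assert (Hs0 : 0 < s) by lra.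
      assert (Hc := is_derive_amp_c nu s Hs0). assert (Hd := is_derive_amp_s nu s Hs0).
      assert (0 < 1 + s ^ 2) by (pose proof (pow2_ge_0 s); lra).
      unfold boundary, kernel, amp_c2, amp_s2, amp_c1, amp_s1, plus, scal; simpl;
        unfold mult; simpl.
      set (A := amp_c nu) in *. set (B := amp_s nu) in *.
      auto_derive.
      + repeat split; eexists; eassumption.
      + rewrite (Derive_eta _ _ _ Hc), (Derive_eta _ _ _ Hd). field. simpl in *. lra.
    - intros s Hs. rewrite Rmin_left in Hs by lra. assert (Hs0 : 0 < s) by lra.
      apply (continuous_plus (V := R_NormedModule));
        [apply (continuous_plus (V := R_NormedModule))|];
        apply (continuous_scal_r (V := R_NormedModule)); apply continuous_kernel.
      + now apply continuous_amp_c2.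
      + now apply continuous_amp_s2.
      + now apply continuous_amp_c1.
      + now apply continuous_amp_s1.
      + now apply continuous_amp_c.
      + now apply continuous_amp_s. }
  apply (is_RInt_unique (V := R_CompleteNormedModule)) in HI, HB. rewrite HI in HB.
  exact HB.
Qed.

(** [bessel_L] solves [y'' + (2 nu + 1) / x * y' + y = 0], and the truncated integral does so up to
    boundary terms. Wronskians of this equation are multiples of [x ^ (- (2 nu + 1))], so [Omega]
    varies only through those terms. *)
Definition Omega (nu lo hi x : R) : R :=
  Rpower x (2 * nu + 1) *
  (K0 nu lo hi x * bessel_L' nu x - K1 nu lo hi x * bessel_L nu x).

Lemma is_derive_Omega (nu lo hi x : R) : 0 <= nu -> 0 < x -> 0 < lo -> lo <= hi ->
  is_derive (Omega nu lo hi) x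
    (- (Rpower x (2 * nu) * bessel_L nu x * (boundary nu x hi - boundary nu x lo))).
Proof.
  intros H0 Hx Hl Hh.
  assert (HR := is_derive_Rpower (2 * nu + 1) x Hx).
  replace (2 * nu + 1 - 1) with (2 * nu) in HR by ring.
  assert (ER : Rpower x (2 * nu + 1) = Rpower x (2 * nu) * x)
    by (rewrite Rpower_plus, Rpower_1; easy).
  assert (HK0 := is_derive_K0 nu lo hi x Hl Hh). assert (HK1 := is_derive_K1 nu lo hi x Hl Hh).
  assert (HL := is_derive_bessel_L nu x H0). assert (HL1 := is_derive_bessel_L' nu x H0 Hx).
  rewrite <- K_ode by easy.
  unfold Omega.
  set (p := fun x => Rpower x (2 * nu + 1)) in *.
  apply (is_derive_ext (fun x => p x *
   (K0 nu lo hi x * bessel_L' nu x - K1 nu lo hi x * bessel_L nu x))); [easy|].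
  change (Rpower x (2 * nu + 1)) with (p x) in ER.
  set (k0 := K0 nu lo hi) in *. set (k1 := K1 nu lo hi) in *.
  set (L := bessel_L nu) in *. set (L1 := bessel_L' nu) in *.
  auto_derive.
  - repeat split; eexists; eassumption.
  - rewrite (Derive_eta p _ _ HR), (Derive_eta _ _ _ HK0), (Derive_eta _ _ _ HK1),
      (Derive_eta _ _ _ HL), (Derive_eta _ _ _ HL1), ER. field. lra.
Qed.

(** * Laplace integrals, with bounds uniform in the cut-offs *)

Definition laplace_weight (b x s : R) : R := Rpower s b * exp (- (x * s)).

Lemma continuous_laplace_weight (b x s : R) :
  0 < s -> continuous (laplace_weight b x) s.
Proof.
  intros Hs. apply (continuous_mult (fun s => Rpower s b) (fun s => exp (- (x * s)))).
  - now apply continuous_Rpower.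
  - apply (ex_derive_continuous (fun s => exp (- (x * s)))). auto_derive. easy.
Qed.

Lemma ex_RInt_laplace_weight (b x lo hi : R) :
  0 < lo -> 0 < hi -> ex_RInt (laplace_weight b x) lo hi.
Proof.
  intros. apply ex_RInt_pos_halfline; try easy.
  intros; now apply continuous_laplace_weight.
Qed.

Lemma laplace_weight_pos (b x s : R) : 0 < laplace_weight b x s.
Proof. apply Rmult_lt_0_compat; [apply Rpower_pos|apply exp_pos]. Qed.

(* [exp (- x s)] is dominated by a multiple of [(1 + x s) ^ (- b - 2)], which makes
   the integrand a multiple of the derivative of [(s / (1 + x s)) ^ (b + 1)]. *)
Lemma RInt_laplace_weight_le (b : R) : -1 < b -> exists C, 0 < C /\
  forall x lo hi, 0 < x -> 0 < lo -> lo <= hi ->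
  RInt (laplace_weight b x) lo hi <= C * Rpower x (- (b + 1)).
Proof.
  intros Hb. destruct (Rpower_le_exp (b + 2) 1) as [C [HC Hexp]]; try lra.
  exists (C * exp 1 / (b + 1)).
  pose proof (exp_pos 1) as He1.
  split; [apply Rdiv_lt_0_compat; nra|].
  intros x lo hi Hx Hl Hh.
  set (F := fun s => C * exp 1 / (b + 1) * Rpower (s / (1 + x * s)) (b + 1)).
  set (f := fun s => C * exp 1 * Rpower (s / (1 + x * s)) b / (1 + x * s) ^ 2).
  assert (HF : is_RInt f lo hi (minus (F hi) (F lo))).
  { apply (is_RInt_derive (V := R_CompleteNormedModule) F f).
    - intros s Hs. rewrite Rmin_left in Hs by lra.
      assert (0 < 1 + x * s) by nra.
      assert (Hy : 0 < s / (1 + x * s)) by (apply Rdiv_lt_0_compat; lra).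
      assert (H1 : is_derive (fun s => s / (1 + x * s)) s (/ (1 + x * s) ^ 2)).
      { auto_derive; [lra|]. simpl. field. lra. }
      assert (H2 := is_derive_Rpower (b + 1) _ Hy).
      replace (b + 1 - 1) with b in H2 by ring.
      assert (H3 := is_derive_comp _ (fun s => s / (1 + x * s)) s _ _ H2 H1).
      apply (is_derive_scal _ s (C * exp 1 / (b + 1))) in H3.
      unfold F, f.
      replace (C * exp 1 * Rpower (s / (1 + x * s)) b / (1 + x * s) ^ 2) with
        (C * exp 1 / (b + 1) * scal (/ (1 + x * s) ^ 2)
          ((b + 1) * Rpower (s / (1 + x * s)) b)); [exact H3|].
      unfold scal; simpl; unfold mult; simpl. field. lra.
    - intros s Hs. rewrite Rmin_left in Hs by lra.
      assert (0 < 1 + x * s) by nra.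
      assert (Hy : 0 < s / (1 + x * s)) by (apply Rdiv_lt_0_compat; lra).
      apply (ex_derive_continuous f). unfold f, Rpower. auto_derive.
      simpl. repeat split; try lra. nra. }
  apply Rle_trans with (RInt f lo hi).
  - apply RInt_le; try lra.
    + apply ex_RInt_laplace_weight; lra.
    + eexists; exact HF.
    + intros s Hs. unfold laplace_weight, f.
      assert (Hp : 0 < 1 + x * s) by nra.
      assert (Hs0 : 0 < s) by lra.
      specialize (Hexp (1 + x * s) Hp). rewrite Rmult_1_l, exp_plus in Hexp.
      replace (Rpower (s / (1 + x * s)) b)
        with (Rpower s b * Rpower (1 + x * s) (- b)).
      2: { unfold Rpower. rewrite <- exp_plus. f_equal. rewrite ln_div by lra. ring. }
      rewrite exp_Ropp. rewrite <- Rpower_pow by lra.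
      replace (C * exp 1 * (Rpower s b * Rpower (1 + x * s) (- b)) /
         Rpower (1 + x * s) (INR 2)) with
        (Rpower s b * (C * exp 1 * / Rpower (1 + x * s) (b + 2))).
      2: { rewrite Rpower_plus, Rpower_Ropp.
           replace (INR 2) with 2 by (simpl; ring).
           pose proof (Rpower_pos (1 + x * s) b). pose proof (Rpower_pos (1 + x * s) 2).
           field. lra. }
      apply Rmult_le_compat_l; [left; apply Rpower_pos|].
      pose proof (Rpower_pos (1 + x * s) (b + 2)) as Hr. pose proof (exp_pos (x * s)) as He.
      apply Rmult_le_reg_l with (exp (x * s)); [easy|].
      rewrite Rinv_r by lra.
      apply Rmult_le_reg_r with (Rpower (1 + x * s) (b + 2)); [easy|].
      replace (exp (x * s) * (C * exp 1 * / Rpower (1 + x * s) (b + 2)) *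
        Rpower (1 + x * s) (b + 2)) with (C * (exp 1 * exp (x * s))) by (field; lra).
      lra.
  - rewrite (is_RInt_unique _ _ _ _ HF). unfold minus, plus, opp; simpl.
    assert (Hpos : 0 < C * exp 1 / (b + 1)) by (apply Rdiv_lt_0_compat; nra).
    assert (0 < F lo) by (unfold F; apply Rmult_lt_0_compat; [easy|apply Rpower_pos]).
    apply Rle_trans with (F hi); [lra|]. unfold F.
    apply Rmult_le_compat_l; [lra|].
    replace (Rpower x (- (b + 1))) with (Rpower (/ x) (b + 1)).
    2: { unfold Rpower. rewrite ln_Rinv by easy. f_equal. ring. }
    assert (0 < 1 + x * hi) by nra.
    apply Rle_Rpower_l; [lra|]. split; [apply Rdiv_lt_0_compat; lra|].
    apply Rmult_le_reg_l with (x * (1 + x * hi)); [nra|].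
    replace (x * (1 + x * hi) * (hi / (1 + x * hi))) with (x * hi) by (field; lra).
    replace (x * (1 + x * hi) * / x) with (1 + x * hi) by (field; lra). lra.
Qed.

Lemma RInt_le_laplace (b1 b2 : R) : -1 < b1 -> -1 < b2 -> exists C, 0 < C /\
  forall (f : R -> R) (M x lo hi : R), 0 < x -> 0 < lo -> lo <= hi -> 0 <= M ->
  (forall s, 0 < s -> continuous f s) ->
  (forall s, 0 < s -> Rabs (f s) <= M * ((Rpower s b1 + Rpower s b2) * exp (- (x * s)))) ->
  Rabs (RInt f lo hi) <= M * C * (Rpower x (- (b1 + 1)) + Rpower x (- (b2 + 1))).
Proof.
  intros H1 H2.
  destruct (RInt_laplace_weight_le b1 H1) as [C1 [HC1 B1]].
  destruct (RInt_laplace_weight_le b2 H2) as [C2 [HC2 B2]].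
  exists (C1 + C2). split; [lra|].
  intros f M x lo hi Hx Hl Hh HM Hc Hf.
  specialize (B1 x lo hi Hx Hl Hh). specialize (B2 x lo hi Hx Hl Hh).
  assert (E1 := RInt_correct _ _ _ (ex_RInt_laplace_weight b1 x lo hi Hl ltac:(lra))).
  assert (E2 := RInt_correct _ _ _ (ex_RInt_laplace_weight b2 x lo hi Hl ltac:(lra))).
  assert (E : is_RInt (fun s => scal M (plus (laplace_weight b1 x s) (laplace_weight b2 x s)))
    lo hi (scal M (plus (RInt (laplace_weight b1 x) lo hi) (RInt (laplace_weight b2 x) lo hi)))).
  { apply (is_RInt_scal (V := R_NormedModule)).
    now apply (is_RInt_plus (V := R_NormedModule)). }
  assert (Hex : ex_RInt f lo hi) by (apply ex_RInt_pos_halfline; auto; lra).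
  eapply Rle_trans; [apply abs_RInt_le; easy|].
  eapply Rle_trans.
  - apply (RInt_le _ (fun s => scal M (plus (laplace_weight b1 x s) (laplace_weight b2 x s))));
      [easy| |eexists; exact E|].
    + apply (ex_RInt_norm f). easy.
    + intros s Hs. unfold laplace_weight, scal, plus; simpl; unfold mult; simpl.
      rewrite <- Rmult_plus_distr_r. apply Hf. lra.
  - rewrite (is_RInt_unique _ _ _ _ E).
    unfold scal, plus; simpl; unfold mult; simpl.
    rewrite Rmult_assoc. apply Rmult_le_compat_l; [easy|].
    pose proof (Rpower_pos x (- (b1 + 1))). pose proof (Rpower_pos x (- (b2 + 1))). nra.
Qed.

Lemma Rpower_le_exponent_small (x b c : R) : 0 < x <= 1 -> b <= c ->
  Rpower x c <= Rpower x b.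
Proof.
  intros Hx Hb. unfold Rpower. apply exp_le_exp.
  assert (ln x <= 0) by (rewrite <- ln_1; apply ln_le; lra). nra.
Qed.

(* The weight [s ^ a + s ^ (a + max a 0)] controls [rho a] at [0] and at infinity. *)
Definition rho_bound (a s : R) : R := Rpower s a + Rpower s (a + Rmax a 0).

Lemma one_plus_sqr_power_le (p s : R) : 0 <= p -> 0 < s ->
  Rpower (1 + s ^ 2) (p / 2) <= Rpower 2 (p / 2) * (1 + Rpower s p).
Proof.
  intros Hp Hs. pose proof (Rpower_pos s p). pose proof (Rpower_pos 2 (p / 2)).
  destruct (Rle_lt_dec s 1) as [L|L].
  - apply Rle_trans with (Rpower 2 (p / 2)); [|nra].
    apply Rle_Rpower_l; [lra|]. split; simpl; nra.
  - apply Rle_trans with (Rpower 2 (p / 2) * Rpower s p); [|nra].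
    replace (Rpower s p) with (Rpower (s ^ 2) (p / 2)).
    + rewrite Rpower_mult_distr by (simpl; nra).
      apply Rle_Rpower_l; [lra|]. split; simpl; nra.
    + rewrite <- Rpower_pow by easy. rewrite Rpower_mult. f_equal. simpl. field.
Qed.

Lemma rho_pos (a s : R) : 0 < rho a s.
Proof. apply Rmult_lt_0_compat; apply Rpower_pos. Qed.

Lemma rho_bound_pos (a s : R) : 0 < rho_bound a s.
Proof. apply Rplus_lt_0_compat; apply Rpower_pos. Qed.

Lemma power_mult_le_rho_bound (a s : R) : 0 < s ->
  Rpower s a * Rpower (1 + s ^ 2) (Rmax a 0 / 2) <= Rpower 2 (Rmax a 0 / 2) * rho_bound a s.
Proof.
  intros Hs. pose proof (Rmax_r a 0).
  pose proof (one_plus_sqr_power_le (Rmax a 0) s ltac:(lra) Hs) as H1.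
  unfold rho_bound. rewrite Rpower_plus. pose proof (Rpower_pos s a).
  apply Rle_trans with (Rpower s a * (Rpower 2 (Rmax a 0 / 2) * (1 + Rpower s (Rmax a 0))));
    [|right; ring].
  apply Rmult_le_compat_l; lra.
Qed.

Lemma rho_le (a s : R) : 0 < s -> rho a s <= Rpower 2 (Rmax a 0 / 2) * rho_bound a s.
Proof.
  intros Hs. eapply Rle_trans; [|now apply power_mult_le_rho_bound].
  unfold rho. apply Rmult_le_compat_l; [left; apply Rpower_pos|].
  apply Rle_Rpower; [pose proof (pow2_ge_0 s); lra|]. pose proof (Rmax_l a 0). lra.
Qed.

(** The mean value theorem for [(1 + y ^ 2) ^ (a / 2)] on [[0, s]]. The factor [s] gained here
    becomes a factor [/ x] after integration. *)
Lemma rho_sub_le (a s : R) : 0 < s ->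
  Rabs (rho a s - Rpower s a) <= Rabs a * Rpower 2 (Rmax a 0 / 2) * (s * rho_bound a s).
Proof.
  intros Hs. pose proof (Rpower_pos s a) as Hp.
  assert (H1 : Rabs (Rpower (1 + s ^ 2) (a / 2) - Rpower (1 + 0 ^ 2) (a / 2)) <=
    Rabs a * Rpower (1 + s ^ 2) (Rmax a 0 / 2) * (s - 0)).
  { apply (Rabs_sub_le_of_is_derive (fun y => Rpower (1 + y ^ 2) (a / 2))
      (fun y => a * y * / (1 + y ^ 2) * Rpower (1 + y ^ 2) (a / 2))); [lra| |].
    - intros y Hy. unfold Rpower. assert (0 < 1 + y ^ 2) by (pose proof (pow2_ge_0 y); lra).
      auto_derive; [simpl in *; lra|]. change (y * (y * 1)) with (y ^ 2). field. lra.
    - intros y Hy. assert (H0 : 0 < 1 + y ^ 2) by (pose proof (pow2_ge_0 y); lra).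
      pose proof (Rpower_pos (1 + y ^ 2) (a / 2)) as H1.
      pose proof (Rinv_0_lt_compat _ H0) as H2.
      rewrite !Rabs_mult, (Rabs_pos_eq y), (Rabs_pos_eq (/ _)), (Rabs_pos_eq (Rpower _ _)) by lra.
      rewrite !Rmult_assoc. apply Rmult_le_compat_l; [apply Rabs_pos|].
      rewrite <- Rmult_assoc. rewrite <- (Rmult_1_l (Rpower (1 + s ^ 2) _)).
      apply Rmult_le_compat; try lra.
      + apply Rmult_le_pos; lra.
      + apply Rmult_le_reg_r with (1 + y ^ 2); [easy|].
        rewrite Rmult_assoc, Rinv_l by lra. simpl; nra.
      + apply Rle_trans with (Rpower (1 + y ^ 2) (Rmax a 0 / 2)).
        * apply Rle_Rpower; [pose proof (pow2_ge_0 y); lra|]. pose proof (Rmax_l a 0). lra.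
        * pose proof (Rmax_r a 0). apply Rle_Rpower_l; [lra|]. split; simpl; nra. }
  replace (1 + 0 ^ 2) with 1 in H1 by ring.
  replace (Rpower 1 (a / 2)) with 1 in H1.
  2: { unfold Rpower. now rewrite ln_1, Rmult_0_r, exp_0. }
  unfold rho. replace (Rpower s a * Rpower (1 + s ^ 2) (a / 2) - Rpower s a)
    with (Rpower s a * (Rpower (1 + s ^ 2) (a / 2) - 1)) by ring.
  rewrite Rabs_mult, (Rabs_pos_eq (Rpower s a)) by lra.
  apply Rle_trans with (Rabs a * s * (Rpower s a * Rpower (1 + s ^ 2) (Rmax a 0 / 2))).
  - apply Rle_trans with (Rpower s a * (Rabs a * Rpower (1 + s ^ 2) (Rmax a 0 / 2) * (s - 0)));
      [|right; ring].
    apply Rmult_le_compat_l; lra.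
  - apply Rle_trans with (Rabs a * s * (Rpower 2 (Rmax a 0 / 2) * rho_bound a s)); [|right; ring].
    apply Rmult_le_compat_l; [|now apply power_mult_le_rho_bound].
    apply Rmult_le_pos; [apply Rabs_pos|lra].
Qed.

Lemma sin_lipschitz (u v : R) : Rabs (sin u - sin v) <= Rabs (u - v).
Proof.
  assert (H : forall a b, a <= b -> Rabs (sin b - sin a) <= 1 * (b - a)).
  { intros a b Hab. apply (Rabs_sub_le_of_is_derive sin cos); [easy| |].
    - intros x _. apply is_derive_sin.
    - intros x _. apply Rabs_le, COS_bound. }
  destruct (Rle_lt_dec v u) as [L|L].
  - rewrite (Rabs_pos_eq (u - v)) by lra. specialize (H v u L). lra.
  - rewrite Rabs_minus_sym, (Rabs_minus_sym u), (Rabs_pos_eq (v - u)) by lra.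
    specialize (H u v ltac:(lra)). lra.
Qed.

Lemma cos_lipschitz (u v : R) : Rabs (cos u - cos v) <= Rabs (u - v).
Proof.
  rewrite <- !sin_shift. eapply Rle_trans; [apply sin_lipschitz|].
  rewrite <- (Rabs_Ropp (u - v)). right. f_equal. ring.
Qed.

Lemma Rabs_sin_le (u : R) : Rabs (sin u) <= Rabs u.
Proof.
  pose proof (sin_lipschitz u 0) as H. now rewrite sin_0, !Rminus_0_r in H.
Qed.

Lemma atan_le_self (y : R) : 0 <= y -> 0 <= atan y <= y.
Proof.
  intros Hy.
  assert (H : Rabs (atan y - atan 0) <= 1 * (y - 0)).
  { apply (Rabs_sub_le_of_is_derive atan (fun y => / (1 + y²))); [easy| |].
    - intros x _. apply is_derive_atan.
    - intros x _. pose proof (Rle_0_sqr x).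
      rewrite Rabs_pos_eq by (left; apply Rinv_0_lt_compat; lra).
      rewrite <- Rinv_1. apply Rinv_le_contravar; lra. }
  rewrite atan_0, !Rminus_0_r in H.
  assert (0 <= atan y).
  { destruct Hy as [Hy| <-]; [|rewrite atan_0; lra].
    left. rewrite <- atan_0. now apply atan_increasing. }
  rewrite Rabs_pos_eq in H by easy. lra.
Qed.

Lemma acot_bound (s : R) : 0 < s -> 0 <= PI / 2 - atan s <= 4 / (1 + s).
Proof.
  intros Hs. pose proof (Rinv_0_lt_compat _ Hs).
  pose proof (atan_le_self (/ s) ltac:(lra)) as H1.
  rewrite atan_inv in H1 by easy. split; [lra|].
  apply Rmult_le_reg_r with (1 + s); [lra|].
  replace (4 / (1 + s) * (1 + s)) with 4 by (field; lra).
  destruct (Rle_lt_dec s 1) as [L|L].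
  - pose proof (atan_le_self s ltac:(lra)). pose proof PI_4. nra.
  - apply Rle_trans with (/ s * (1 + s)).
    + apply Rmult_le_compat_r; lra.
    + replace (/ s * (1 + s)) with (/ s + 1) by (field; lra).
      assert (/ s < 1); [|lra]. rewrite <- Rinv_1. apply Rinv_lt_contravar; lra.
Qed.

(* The phase is chosen so that the real part vanishes as [s] tends to infinity; this is
   what makes the integral the solution that is recessive at [x = 0]. *)
Lemma cos_theta_bound (nu x s : R) : 0 < x -> 0 < s ->
  Rabs (cos (x + theta nu s)) <= x + Rabs (nu - 1 / 2) * (4 / (1 + s)).
Proof.
  intros Hx Hs. pose proof (acot_bound s Hs).
  replace (x + theta nu s) with
    (- (PI / 2 - (x - (nu - 1 / 2) * (PI / 2 - atan s))))
    by (unfold theta, phase; field).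
  rewrite cos_neg, cos_shift.
  eapply Rle_trans; [apply Rabs_sin_le|].
  eapply Rle_trans; [apply Rabs_triang|].
  rewrite Rabs_Ropp, Rabs_mult, (Rabs_pos_eq x), (Rabs_pos_eq (PI / 2 - atan s)) by lra.
  apply Rplus_le_compat_l. apply Rmult_le_compat_l; [apply Rabs_pos|lra].
Qed.

Lemma kernel0_eq (nu x s : R) : kernel (amp_c nu) (amp_s nu) x s =
  exp (- (2 * x * s)) * (rho (nu - 1 / 2) s * cos (x + theta nu s)).
Proof. unfold kernel. now rewrite amp_c_cos. Qed.

Lemma kernel1_eq (nu x s : R) : kernel (amp_c1 nu) (amp_s1 nu) x s =
  - (exp (- (2 * x * s)) * (rho (nu - 1 / 2) s *
     (2 * s * cos (x + theta nu s) + sin (x + theta nu s)))).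
Proof.
  unfold kernel.
  replace (amp_c1 nu s * cos x + amp_s1 nu s * sin x) with
    (- (2 * s * (amp_c nu s * cos x + amp_s nu s * sin x) +
      (amp_c nu s * sin x - amp_s nu s * cos x))) by (unfold amp_c1, amp_s1; ring).
  rewrite amp_c_cos, amp_c_sin. ring.
Qed.

Lemma continuous_kernel0 (nu x s : R) : 0 < s ->
  continuous (kernel (amp_c nu) (amp_s nu) x) s.
Proof.
  intros Hs. apply continuous_kernel; [now apply continuous_amp_c|now apply continuous_amp_s].
Qed.

Lemma continuous_kernel1 (nu x s : R) : 0 < s ->
  continuous (kernel (amp_c1 nu) (amp_s1 nu) x) s.
Proof.
  intros Hs. apply continuous_kernel; [now apply continuous_amp_c1|now apply continuous_amp_s1].
Qed.

Lemma exp_double_le (x s : R) : 0 < x -> 0 < s ->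
  exp (- (2 * x * s)) <= exp (- (x * s)).
Proof. intros. apply exp_le_exp. nra. Qed.

Lemma K0_le (nu : R) : 0 <= nu -> exists C, 0 < C /\ forall x lo hi,
  0 < x -> 0 < lo -> lo <= hi ->
  Rabs (K0 nu lo hi x) <= C * (Rpower x (- (nu - 1 / 2 + 1)) +
    Rpower x (- (nu - 1 / 2 + Rmax (nu - 1 / 2) 0 + 1))).
Proof.
  intros H. set (a := nu - 1 / 2). pose proof (Rmax_r a 0) as Hm.
  destruct (RInt_le_laplace a (a + Rmax a 0)) as [C [HC HB]]; [unfold a; lra|unfold a in *; lra|].
  pose proof (Rpower_pos 2 (Rmax a 0 / 2)) as Hc.
  exists (Rpower 2 (Rmax a 0 / 2) * C). split; [nra|].
  intros x lo hi Hx Hl Hh. apply HB; try easy; try lra.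
  - intros; now apply continuous_kernel0.
  - intros s Hs. rewrite kernel0_eq. fold a.
    pose proof (rho_le a s Hs) as Hr. pose proof (rho_pos a s) as Hr0.
    pose proof (exp_double_le x s Hx Hs) as He. pose proof (exp_pos (- (2 * x * s))) as He0.
    rewrite !Rabs_mult, (Rabs_pos_eq (exp _)), (Rabs_pos_eq (rho _ _)) by lra.
    assert (Rabs (cos (x + theta nu s)) <= 1) by apply Rabs_le, COS_bound.
    apply Rle_trans with (exp (- (x * s)) * (Rpower 2 (Rmax a 0 / 2) * rho_bound a s * 1)).
    + pose proof (Rabs_pos (cos (x + theta nu s))).
      apply Rmult_le_compat; try lra; [nra|]. apply Rmult_le_compat; lra.
    + right. unfold rho_bound. ring.
Qed.

Lemma mul_exp_neg_le (t : R) : t * exp (- t) <= 1.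
Proof.
  rewrite exp_Ropp. pose proof (exp_pos t). pose proof (exp_ineq1_le t).
  apply Rmult_le_reg_r with (exp t); [easy|].
  rewrite Rmult_assoc, Rinv_l; lra.
Qed.

(** The factor [2 s] produced by differentiation would cost a factor [/ x] and spoil the limit of
    [Omega] at 0. [cos_theta_bound] avoids this: [s] times the cosine is at most [x s] plus a
    constant. *)
Lemma K1_le (nu : R) : 0 <= nu -> exists C, 0 < C /\ forall x lo hi,
  0 < x -> 0 < lo -> lo <= hi ->
  Rabs (K1 nu lo hi x) <= C * (Rpower x (- (nu - 1 / 2 + 1)) +
    Rpower x (- (nu - 1 / 2 + Rmax (nu - 1 / 2) 0 + 1))).
Proof.
  intros H. set (a := nu - 1 / 2). pose proof (Rmax_r a 0) as Hm.
  destruct (RInt_le_laplace a (a + Rmax a 0)) as [C [HC HB]]; [unfold a; lra|unfold a in *; lra|].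
  pose proof (Rpower_pos 2 (Rmax a 0 / 2)) as Hc.
  set (M := (3 + 8 * Rabs a) * Rpower 2 (Rmax a 0 / 2)).
  pose proof (Rabs_pos a) as Ha.
  assert (HM : 0 < M) by (unfold M; apply Rmult_lt_0_compat; lra).
  exists (M * C). split; [nra|].
  intros x lo hi Hx Hl Hh. apply HB; try easy; try lra.
  - intros; now apply continuous_kernel1.
  - intros s Hs. rewrite kernel1_eq. fold a.
    pose proof (rho_le a s Hs) as Hr. pose proof (rho_pos a s) as Hr0.
    set (c := cos (x + theta nu s)). set (S := sin (x + theta nu s)).
    assert (Hcb : Rabs c <= x + Rabs a * (4 / (1 + s))) by now apply cos_theta_bound.
    assert (HS : Rabs S <= 1) by apply Rabs_le, SIN_bound.
    assert (H1 : Rabs (2 * s * c + S) <= 2 * (x * s) + 8 * Rabs a + 1).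
    { eapply Rle_trans; [apply Rabs_triang|].
      rewrite !Rabs_mult, (Rabs_pos_eq 2), (Rabs_pos_eq s) by lra.
      assert (2 * s * Rabs c <= 2 * (x * s) + 8 * Rabs a); [|lra].
      apply Rle_trans with (2 * s * (x + Rabs a * (4 / (1 + s)))).
      - apply Rmult_le_compat_l; lra.
      - assert (Rabs a * (s / (1 + s)) <= Rabs a * 1).
        { apply Rmult_le_compat_l; [easy|]. apply Rmult_le_reg_r with (1 + s); [lra|].
          replace (s / (1 + s) * (1 + s)) with s by (field; lra). lra. }
        replace (2 * s * (x + Rabs a * (4 / (1 + s)))) with
          (2 * (x * s) + 8 * (Rabs a * (s / (1 + s)))) by (field; lra). lra. }
    pose proof (exp_pos (- (x * s))) as He.
    rewrite Rabs_Ropp, !Rabs_mult, (Rabs_pos_eq (exp _)), (Rabs_pos_eq (rho _ _));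
      [|lra|left; apply exp_pos].
    (* One half of the exponential absorbs [x * s]; the other remains as the Laplace weight. *)
    replace (- (2 * x * s)) with (- (x * s) + - (x * s)) by ring. rewrite exp_plus.
    assert (H2 : exp (- (x * s)) * Rabs (2 * s * c + S) <= 3 + 8 * Rabs a).
    { apply Rle_trans with (exp (- (x * s)) * (2 * (x * s) + 8 * Rabs a + 1)).
      - apply Rmult_le_compat_l; lra.
      - pose proof (mul_exp_neg_le (x * s)).
        assert (exp (- (x * s)) <= 1) by (rewrite <- exp_0; apply exp_le_exp; nra).
        nra. }
    apply Rle_trans with (exp (- (x * s)) * (Rpower 2 (Rmax a 0 / 2) * rho_bound a s) *
      (3 + 8 * Rabs a)).
    + replace (exp (- (x * s)) * exp (- (x * s)) * (rho a s * Rabs (2 * s * c + S)))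
        with (exp (- (x * s)) * rho a s * (exp (- (x * s)) * Rabs (2 * s * c + S))) by ring.
      pose proof (Rabs_pos (2 * s * c + S)).
      apply Rmult_le_compat; try nra.
    + right. unfold M, rho_bound. ring.
Qed.

(** Leading factor in Laplace's method: near [s = 0] the modulus of the amplitude is
    [s ^ (nu - 1/2)] and its argument is constant. *)
Definition laplace_int (nu lo hi x : R) : R := RInt (laplace_weight (nu - 1 / 2) (2 * x)) lo hi.

Lemma Rpower_S (s b : R) : 0 < s -> Rpower s (b + 1) = s * Rpower s b.
Proof. intros Hs. rewrite Rpower_plus, Rpower_1 by easy. ring. Qed.

(** [F] stands for the cosine or the sine. Both the modulus and the angle, which moves by
    [a * atan s], differ from their leading forms by a factor of order [s]. *)
Lemma amplitude_error (nu x s : R) (F : R -> R) : 0 < x -> 0 < s ->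
  (forall u v, Rabs (F u - F v) <= Rabs (u - v)) -> (forall u, Rabs (F u) <= 1) ->
  let a := nu - 1 / 2 in
  Rabs (rho a s * F (x + theta nu s) - Rpower s a * F (x - phase nu)) <=
  Rabs a * (Rpower 2 (Rmax a 0 / 2) + 1) * (s * rho_bound a s).
Proof.
  intros Hx Hs HL H1 a.
  pose proof (rho_sub_le a s Hs) as Hr. pose proof (Rpower_pos s a) as Hp.
  pose proof (Rpower_pos s (a + Rmax a 0)) as Hp2.
  pose proof (Rabs_pos a) as Ha.
  replace (rho a s * F (x + theta nu s) - Rpower s a * F (x - phase nu)) with
    ((rho a s - Rpower s a) * F (x + theta nu s) +
     Rpower s a * (F (x + theta nu s) - F (x - phase nu))) by ring.
  eapply Rle_trans; [apply Rabs_triang|]. rewrite !Rabs_mult, (Rabs_pos_eq (Rpower s a)) by lra.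
  assert (Hd : Rabs (F (x + theta nu s) - F (x - phase nu)) <= Rabs a * s).
  { eapply Rle_trans; [apply HL|].
    replace (x + theta nu s - (x - phase nu)) with (a * atan s)
      by (unfold theta, a; ring).
    pose proof (atan_le_self s ltac:(lra)).
    rewrite Rabs_mult, (Rabs_pos_eq (atan s)) by lra. apply Rmult_le_compat_l; lra. }
  specialize (H1 (x + theta nu s)).
  pose proof (Rabs_pos (F (x + theta nu s))). pose proof (Rabs_pos (rho a s - Rpower s a)).
  assert (Rabs (rho a s - Rpower s a) * Rabs (F (x + theta nu s)) <=
    Rabs a * Rpower 2 (Rmax a 0 / 2) * (s * rho_bound a s) * 1)
    by (apply Rmult_le_compat; lra).
  assert (Rpower s a * Rabs (F (x + theta nu s) - F (x - phase nu)) <=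
    rho_bound a s * (Rabs a * s)).
  { apply Rmult_le_compat; try lra; [apply Rabs_pos|]. unfold rho_bound. lra. }
  nra.
Qed.

Lemma RInt_sub_laplace (nu x c lo hi : R) (f : R -> R) : 0 < lo -> lo <= hi ->
  (forall s, 0 < s -> continuous f s) ->
  RInt (fun s => f s - c * laplace_weight (nu - 1 / 2) (2 * x) s) lo hi =
  RInt f lo hi - c * laplace_int nu lo hi x /\
  forall s, 0 < s -> continuous (fun s => f s - c * laplace_weight (nu - 1 / 2) (2 * x) s) s.
Proof.
  intros Hl Hh Hf. split.
  - apply is_RInt_unique.
    apply (is_RInt_minus (V := R_NormedModule) f
      (fun s => c * laplace_weight (nu - 1 / 2) (2 * x) s)).
    + apply (RInt_correct (V := R_CompleteNormedModule)). apply ex_RInt_pos_halfline; auto; lra.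
    + apply (is_RInt_scal (V := R_NormedModule) (laplace_weight (nu - 1 / 2) (2 * x))).
      apply (RInt_correct (V := R_CompleteNormedModule)). apply ex_RInt_laplace_weight; lra.
  - intros s Hs. apply (continuous_minus f (fun s => c * laplace_weight (nu - 1 / 2) (2 * x) s)).
    + auto.
    + apply (continuous_scal_r c (laplace_weight (nu - 1 / 2) (2 * x))).
      now apply continuous_laplace_weight.
Qed.

(** Each error carries an extra factor [s], hence one more power of [/ x] than the main term. In
    [K1] the term with [2 s] times the cosine goes wholly into the error, which accounts for
    [2 * cr] in [M]. *)
Lemma K_asymp (nu : R) : 0 <= nu -> exists C, 0 < C /\ forall x lo hi,
  1 <= x -> 0 < lo -> lo <= hi ->
  Rabs (K0 nu lo hi x) <= C * Rpower x (- (nu + 1 / 2)) /\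
  Rabs (K0 nu lo hi x - cos (x - phase nu) * laplace_int nu lo hi x) <=
    C * Rpower x (- (nu + 3 / 2)) /\
  Rabs (K1 nu lo hi x - - sin (x - phase nu) * laplace_int nu lo hi x) <=
    C * Rpower x (- (nu + 3 / 2)).
Proof.
  intros H. set (a := nu - 1 / 2). pose proof (Rmax_r a 0) as Hm.
  assert (Hpow : forall x b c, 1 <= x -> b <= c -> Rpower x (- c) <= Rpower x (- b)).
  { intros x b c Hx Hbc. apply Rle_Rpower; lra. }
  destruct (K0_le nu H) as [C0 [HC0 B0]].
  destruct (RInt_le_laplace (a + 1) (a + Rmax a 0 + 1)) as [C [HC HB]];
    [unfold a; lra|unfold a in *; lra|].
  pose proof (Rpower_pos 2 (Rmax a 0 / 2)) as Hc. set (cr := Rpower 2 (Rmax a 0 / 2)) in *.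
  pose proof (Rabs_pos a) as Ha.
  set (M := Rabs a * (cr + 1) + 2 * cr).
  assert (HM : 0 < M) by (unfold M; nra).
  assert (Herr : forall f x lo hi, 1 <= x -> 0 < lo -> lo <= hi ->
    (forall s, 0 < s -> continuous f s) ->
    (forall s, 0 < s -> Rabs (f s) <= M * (exp (- (2 * x * s)) * (s * rho_bound a s))) ->
    Rabs (RInt f lo hi) <= 2 * M * C * Rpower x (- (nu + 3 / 2))).
  { intros f x lo hi Hx Hl Hh Hcf Hf.
    eapply Rle_trans.
    - apply (HB f M x lo hi); try easy; try lra.
      intros s Hs. eapply Rle_trans; [now apply Hf|].
      apply Rmult_le_compat_l; [lra|]. rewrite !Rpower_S by easy.
      rewrite <- Rmult_plus_distr_l, Rmult_comm.
      pose proof (rho_bound_pos a s).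
      apply Rmult_le_compat_l; [apply Rmult_le_pos; unfold rho_bound in *; lra|].
      apply exp_double_le; lra.
    - pose proof (Hpow x (nu + 3 / 2) (a + Rmax a 0 + 1 + 1) Hx ltac:(unfold a in *; lra)).
      replace (a + 1 + 1) with (nu + 3 / 2) by (unfold a; field).
      assert (0 < M * C) by nra. nra. }
  exists (2 * C0 + 2 * M * C). split; [nra|].
  intros x lo hi Hx Hl Hh. pose proof (Rpower_pos x (- (nu + 3 / 2))) as Hp.
  assert (0 < M * C) by nra.
  split; [|split].
  - eapply Rle_trans; [apply B0; lra|]. fold a.
    pose proof (Hpow x (nu + 1 / 2) (a + Rmax a 0 + 1) Hx ltac:(unfold a in *; lra)).
    replace (a + 1) with (nu + 1 / 2) by (unfold a; field).
    pose proof (Rpower_pos x (- (nu + 1 / 2))). nra.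
  - destruct (RInt_sub_laplace nu x (cos (x - phase nu)) lo hi
      (kernel (amp_c nu) (amp_s nu) x) Hl Hh (continuous_kernel0 nu x)) as [E Hcn].
    unfold K0, kernel_int. rewrite <- E.
    eapply Rle_trans; [apply (Herr _ x lo hi Hx Hl Hh Hcn)|nra].
    intros s Hs. rewrite kernel0_eq. unfold laplace_weight. fold a.
    replace (exp (- (2 * x * s)) * (rho a s * cos (x + theta nu s)) -
       cos (x - phase nu) * (Rpower s a * exp (- (2 * x * s)))) with
      (exp (- (2 * x * s)) * (rho a s * cos (x + theta nu s) - Rpower s a * cos (x - phase nu)))
      by ring.
    pose proof (exp_pos (- (2 * x * s))) as He. pose proof (rho_bound_pos a s) as Hrb.
    rewrite Rabs_mult, (Rabs_pos_eq (exp _)) by lra.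
    assert (Hae := amplitude_error nu x s cos ltac:(lra) Hs cos_lipschitz
      (fun u => Rabs_le _ _ (COS_bound u))). simpl in Hae. fold a cr in Hae.
    apply Rle_trans with (exp (- (2 * x * s)) * (M * (s * rho_bound a s))); [|right; ring].
    apply Rmult_le_compat_l; [lra|]. eapply Rle_trans; [exact Hae|].
    apply Rmult_le_compat_r; [apply Rmult_le_pos; lra|]. unfold M. lra.
  - destruct (RInt_sub_laplace nu x (- sin (x - phase nu)) lo hi
      (kernel (amp_c1 nu) (amp_s1 nu) x) Hl Hh (continuous_kernel1 nu x)) as [E Hcn].
    unfold K1, kernel_int. rewrite <- E.
    eapply Rle_trans; [apply (Herr _ x lo hi Hx Hl Hh Hcn)|nra].
    intros s Hs. rewrite kernel1_eq. unfold laplace_weight. fold a.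
    replace (- (exp (- (2 * x * s)) * (rho a s * (2 * s * cos (x + theta nu s) +
         sin (x + theta nu s)))) -
       - sin (x - phase nu) * (Rpower s a * exp (- (2 * x * s)))) with
      (- (exp (- (2 * x * s)) * ((rho a s * sin (x + theta nu s) - Rpower s a * sin (x - phase nu))
        + 2 * s * rho a s * cos (x + theta nu s)))) by ring.
    pose proof (exp_pos (- (2 * x * s))) as He. pose proof (rho_bound_pos a s) as Hrb.
    rewrite Rabs_Ropp, Rabs_mult, (Rabs_pos_eq (exp _)) by lra.
    assert (Hae := amplitude_error nu x s sin ltac:(lra) Hs sin_lipschitz
      (fun u => Rabs_le _ _ (SIN_bound u))). simpl in Hae. fold a cr in Hae.
    apply Rle_trans with (exp (- (2 * x * s)) * (M * (s * rho_bound a s))); [|right; ring].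
    apply Rmult_le_compat_l; [lra|]. eapply Rle_trans; [apply Rabs_triang|].
    assert (Rabs (2 * s * rho a s * cos (x + theta nu s)) <= 2 * cr * (s * rho_bound a s)).
    { pose proof (rho_pos a s). pose proof (rho_le a s Hs) as Hrl. fold cr in Hrl.
      rewrite Rabs_mult, (Rabs_pos_eq (2 * s * rho a s)) by nra.
      assert (Rabs (cos (x + theta nu s)) <= 1) by apply Rabs_le, COS_bound.
      apply Rle_trans with (2 * s * rho a s * 1); [apply Rmult_le_compat_l; nra|]. nra. }
    unfold M. lra.
Qed.

(** Only [[1 / (2 x), 1 / x]] is kept. There [x * s] lies between [1/2] and 1, so [s ^ a] is at
    least [2 ^ (- Rabs a) * x ^ (- a)] for either sign of [a]. *)
Lemma laplace_int_ge (nu : R) : exists c, 0 < c /\ forall x lo hi,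
  0 < x -> 0 < lo -> lo <= / (2 * x) -> / x <= hi ->
  c * Rpower x (- (nu + 1 / 2)) <= laplace_int nu lo hi x.
Proof.
  set (a := nu - 1 / 2). set (m := Rpower 2 (- Rabs a)).
  pose proof (Rpower_pos 2 (- Rabs a)) as Hm. fold m in Hm. pose proof (exp_pos (- 2)) as He2.
  exists (m * exp (- 2) / 2). split; [nra|].
  intros x lo hi Hx Hl H1 H2. unfold laplace_int. fold a.
  assert (Hi : / x = 2 * / (2 * x)) by (field; lra).
  pose proof (Rinv_0_lt_compat (2 * x) ltac:(lra)) as Hi2.
  eapply Rle_trans; [|apply (RInt_mono_bounds _ (/ (2 * x)) (/ x) lo hi)]; try lra.
  2: { intros; now apply continuous_laplace_weight. }
  2: { intros; left; apply laplace_weight_pos. }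
  set (v := Rpower x (- a) * m * exp (- 2)).
  replace (m * exp (- 2) / 2 * Rpower x (- (nu + 1 / 2))) with ((/ x - / (2 * x)) * v).
  2: { unfold v. replace (- (nu + 1 / 2)) with (- a + - (1)) by (unfold a; field).
       rewrite Rpower_plus, (Rpower_Ropp x 1), Rpower_1 by easy. field. lra. }
  assert (Hcst : is_RInt (fun _ : R => v) (/ (2 * x)) (/ x) ((/ x - / (2 * x)) * v))
    by apply (is_RInt_const (V := R_NormedModule)).
  rewrite <- (is_RInt_unique _ _ _ _ Hcst).
  apply RInt_le; try lra.
  - eexists; exact Hcst.
  - apply ex_RInt_laplace_weight; lra.
  - intros s Hs. unfold v, laplace_weight.
    assert (Hs0 : 0 < s) by lra.
    assert (Hxs : 1 / 2 < x * s < 1).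
    { split.
      - apply Rmult_lt_reg_l with (/ x); [lra|].
        replace (/ x * (x * s)) with s by (field; lra).
        replace (/ x * (1 / 2)) with (/ (2 * x)) by (field; lra). lra.
      - apply Rmult_lt_reg_l with (/ x); [lra|].
        replace (/ x * (x * s)) with s by (field; lra). lra. }
    apply Rmult_le_compat.
    + pose proof (Rpower_pos x (- a)). nra.
    + lra.
    + apply Rmult_le_reg_l with (Rpower x a); [apply Rpower_pos|].
      rewrite Rpower_Ropp, <- Rmult_assoc, Rinv_r by (apply Rgt_not_eq, Rpower_pos).
      rewrite Rmult_1_l, Rpower_mult_distr by easy. unfold m, Rpower. apply exp_le_exp.
      assert (Hln : ln (1 / 2) <= ln (x * s)) by (apply ln_le; lra).
      assert (Hln2 : ln (x * s) <= 0) by (rewrite <- ln_1; apply ln_le; lra).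
      replace (1 / 2) with (/ 2) in Hln by field. rewrite ln_Rinv in Hln by lra.
      pose proof (Rle_abs a). pose proof (Rle_abs (- a)). rewrite Rabs_Ropp in *. nra.
    + apply exp_le_exp. nra.
Qed.

(** With [a = nu - 1/2] and [P = max a 0], [K0] and [K1] are [O(x ^ (- (a + P + 1)))]; against
    [x ^ (2 a + 2)] an exponent [a + 1 - P >= 1/2] is left. This is where recessiveness at 0 enters:
    a solution independent of [bessel_L] would leave a nonzero limit. *)
Lemma Omega_small (nu : R) : 0 <= nu -> exists C eta, 0 < C /\ 0 < eta /\
  forall x lo hi, 0 < x < eta -> 0 < lo -> lo <= hi ->
  Rabs (Omega nu lo hi x) <= C * sqrt x.
Proof.
  intros H. destruct (K0_le nu H) as [C0 [HC0 B0]]. destruct (K1_le nu H) as [C1 [HC1 B1]].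
  destruct (bessel_L_near0 nu H) as (eta & B & He & HB).
  assert (HBp : 0 < B) by (destruct (HB (eta / 2) ltac:(lra)); lra).
  exists (2 * (C0 + C1) * B), (Rmin 1 eta).
  split; [nra|]. split; [apply Rmin_glb_lt; lra|].
  intros x lo hi [Hx Hx2] Hl Hh.
  pose proof (Rmin_l 1 eta). pose proof (Rmin_r 1 eta).
  destruct (HB x ltac:(lra)) as [HL HL'].
  set (a := nu - 1 / 2) in *. pose proof (Rmax_l a 0). pose proof (Rmax_r a 0).
  set (P := Rmax a 0) in *.
  assert (HP : P <= a + 1 / 2).
  { unfold P, Rmax. destruct (Rle_dec a 0); unfold a in *; lra. }
  specialize (B0 x lo hi Hx Hl Hh). specialize (B1 x lo hi Hx Hl Hh). fold a P in B0, B1.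
  assert (Hpw : Rpower x (- (a + 1)) <= Rpower x (- (a + P + 1)))
    by (apply Rpower_le_exponent_small; lra).
  set (p := Rpower x (- (a + P + 1))) in *.
  assert (Hp : 0 < p) by apply Rpower_pos.
  assert (B0' : Rabs (K0 nu lo hi x) <= 2 * C0 * p) by nra.
  assert (B1' : Rabs (K1 nu lo hi x) <= 2 * C1 * p) by nra.
  assert (HL2 : Rabs (bessel_L' nu x) <= B) by nra.
  unfold Omega. pose proof (Rpower_pos x (2 * nu + 1)) as Hq.
  rewrite Rabs_mult, (Rabs_pos_eq (Rpower x _)) by lra.
  assert (Hsum : Rabs (K0 nu lo hi x * bessel_L' nu x - K1 nu lo hi x * bessel_L nu x)
    <= 2 * (C0 + C1) * B * p).
  { eapply Rle_trans; [apply Rabs_triang|]. rewrite Rabs_Ropp, !Rabs_mult.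
    rewrite (Rabs_pos_eq (bessel_L nu x)) by lra.
    assert (Rabs (K0 nu lo hi x) * Rabs (bessel_L' nu x) <= 2 * C0 * p * B)
      by (apply Rmult_le_compat; auto using Rabs_pos).
    assert (Rabs (K1 nu lo hi x) * bessel_L nu x <= 2 * C1 * p * B)
      by (apply Rmult_le_compat; auto using Rabs_pos; lra).
    lra. }
  apply Rle_trans with (Rpower x (2 * nu + 1) * (2 * (C0 + C1) * B * p)).
  { apply Rmult_le_compat_l; lra. }
  replace (Rpower x (2 * nu + 1) * (2 * (C0 + C1) * B * p))
    with (2 * (C0 + C1) * B * (Rpower x (2 * nu + 1) * p)) by ring.
  apply Rmult_le_compat_l; [nra|].
  unfold p. rewrite <- Rpower_plus, <- Rpower_sqrt by easy.
  apply Rpower_le_exponent_small; [lra|]. unfold a in *. lra.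
Qed.

(** * Boundary terms and the limit of the Wronskian *)

Lemma boundary_le (nu x s : R) : 0 < s ->
  Rabs (boundary nu x s) <=
  2 * s * (s + 1) * (Rpower 2 (Rmax (nu - 1 / 2) 0 / 2) * rho_bound (nu - 1 / 2) s) *
  exp (- (2 * x * s)).
Proof.
  intros Hs. unfold boundary. rewrite amp_c_cos, amp_c_sin.
  set (a := nu - 1 / 2). set (c := cos (x + theta nu s)). set (S := sin (x + theta nu s)).
  pose proof (rho_pos a s). pose proof (rho_le a s Hs). pose proof (exp_pos (- (2 * x * s))).
  replace (- 2 * s * exp (- (2 * x * s)) * (s * (rho a s * c) + rho a s * S)) with
    (- (2 * s * exp (- (2 * x * s)) * rho a s * (s * c + S))) by ring.
  assert (Hc : Rabs c <= 1) by apply Rabs_le, COS_bound.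
  assert (HS : Rabs S <= 1) by apply Rabs_le, SIN_bound.
  rewrite Rabs_Ropp, Rabs_mult, (Rabs_pos_eq (2 * s * _ * _)).
  2: { apply Rmult_le_pos; [|lra]. apply Rmult_le_pos; lra. }
  assert (Rabs (s * c + S) <= s + 1).
  { eapply Rle_trans; [apply Rabs_triang|]. rewrite Rabs_mult, (Rabs_pos_eq s) by lra. nra. }
  apply Rle_trans with (2 * s * exp (- (2 * x * s)) *
    (Rpower 2 (Rmax a 0 / 2) * rho_bound a s) * (s + 1)); [|right; ring].
  assert (0 < 2 * s * exp (- (2 * x * s))) by (apply Rmult_lt_0_compat; lra).
  apply Rmult_le_compat; auto using Rabs_pos.
  - apply Rmult_le_pos; lra.
  - apply Rmult_le_compat_l; lra.
Qed.

Lemma boundary_at_infinity (nu x0 : R) : 0 < x0 -> exists C, 0 < C /\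
  forall x s, x0 <= x -> 1 <= s -> Rabs (boundary nu x s) <= C / s.
Proof.
  intros Hx0. set (a := nu - 1 / 2). set (cr := Rpower 2 (Rmax a 0 / 2)).
  assert (Hcr : 0 < cr) by apply Rpower_pos.
  pose proof (Rabs_pos a) as Ha.
  destruct (Rpower_le_exp (2 * Rabs a + 2) x0) as [C [HC HE]]; [lra|easy|].
  exists (8 * cr * C / x0). split; [apply Rdiv_lt_0_compat; nra|].
  intros x s Hx Hs. eapply Rle_trans; [apply boundary_le; lra|]. fold a cr.
  assert (Hrb : rho_bound a s <= 2 * Rpower s (2 * Rabs a)).
  { unfold rho_bound. pose proof (Rle_abs a).
    assert (Rmax a 0 <= Rabs a) by (apply Rmax_lub; lra).
    assert (Rpower s a <= Rpower s (2 * Rabs a)) by (apply Rle_Rpower; lra).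
    assert (Rpower s (a + Rmax a 0) <= Rpower s (2 * Rabs a)) by (apply Rle_Rpower; lra).
    lra. }
  pose proof (rho_bound_pos a s) as Hrb0.
  apply Rle_trans with (8 * cr * (C * exp (x0 * s)) * exp (- (2 * x0 * s))).
  - apply Rmult_le_compat.
    + apply Rmult_le_pos; [nra|]. apply Rmult_le_pos; lra.
    + left; apply exp_pos.
    + specialize (HE s ltac:(lra)). rewrite Rpower_plus in HE.
      replace (Rpower s 2) with (s ^ 2) in HE
        by (rewrite <- Rpower_pow by lra; f_equal; simpl; ring).
      apply Rle_trans with (8 * cr * (Rpower s (2 * Rabs a) * s ^ 2)).
      * apply Rle_trans with (4 * s ^ 2 * (cr * (2 * Rpower s (2 * Rabs a)))); [|right; ring].
        apply Rmult_le_compat; try nra.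
      * apply Rmult_le_compat_l; [lra|]. exact HE.
    + apply exp_le_exp. nra.
  - rewrite !Rmult_assoc, <- exp_plus.
    replace (x0 * s + - (2 * (x0 * s))) with (- (x0 * s)) by ring.
    pose proof (mul_exp_neg_le (x0 * s)) as Hm.
    assert (0 < x0 * s) by nra.
    apply Rle_trans with (8 * (cr * (C * / (x0 * s)))); [|right; field; lra].
    apply Rmult_le_compat_l; [lra|]. apply Rmult_le_compat_l; [lra|].
    apply Rmult_le_compat_l; [lra|].
    apply Rmult_le_reg_l with (x0 * s); [easy|]. rewrite Rinv_r by lra. easy.
Qed.

Lemma boundary_at_0 (nu : R) : 0 <= nu -> exists C, 0 < C /\
  forall x s, 0 < x -> 0 < s <= 1 -> Rabs (boundary nu x s) <= C * sqrt s.
Proof.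
  intros H. set (a := nu - 1 / 2). set (cr := Rpower 2 (Rmax a 0 / 2)).
  assert (Hcr : 0 < cr) by apply Rpower_pos. pose proof (Rmax_r a 0) as Hm.
  exists (8 * cr). split; [lra|].
  intros x s Hx Hs. eapply Rle_trans; [apply boundary_le; lra|]. fold a cr.
  assert (Hrb : rho_bound a s <= 2 * Rpower s a).
  { unfold rho_bound.
    assert (Rpower s (a + Rmax a 0) <= Rpower s a) by (apply Rpower_le_exponent_small; lra).
    lra. }
  pose proof (rho_bound_pos a s) as Hrb0.
  assert (Hsq : s * Rpower s a <= sqrt s).
  { rewrite <- Rpower_S, <- Rpower_sqrt by lra.
    apply Rpower_le_exponent_small; [lra|unfold a; lra]. }
  assert (exp (- (2 * x * s)) <= 1) by (rewrite <- exp_0; apply exp_le_exp; nra).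
  pose proof (exp_pos (- (2 * x * s))).
  apply Rle_trans with (8 * cr * (s * Rpower s a) * 1).
  - pose proof (Rpower_pos s a). apply Rmult_le_compat; try lra.
    + apply Rmult_le_pos; [nra|]. apply Rmult_le_pos; lra.
    + apply Rle_trans with (4 * s * (cr * (2 * Rpower s a))); [|right; ring].
      apply Rmult_le_compat; try nra.
  - rewrite Rmult_1_r. apply Rmult_le_compat_l; lra.
Qed.

Lemma exists_pos_sqrt_le (C e M : R) : 0 < C -> 0 < e -> 0 < M ->
  exists t, 0 < t < M /\ C * sqrt t <= e.
Proof.
  intros HC He HM. set (u := (e / C) ^ 2).
  assert (Hu : 0 < u) by (apply pow_lt, Rdiv_lt_0_compat; lra).
  exists (Rmin u (M / 2)). pose proof (Rmin_l u (M / 2)). pose proof (Rmin_r u (M / 2)).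
  assert (0 < Rmin u (M / 2)) by (apply Rmin_glb_lt; lra).
  split; [lra|].
  apply Rle_trans with (C * (e / C)); [|right; field; lra].
  apply Rmult_le_compat_l; [lra|].
  rewrite <- (sqrt_pow2 (e / C)) by (left; apply Rdiv_lt_0_compat; lra).
  now apply sqrt_le_1_alt.
Qed.

(** A point [x0] near 0 is fixed first, where [Omega] is small for every truncation. From [x0] to
    [x] it changes only through boundary terms, which vanish as [r] grows, uniformly on
    [[x0, x]]. *)
Lemma Omega_tends_0 (nu x eps : R) : 0 <= nu -> 0 < x -> 0 < eps ->
  exists R0, 1 <= R0 /\ forall r, R0 <= r -> Rabs (Omega nu (/ r) r x) <= eps.
Proof.
  intros H Hx He.
  destruct (Omega_small nu H) as (C & eta & HC & Heta & Hsmall).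
  destruct (exists_pos_sqrt_le C (eps / 2) (Rmin eta x)) as [x0 [Hx0 Hs0]];
    [easy|lra|apply Rmin_glb_lt; lra|].
  pose proof (Rmin_l eta x). pose proof (Rmin_r eta x).
  set (f := fun y => Rpower y (2 * nu) * bessel_L nu y).
  destruct (continuity_ab_maj (fun y => Rabs (f y)) x0 x) as [ym [HM _]]; [lra| |].
  { intros y Hy. apply (continuity_pt_comp f Rabs); [|apply Rcontinuity_abs].
    apply (continuity_pt_mult (fun y => Rpower y (2 * nu)) (bessel_L nu)).
    - eapply is_derive_continuity_pt. apply is_derive_Rpower. lra.
    - eapply is_derive_continuity_pt. now apply is_derive_bessel_L. }
  set (M := Rabs (f ym) + 1). pose proof (Rabs_pos (f ym)).
  assert (HM0 : 0 < M) by (unfold M; lra).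
  destruct (boundary_at_infinity nu x0) as [C1 [HC1 Hinf]]; [lra|].
  destruct (boundary_at_0 nu H) as [C2 [HC2 Hzero]].
  set (e1 := eps / (4 * M * x)).
  assert (He1 : 0 < e1) by (apply Rdiv_lt_0_compat; nra).
  destruct (exists_pos_sqrt_le C2 e1 1) as [t [Ht Hst]]; [easy|easy|lra|].
  set (R0 := Rmax (/ t) (C1 / e1)).
  assert (Hti : 1 < / t).
  { rewrite <- Rinv_1. apply Rinv_lt_contravar; lra. }
  exists (Rmax 1 R0). split; [apply Rmax_l|]. intros r Hr.
  pose proof (Rmax_l 1 R0). pose proof (Rmax_r 1 R0).
  pose proof (Rmax_l (/ t) (C1 / e1)). pose proof (Rmax_r (/ t) (C1 / e1)).
  fold R0 in H5, H6.
  assert (Hir : 0 < / r <= t).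
  { split; [apply Rinv_0_lt_compat; lra|]. rewrite <- (Rinv_inv t).
    apply Rinv_le_contravar; lra. }
  assert (Hir2 : / r <= r) by lra.
  assert (Hd : Rabs (Omega nu (/ r) r x - Omega nu (/ r) r x0) <= M * (2 * e1) * (x - x0)).
  { apply (Rabs_sub_le_of_is_derive _ (fun y => - (Rpower y (2 * nu) * bessel_L nu y *
      (boundary nu y r - boundary nu y (/ r))))); [lra| |].
    - intros y Hy. apply is_derive_Omega; lra.
    - intros y Hy. rewrite Rabs_Ropp, Rabs_mult.
      apply Rmult_le_compat; auto using Rabs_pos.
      + specialize (HM y Hy). cbv beta in HM. change (Rabs (f y) <= M). unfold M. lra.
      + eapply Rle_trans; [apply Rabs_triang|]. rewrite Rabs_Ropp.
        assert (Rabs (boundary nu y r) <= e1).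
        { eapply Rle_trans; [apply Hinf; lra|].
          apply Rmult_le_reg_r with (r / e1); [apply Rdiv_lt_0_compat; lra|].
          replace (C1 / r * (r / e1)) with (C1 / e1) by (field; lra).
          replace (e1 * (r / e1)) with r by (field; lra). lra. }
        assert (Rabs (boundary nu y (/ r)) <= e1).
        { eapply Rle_trans; [apply Hzero; lra|]. eapply Rle_trans; [|exact Hst].
          apply Rmult_le_compat_l; [lra|]. apply sqrt_le_1_alt. lra. }
        lra. }
  assert (H7 : M * (2 * e1) * (x - x0) <= eps / 2).
  { apply Rle_trans with (M * (2 * e1) * x).
    - apply Rmult_le_compat_l; nra.
    - right. unfold e1. field. lra. }
  specialize (Hsmall x0 (/ r) r ltac:(lra) ltac:(lra) Hir2).
  replace (Omega nu (/ r) r x) with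
    ((Omega nu (/ r) r x - Omega nu (/ r) r x0) + Omega nu (/ r) r x0) by ring.
  eapply Rle_trans; [apply Rabs_triang|]. lra.
Qed.

Lemma wronskian_tends_0 (nu x eps : R) : 0 <= nu -> 0 < x -> 0 < eps ->
  exists R0, 1 <= R0 /\ forall r, R0 <= r ->
  Rabs (K0 nu (/ r) r x * bessel_L' nu x - K1 nu (/ r) r x * bessel_L nu x) <= eps.
Proof.
  intros H Hx He. pose proof (Rpower_pos x (2 * nu + 1)) as Hp.
  destruct (Omega_tends_0 nu x (Rpower x (2 * nu + 1) * eps) H Hx) as [R0 [H1 HR]]; [nra|].
  exists R0. split; [easy|]. intros r Hr. specialize (HR r Hr). unfold Omega in HR.
  rewrite Rabs_mult, (Rabs_pos_eq (Rpower x _)) in HR by lra.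
  now apply Rmult_le_reg_l in HR.
Qed.

(** If [L = 0], the small Wronskian leaves [K0] small; if [x L' = d L], it leaves [K1] close to
    [d / x * K0]. Dividing by [laplace_int], of order at least [x * p], bounds the cosine or the
    sine. The truncation depends on [x], the constant does not. *)
Lemma phase_of_zeros (nu : R) : 0 <= nu -> exists C, 0 < C /\ forall x, 1 <= x ->
  (bessel_L nu x = 0 -> bessel_L' nu x <> 0 -> Rabs (cos (x - phase nu)) <= C / x) /\
  (forall d, bessel_L nu x <> 0 -> x * bessel_L' nu x = d * bessel_L nu x ->
     Rabs (sin (x - phase nu)) <= C * (1 + Rabs d) / x).
Proof.
  intros H. destruct (K_asymp nu H) as [C [HC HK]]. destruct (laplace_int_ge nu) as [c [Hc HG]].
  exists ((1 + C) / c). split; [apply Rdiv_lt_0_compat; lra|].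
  intros x Hx. set (p := Rpower x (- (nu + 3 / 2))).
  assert (Hp : 0 < p) by apply Rpower_pos.
  assert (Ep : Rpower x (- (nu + 1 / 2)) = x * p).
  { unfold p. rewrite <- Rpower_S by lra. f_equal. field. }
  pose proof (Rinv_0_lt_compat x ltac:(lra)) as Hix.
  assert (Hend : forall t Gv D, c * (x * p) <= Gv -> Rabs t * Gv <= D * p ->
    Rabs t <= D / c / x).
  { intros t Gv D HGv Ht. pose proof (Rabs_pos t).
    apply Rmult_le_reg_r with (c * (x * p)); [apply Rmult_lt_0_compat; nra|].
    replace (D / c / x * (c * (x * p))) with (D * p) by (field; lra).
    eapply Rle_trans; [|exact Ht]. apply Rmult_le_compat_l; lra. }
  assert (HR : forall r, 2 * x <= r -> c * (x * p) <= laplace_int nu (/ r) r x).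
  { intros r Hr. rewrite <- Ep. apply HG; try lra.
    - apply Rinv_0_lt_compat. lra.
    - apply Rinv_le_contravar; lra.
    - assert (/ x <= 1) by (rewrite <- Rinv_1; apply Rinv_le_contravar; lra). lra. }
  assert (Hlohi : forall r, 2 * x <= r -> 0 < / r /\ / r <= r).
  { intros r Hr. split; [apply Rinv_0_lt_compat; lra|].
    assert (/ r <= 1) by (rewrite <- Rinv_1; apply Rinv_le_contravar; lra). lra. }
  split.
  - intros L0 L1.
    (* This accuracy bounds [K0] by [p] after division by the modulus of [L']. *)
    destruct (wronskian_tends_0 nu x (Rabs (bessel_L' nu x) * p) H ltac:(lra)) as [R0 [HR0 Hw]].
    { apply Rmult_lt_0_compat; [now apply Rabs_pos_lt|easy]. }
    set (r := Rmax R0 (2 * x)). pose proof (Rmax_l R0 (2 * x)) as M1.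
    pose proof (Rmax_r R0 (2 * x)) as M2. fold r in M1, M2.
    specialize (Hw r M1). rewrite L0, Rmult_0_r, Rminus_0_r, Rabs_mult, Rmult_comm in Hw.
    apply Rmult_le_reg_l in Hw; [|now apply Rabs_pos_lt].
    destruct (Hlohi r M2) as [Hl Hh].
    destruct (HK x (/ r) r Hx Hl Hh) as (_ & HK0 & _). fold p in HK0.
    apply (Hend _ (laplace_int nu (/ r) r x)); [now apply HR|].
    specialize (HR r M2).
    assert (HG0 : 0 < laplace_int nu (/ r) r x)
      by (eapply Rlt_le_trans; [|exact HR]; repeat apply Rmult_lt_0_compat; lra).
    rewrite <- (Rabs_pos_eq (laplace_int nu (/ r) r x)) at 1 by lra. rewrite <- Rabs_mult.
    replace (cos (x - phase nu) * laplace_int nu (/ r) r x) with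
      (K0 nu (/ r) r x + - (K0 nu (/ r) r x - cos (x - phase nu) * laplace_int nu (/ r) r x))
      by ring.
    eapply Rle_trans; [apply Rabs_triang|]. rewrite Rabs_Ropp. lra.
  - intros d L0 Hd.
    destruct (wronskian_tends_0 nu x (Rabs (bessel_L nu x) * p) H ltac:(lra)) as [R0 [HR0 Hw]].
    { apply Rmult_lt_0_compat; [now apply Rabs_pos_lt|easy]. }
    set (r := Rmax R0 (2 * x)). pose proof (Rmax_l R0 (2 * x)) as M1.
    pose proof (Rmax_r R0 (2 * x)) as M2. fold r in M1, M2.
    specialize (Hw r M1).
    assert (EL : bessel_L' nu x = d / x * bessel_L nu x).
    { apply Rmult_eq_reg_l with x; [|lra]. rewrite Hd. field. lra. }
    rewrite EL in Hw.
    replace (K0 nu (/ r) r x * (d / x * bessel_L nu x) - K1 nu (/ r) r x * bessel_L nu x)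
      with (bessel_L nu x * (K0 nu (/ r) r x * (d / x) - K1 nu (/ r) r x)) in Hw by ring.
    rewrite Rabs_mult in Hw. apply Rmult_le_reg_l in Hw; [|now apply Rabs_pos_lt].
    destruct (Hlohi r M2) as [Hl Hh].
    destruct (HK x (/ r) r Hx Hl Hh) as (HK0 & _ & HK1). fold p in HK1. rewrite Ep in HK0.
    replace ((1 + C) / c * (1 + Rabs d) / x) with ((1 + C) * (1 + Rabs d) / c / x)
      by (field; lra).
    apply (Hend _ (laplace_int nu (/ r) r x)); [now apply HR|].
    specialize (HR r M2).
    assert (HG0 : 0 < laplace_int nu (/ r) r x)
      by (eapply Rlt_le_trans; [|exact HR]; repeat apply Rmult_lt_0_compat; lra).
    rewrite <- (Rabs_pos_eq (laplace_int nu (/ r) r x)) at 1 by lra. rewrite <- Rabs_mult.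
    set (k0 := K0 nu (/ r) r x) in *. set (k1 := K1 nu (/ r) r x) in *.
    set (g := laplace_int nu (/ r) r x) in *.
    replace (sin (x - phase nu) * g) with
      ((k1 - - sin (x - phase nu) * g) + ((k0 * (d / x) - k1) + - (k0 * (d / x)))) by ring.
    eapply Rle_trans; [apply Rabs_triang|].
    eapply Rle_trans; [apply Rplus_le_compat_l, Rabs_triang|]. rewrite Rabs_Ropp.
    assert (Rabs (k0 * (d / x)) <= C * p * Rabs d).
    { unfold Rdiv. rewrite !Rabs_mult, (Rabs_pos_eq (/ x)) by lra.
      apply Rle_trans with (C * (x * p) * (Rabs d * / x)).
      - apply Rmult_le_compat_r; [|easy]. apply Rmult_le_pos; [apply Rabs_pos|lra].
      - right. field. lra. }
    pose proof (Rabs_pos d). nra.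
Qed.

Lemma phase_of_BesselJ_zeros (nu : R) : 0 <= nu -> exists C, 0 < C /\ forall x, 1 <= x ->
  BesselJ nu x = 0 -> Rabs (cos (x - phase nu)) <= C / x.
Proof.
  intros H. destruct (phase_of_zeros nu H) as [C [HC HP]]. exists C. split; [easy|].
  intros x Hx Jx. assert (Hb := bessel_pair_BesselJ nu H).
  pose proof (energy_J_zero nu _ _ x Hb ltac:(lra) Jx) as HN.
  rewrite BesselJ_eq in Jx by lra. pose proof (Rpower_pos (x / 2) nu) as Hr.
  apply Rmult_integral in Jx. destruct Jx as [Jx|Jx]; [lra|].
  apply (HP x Hx); [easy|]. intros L1. apply HN. unfold bessel_N. rewrite Jx, L1. ring.
Qed.

Lemma phase_of_level_zeros (nu delta : R) : 0 <= nu -> exists C, 0 < C /\ forall x, 1 <= x ->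
  bessel_N nu x = delta * BesselJ nu x -> Rabs (sin (x - phase nu)) <= C / x.
Proof.
  intros H. destruct (phase_of_zeros nu H) as [C [HC HP]].
  pose proof (Rabs_pos (delta - nu)).
  (* As [N = (x / 2) ^ nu * (nu * L + x * L')], the equation [N = delta * J] reads
     [x L' = (delta - nu) L]. *)
  exists (C * (1 + Rabs (delta - nu))). split; [nra|].
  intros x Hx E. assert (Hb := bessel_pair_BesselJ nu H).
  pose proof (Rpower_pos (x / 2) nu) as Hr.
  assert (L0 : bessel_L nu x <> 0).
  { intros L0. assert (Jx : BesselJ nu x = 0) by (rewrite BesselJ_eq, L0 by lra; ring).
    apply (energy_J_zero nu _ _ x Hb ltac:(lra) Jx). rewrite E, Jx. ring. }
  apply (HP x Hx); [easy|].
  rewrite BesselJ_eq in E by lra. unfold bessel_N in E.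
  apply Rmult_eq_reg_l with (Rpower (x / 2) nu); [|lra]. lra.
Qed.

(** * Asymptotics of the critical points *)

Lemma h_Phi (nu x : R) : Phi nu x = PI * h nu x.
Proof. reflexivity. Qed.

Lemma h_at_nu (nu : R) : 0 <= nu -> h nu nu = 0.
Proof.
  intros [H| <-].
  - unfold h, g. replace (nu / nu) with 1 by (field; lra).
    rewrite acos_1. replace (1 - 1 ^ 2) with 0 by ring. rewrite sqrt_0. field.
    apply PI_neq0.
  - unfold h. ring.
Qed.

Lemma h_incr (nu a b : R) : 0 <= nu < a -> a < b -> h nu a < h nu b.
Proof.
  intros H Hab. pose proof (Phi_incr nu a b H Hab). pose proof PI_RGT_0.
  rewrite !h_Phi in *. now apply Rmult_lt_reg_l in H0.
Qed.

(** The threshold lets the intermediate value theorem start at [nu + 1], where [Phi] is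
    differentiable, and makes [y] positive, which excludes the value [nu]. *)
Lemma h_inv_spec (nu y : R) : 0 <= nu -> h nu (nu + 1) < y ->
  nu < h_inv nu y /\ h nu (h_inv nu y) = y.
Proof.
  intros H Hy. pose proof PI_RGT_0 as Hpi.
  assert (Hpos : 0 < h nu (nu + 1)).
  { pose proof (Phi_pos nu (nu + 1) ltac:(lra)) as Hp. rewrite h_Phi in Hp. nra. }
  assert (Hex : exists x, nu <= x /\ h nu x = y).
  { destruct (Phi_unbounded nu (PI * y) H) as [X [HX HXy]].
    set (b := Rmax X (nu + 2)). specialize (HXy b (Rmax_l _ _)).
    pose proof (Rmax_r X (nu + 2)) as Hb. fold b in Hb.
    destruct (IVT_interv (fun x => Phi nu x - PI * y) (nu + 1) b) as [x [Hx E]].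
    - intros t Ht. apply (continuity_pt_minus (Phi nu) (fun _ => PI * y)).
      + eapply is_derive_continuity_pt. apply is_derive_Phi. lra.
      + apply continuity_pt_const. now intros ? ?.
    - lra.
    - rewrite h_Phi. nra.
    - lra.
    - exists x. split; [lra|]. rewrite h_Phi in E.
      apply Rmult_eq_reg_l with PI; lra. }
  assert (HS : nu <= h_inv nu y /\ h nu (h_inv nu y) = y).
  { unfold h_inv. apply (epsilon_spec (inhabits 0) (fun x => nu <= x /\ h nu x = y) Hex). }
  destruct HS as [[H1|H1] H2]; [now split|].
  rewrite <- H1, h_at_nu in H2 by easy. lra.
Qed.

Lemma lt_h_inv (nu x y : R) : 0 <= nu < x -> h nu (nu + 1) < y -> h nu x < y ->
  x < h_inv nu y.
Proof.
  intros H Hy Hx. destruct (h_inv_spec nu y ltac:(lra) Hy) as [H1 H2].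
  destruct (Rtotal_order x (h_inv nu y)) as [L|[E|L]]; [easy| |].
  - rewrite <- E in H2. lra.
  - pose proof (h_incr nu (h_inv nu y) x ltac:(lra) L). lra.
Qed.

Lemma h_inv_lt (nu x y : R) : 0 <= nu < x -> h nu (nu + 1) < y -> y < h nu x ->
  h_inv nu y < x.
Proof.
  intros H Hy Hx. destruct (h_inv_spec nu y ltac:(lra) Hy) as [H1 H2].
  destruct (Rtotal_order x (h_inv nu y)) as [L|[E|L]]; [| |easy].
  - pose proof (h_incr nu x (h_inv nu y) ltac:(lra) L). lra.
  - rewrite <- E in H2. lra.
Qed.

(** * Windows for the phase of a zero *)

Lemma Rabs_sin_shift (u : R) (m : nat) : Rabs (sin (u + INR m * PI)) = Rabs (sin u).
Proof.
  induction m as [|m IH].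
  - simpl. f_equal. f_equal. ring.
  - rewrite S_INR. replace (u + (INR m + 1) * PI) with (u + INR m * PI + PI) by ring.
    now rewrite neg_sin, Rabs_Ropp.
Qed.

Lemma sin_ge_pi8 (u : R) : PI / 8 <= u <= 7 * PI / 8 -> sin (PI / 8) <= sin u.
Proof.
  intros H. pose proof PI_RGT_0. destruct (Rle_lt_dec u (PI / 2)) as [L|L].
  - apply sin_incr_1; lra.
  - rewrite <- (sin_PI_x u). apply sin_incr_1; lra.
Qed.

Lemma Rabs_sin_ge_pi8 (u : R) :
  PI / 8 <= u <= 7 * PI / 8 \/ - (7 * PI / 8) <= u <= - (PI / 8) \/
  9 * PI / 8 <= u <= 15 * PI / 8 ->
  sin (PI / 8) <= Rabs (sin u).
Proof.
  intros [H|[H|H]].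
  - eapply Rle_trans; [now apply sin_ge_pi8|]. apply Rle_abs.
  - rewrite <- Rabs_Ropp, <- sin_neg.
    eapply Rle_trans; [apply (sin_ge_pi8 (- u)); lra|]. apply Rle_abs.
  - replace u with (u - PI + PI) by ring. rewrite neg_sin, Rabs_Ropp.
    eapply Rle_trans; [apply (sin_ge_pi8 (u - PI)); lra|]. apply Rle_abs.
Qed.

(** The only zero of the sine in range is at [v = 3 PI / 4], and the tolerance [sin (PI / 8)] allows
    a deviation of [PI / 8]. *)
Lemma zero_window (v : R) : 0 < v <= PI -> Rabs (sin (v + PI / 4)) < sin (PI / 8) ->
  5 * PI / 8 < v < 7 * PI / 8.
Proof.
  intros H Hs. pose proof PI_RGT_0. split; apply Rnot_le_lt; intros Hle;
    pose proof (Rabs_sin_ge_pi8 (v + PI / 4)); lra.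
Qed.

(** The range of [v] is what the windows of two consecutive zeros of [J] leave, [- (3 PI / 8)] being
    [5 PI / 8 - PI]. It excludes the zeros [- 3 PI / 4] and [5 PI / 4] of the sine; the deviation
    from [PI / 4] is then below [PI / 8]. *)
Lemma extremum_window (v : R) : - (3 * PI / 8) < v < 7 * PI / 8 ->
  Rabs (sin (v - PI / 4)) < sin (PI / 8) -> 0 < v < 3 * PI / 8.
Proof.
  intros H Hs. pose proof PI_RGT_0. split; apply Rnot_le_lt; intros Hle;
    pose proof (Rabs_sin_ge_pi8 (v - PI / 4)); lra.
Qed.

Lemma level_zero_asymptotics (nu delta : R) : 0 <= nu -> exists K : nat,
  (1 <= K)%nat /\ forall k : nat, (K <= k)%nat ->
    PI * (INR k + nu / 2 - 1 / 2) < h_inv nu (INR k) /\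
    h_inv nu (INR k) < level_zero (BesselJ nu) (bessel_N nu) delta k /\
    level_zero (BesselJ nu) (bessel_N nu) delta k < h_inv nu (INR k + 3 / 8) /\
    h_inv nu (INR k + 3 / 8) < PI * (INR k + nu / 2 + 1 / 2).
Proof.
  intros H. assert (HP := bessel_pair_BesselJ nu H).
  set (J := BesselJ nu) in *. set (N := bessel_N nu) in *. set (z := zero_seq J) in *.
  destruct (phase_of_BesselJ_zeros nu H) as [C1 [HC1 P1]].
  destruct (phase_of_level_zeros nu delta H) as [C2 [HC2 P2]].
  pose proof PI_RGT_0 as Hpi. pose proof PI2_1 as Hpi1.
  set (s0 := sin (PI / 8)).
  assert (Hs0 : 0 < s0) by (apply sin_gt_0; lra).
  set (D := C1 + C2 + 3 * nu ^ 2 + 1).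
  pose proof (pow2_ge_0 nu) as Hnu2.
  assert (HD : 0 < D) by (unfold D; lra).
  (* Beyond [T] the phase errors, together at most [D / x], are below [sin (PI / 8)]. They are also
     at most [1/8], less than the distance [PI / 8] between [3 PI / 8] and [PI / 2] needed for the
     outermost bound. *)
  set (T := Rmax (2 * nu + 1) (Rmax (h nu (nu + 1) + 1) (Rmax (D / s0 + 1) (8 * D)))).
  assert (HT : 2 * nu + 1 <= T /\ h nu (nu + 1) + 1 <= T /\ D / s0 + 1 <= T /\ 8 * D <= T).
  { unfold T. repeat split.
    - apply Rmax_l.
    - eapply Rle_trans; [|apply Rmax_r]. apply Rmax_l.
    - eapply Rle_trans; [|apply Rmax_r]. eapply Rle_trans; [|apply Rmax_r]. apply Rmax_l.
    - eapply Rle_trans; [|apply Rmax_r]. eapply Rle_trans; [|apply Rmax_r]. apply Rmax_r. }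
  assert (Hbig : forall x, T <= x -> 0 < x /\ nu < x /\
     D / x < s0 /\ D / x <= 1 / 8 /\
     Rabs (Phi nu x - (x - nu * (PI / 2))) <= 3 * nu ^ 2 / x).
  { intros x Hx. assert (Hx0 : 0 < x) by lra. split; [easy|]. split; [lra|].
    split; [|split].
    - apply Rmult_lt_reg_r with (x / s0); [now apply Rdiv_lt_0_compat|].
      replace (D / x * (x / s0)) with (D / s0) by (field; lra).
      replace (s0 * (x / s0)) with x by (field; lra). lra.
    - apply Rmult_le_reg_r with x; [easy|]. unfold Rdiv at 1.
      rewrite Rmult_assoc, Rinv_l by lra. lra.
    - apply Phi_asymp; lra. }
  assert (HDx : forall x A, 0 < x -> 0 <= A <= D -> A / x <= D / x).
  { intros x A Hx HA. apply Rmult_le_compat_r; [left; now apply Rinv_0_lt_compat|lra]. }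
  destruct (INR_unbounded (T + 1)) as [K HK].
  exists (S K). split; [lia|]. intros k Hk.
  assert (HkT : T + 1 < INR k).
  { apply Rlt_le_trans with (INR K); [easy|]. apply le_INR. lia. }
  (* Counting puts [Phi] at this zero between [m * PI] and [(m + 1) * PI]; the asymptotic phase then
     narrows it to the window around [(m + 3/4) * PI]. *)
  assert (Hzw : forall m, (K <= m)%nat ->
    INR m * PI + 5 * PI / 8 < Phi nu (z (S m)) < INR m * PI + 7 * PI / 8).
  { intros m Hm. assert (Hm' : T < INR m) by (apply le_INR in Hm; lra).
    pose proof (zero_seq_ge nu J N HP m) as Hz. fold z in Hz.
    assert (HzT : T <= z (S m)) by nra.
    destruct (Hbig _ HzT) as (Hz0 & Hz1 & Hz2 & _ & Hz3).
    pose proof (P1 (z (S m)) ltac:(lra) (zero_seq_zero nu J N HP m)) as Hc.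
    pose proof (Phi_zero_seq_gt nu J N HP m) as G1.
    pose proof (Phi_zero_seq_le nu J N HP m) as G2. fold z in G1, G2.
    set (x := z (S m)) in *.
    assert (Hw : 5 * PI / 8 < Phi nu x - INR m * PI < 7 * PI / 8); [|lra].
    apply zero_window; [lra|].
    rewrite <- (Rabs_sin_shift _ m).
    replace (Phi nu x - INR m * PI + PI / 4 + INR m * PI)
      with (PI / 2 + (Phi nu x - PI / 4)) by field.
    rewrite <- cos_sin.
    replace (cos (Phi nu x - PI / 4)) with
      (cos (x - phase nu) + (cos (Phi nu x - PI / 4) - cos (x - phase nu))) by ring.
    eapply Rle_lt_trans; [apply Rabs_triang|].
    pose proof (cos_lipschitz (Phi nu x - PI / 4) (x - phase nu)) as Hl.
    replace (Phi nu x - PI / 4 - (x - phase nu)) with (Phi nu x - (x - nu * (PI / 2)))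
      in Hl by (unfold phase; field).
    apply Rle_lt_trans with (C1 / x + 3 * nu ^ 2 / x); [lra|].
    replace (C1 / x + 3 * nu ^ 2 / x) with ((C1 + 3 * nu ^ 2) / x) by (field; lra).
    eapply Rle_lt_trans; [apply HDx|exact Hz2]; [easy|unfold D; lra]. }
  destruct (level_zero_spec nu J N HP delta k) as [Hd1 Hd2]; [left; lia|].
  set (d := level_zero J N delta k) in *. fold z in Hd1.
  assert (Hdw : INR k * PI < Phi nu d < INR k * PI + 3 * PI / 8).
  { destruct k as [|k']; [lia|].
    pose proof (Hzw k' ltac:(lia)) as Z1. pose proof (Hzw (S k') ltac:(lia)) as Z2.
    pose proof (zero_seq_ge nu J N HP k') as Hz. fold z in Hz.
    rewrite S_INR in HkT.
    assert (HzT : T <= z (S k')) by nra.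
    pose proof (zero_seq_gt_nu nu J N HP k') as Hzn. fold z in Hzn.
    destruct (Hbig d ltac:(lra)) as (Hd0 & Hd3 & Hd4 & _ & Hd5).
    pose proof (P2 d ltac:(lra) Hd2) as Hs.
    pose proof (Phi_incr nu (z (S k')) d ltac:(lra) ltac:(lra)) as I1.
    pose proof (Phi_incr nu d (z (S (S k'))) ltac:(lra) ltac:(lra)) as I2.
    rewrite S_INR in *.
    assert (Hw : 0 < Phi nu d - (INR k' + 1) * PI < 3 * PI / 8); [|lra].
    apply extremum_window; [lra|].
    rewrite <- (Rabs_sin_shift _ (S k')), S_INR.
    replace (Phi nu d - (INR k' + 1) * PI - PI / 4 + (INR k' + 1) * PI)
      with (Phi nu d - PI / 4) by ring.
    replace (sin (Phi nu d - PI / 4)) with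
      (sin (d - phase nu) + (sin (Phi nu d - PI / 4) - sin (d - phase nu))) by ring.
    eapply Rle_lt_trans; [apply Rabs_triang|].
    pose proof (sin_lipschitz (Phi nu d - PI / 4) (d - phase nu)) as Hl.
    replace (Phi nu d - PI / 4 - (d - phase nu)) with (Phi nu d - (d - nu * (PI / 2)))
      in Hl by (unfold phase; field).
    apply Rle_lt_trans with (C2 / d + 3 * nu ^ 2 / d); [lra|].
    replace (C2 / d + 3 * nu ^ 2 / d) with ((C2 + 3 * nu ^ 2) / d) by (field; lra).
    eapply Rle_lt_trans; [apply HDx|exact Hd4]; [easy|unfold D; lra]. }
  assert (Hdn : nu < d).
  { pose proof (zero_seq_gt_nu nu J N HP (pred k)) as Hzn. fold z in Hzn.
    replace (S (pred k)) with k in Hzn by lia. lra. }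
  rewrite h_Phi in Hdw.
  assert (Hhd : INR k < h nu d < INR k + 3 / 8) by (split; nra).
  assert (Hkh : h nu (nu + 1) < INR k) by lra.
  assert (Hnp : 0 <= PI * (nu / 2)) by nra.
  repeat apply conj.
  (* At this [X], [Phi] is [PI * k - PI / 2] up to [1/8], hence below [PI * k]. *)
  - set (X := PI * (INR k + nu / 2 - 1 / 2)).
    assert (HX : T <= X) by (unfold X; nra).
    destruct (Hbig X HX) as (X0 & Xn & _ & X1 & X2).
    apply lt_h_inv; [lra|easy|].
    apply Rmult_lt_reg_l with PI; [easy|]. rewrite <- h_Phi.
    assert (3 * nu ^ 2 / X <= D / X) by (apply HDx; [easy|unfold D; lra]).
    pose proof (Rle_abs (Phi nu X - (X - nu * (PI / 2)))).
    assert (X - nu * (PI / 2) = PI * INR k - PI / 2) by (unfold X; field). lra.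
  - apply h_inv_lt; [lra|easy|lra].
  - apply lt_h_inv; [lra|lra|lra].
  - set (X := PI * (INR k + nu / 2 + 1 / 2)).
    assert (HX : T <= X) by (unfold X; nra).
    destruct (Hbig X HX) as (X0 & Xn & _ & X1 & X2).
    apply h_inv_lt; [lra|lra|].
    apply Rmult_lt_reg_l with PI; [easy|]. rewrite <- h_Phi.
    assert (3 * nu ^ 2 / X <= D / X) by (apply HDx; [easy|unfold D; lra]).
    pose proof (Rle_abs (- (Phi nu X - (X - nu * (PI / 2))))). rewrite Rabs_Ropp in *.
    assert (X - nu * (PI / 2) = PI * INR k + PI / 2) by (unfold X; field). lra.
Qed.

Theorem proposition4p10 (delta : R) :
  (forall (nu : R) (k : nat),
     nu >= Rabs delta -> (2 <= k)%nat ->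
     a' nu delta k > sqrt (nu ^ 2 + PI ^ 2 * (INR k - 5 / 4) ^ 2)) /\
  (forall nu : R,
     nu >= Rabs delta -> ~ (0 < nu /\ delta = - nu) ->
     exists K : nat, forall k : nat, (K <= k)%nat ->
       PI * (INR k + nu / 2 - 1 / 2) < h_inv nu (INR k) /\
       h_inv nu (INR k) < a' nu delta k /\
       a' nu delta k < h_inv nu (INR k + 3 / 8) /\
       h_inv nu (INR k + 3 / 8) < PI * (INR k + nu / 2 + 1 / 2)) /\
  (forall nu : R,
     0 < nu -> delta = - nu ->
     exists K : nat, forall k : nat, (K <= k)%nat ->
       PI * (INR k + nu / 2 - 1 / 2) < h_inv nu (INR k) /\
       h_inv nu (INR k) < a' nu delta (S k) /\
       a' nu delta (S k) < h_inv nu (INR k + 3 / 8) /\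
       h_inv nu (INR k + 3 / 8) < PI * (INR k + nu / 2 + 1 / 2)).
Proof.
  split; [|split].
  - intros nu k H Hk. apply a'_lower_bound; [lra|easy].
  - intros nu H Hn. pose proof (Rabs_pos delta).
    destruct (level_zero_asymptotics nu delta) as [K [HK Hb]]; [lra|].
    exists K. intros k Hk. rewrite a'_regular by (easy || lra || lia). now apply Hb.
  - intros nu H ->.
    destruct (level_zero_asymptotics nu (- nu)) as [K [HK Hb]]; [lra|].
    exists K. intros k Hk. rewrite a'_opposite by easy. now apply Hb.
Qed.
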